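(* Let $(X,\mu)$ be a measure space with a (separable) doubling ball-basis $\mathscr B$, let $1\le r<\infty$, let $\{T_\alpha\}$ be a family of uniformly restricted bounded oscillation operators $T_\alpha:L^r(X,\mathbb U)\to L^0(X,\mathbb V)$, and let $Tf=\sup_\alpha\|T_\alpha f\|_{\mathbb V}$. If $$C(T)=\mathcal L_0(T)+\sup_\alpha\mathcal L_1(T_\alpha)<\infty,$$ then for any $f\in L^r(X,\mathbb U)$ and a ball $B$ there exist a ball $B'\supset B$, a sparse collection of balls $\mathscr A$ and a martingale type collection of measurable sets $\bar{\mathscr A}\Subset\mathscr A$ such that $$\bigcup_{G\in\mathscr A}G\subset B',\qquad\mu(B')\lesssim\mu(B),$$ $$\mu\Big\{x\in X:\sum_{G\in\mathscr A}\mathbf 1_{\bar G}(x)>\lambda\Big\}\lesssim\exp(-c\lambda)\mu(B),\quad\lambda>0,$$ $$|Tf(x)-m(B)|\lesssim C(T)\sum_{G\in\mathscr A}\langle f\rangle^*_{\#,G}\,\mathbf 1_{\bar G}(x),\quad x\in B,$$ where $c>0$ is an admissible constant and $m(B)=m_{T(f)}(B)$ is a median of the real valued function $T(f)$ on $B$.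
   Context: Ball-basis. Let $(X,\mathfrak M,\mu)$ be a measure space. A family $\mathscr B$ of measurable sets (balls) is a ball-basis if: (B1) $0<\mu(B)<\infty$ for $B\in\mathscr B$; (B2) any two points lie in a common ball; (B3) for any $E\in\mathfrak M$, $\varepsilon>0$ there is a finite or infinite sequence of balls $B_k$ with $\mu(E\triangle\bigcup_kB_k)<\varepsilon$; (B4) for any $B\in\mathscr B$ there is a ball $[B]\in\mathscr B$ with $B^*:=\bigcup_{A\in\mathscr B:\ \mu(A)\le2\mu(B),\ A\cap B\ne\varnothing}A\subset[B]$ and $\mu([B])\le\mathcal K\mu(B)$, $\mathcal K$ independent of $B$. All ball-bases are assumed separable (arbitrary unions of balls are measurable). $\mathscr B$ is doubling if there is $\eta>1$ such that for every ball $B$ with $B^*\ne X$ there is a ball $B'\supsetneq B$ with $\mu(B')\le\eta\mu(B)$. Notation. $\mathbb U,\mathbb V$ are Banach spaces; $L^0(X,\mathbb V)$ is the space of measurable $\mathbb V$-valued functions. $\langle f\rangle_A=\big(\frac1{\mu(A)}\int_A\|f\|_{\mathbb U}^r\big)^{1/r}$, $\langle f\rangle_A^*=\sup_{C\in\mathscr B,C\supset A}\langle f\rangle_C$, $f_B=\frac1{\mu(B)}\int_Bf$, $\langle f\rangle_{\#,B}=\big(\frac1{\mu(B)}\int_B\|f-f_B\|_{\mathbb U}^r\big)^{1/r}$, $\langle f\rangle^*_{\#,B}=\sup_{A\in\mathscr B,A\supset B}\langle f\rangle_{\#,A}$. $\mathrm{OSC}_E(g)=\operatorname{esssup}_{x,x'\in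 E}\|g(x)-g(x')\|$, $\mathrm{SUP}_E(g)=\operatorname{esssup}_{x\in E}\|g(x)\|$ (norm of the space of values), and $\mathrm{OSC}_{B,\beta}(g)=\inf_{E\subset B:\,\mu(E)>\beta\mu(B)}\mathrm{OSC}_E(g)$ for $0<\beta<1$. BO operators (with parameters $\varrho=\rho=1/r$). A sublinear $S:L^r(X,\mathbb U)\to L^0(X,\mathbb V)$ (i.e. $\|S(f+g)\|_{\mathbb V}\le\|Sf\|_{\mathbb V}+\|Sg\|_{\mathbb V}$) is a bounded oscillation (BO) operator if there are constants $\mathcal L_j(S)$ such that, whenever $f\in L^r(X,\mathbb U)$: (T0) for $B\in\mathscr B$, $\lambda>0$: $\mu\{x\in B:\|S(f\mathbf 1_B)(x)\|_{\mathbb V}>\lambda\langle f\rangle_B\}\le(\mathcal L_0/\lambda)^{r}\mu(B)$; (T1) for $B\in\mathscr B$: $\mathrm{OSC}_B(S(f\mathbf 1_{X\setminus B^*}))\le\mathcal L_1\langle f\rangle^*_B$; (T2) for every ball $A$ with $A^*\ne X$ there is a ball $B\supsetneq A$ with $\mathrm{SUP}_A(S(f\mathbf 1_{B^*\setminus A^*}))\le\mathcal L_2\langle f\rangle_{B^*}$. Restricted type. A BO operator $S$ is of restricted type if: (R1) $\mathscr B$ is doubling; (R2) $S$ is linear; (R3) $S$ satisfies (T0) with $\varrho=\rho=1/r$; (R4) there is a constant $\mathcal L_1(S)$ such that for any ball $B$, $\mathrm{OSC}_B(S(f\mathbf 1_{X\setminus B^*}))\le\mathcal L_1(S)\sup_{A\in\mathscr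 B:A\supset B}\log^{-1}\big(1+\frac{\mu(A)}{\mu(B)}\big)\langle f\rangle_A$; (R5) for any ball $B$ and $\varepsilon>0$ there is a ball $B'\supset B$ such that for any ball $B''\supset B'$ it holds $\mathrm{OSC}_B(S(\mathbf 1_{B''}))\le\varepsilon$. A family $\{T_\alpha\}$ of restricted type operators is uniformly restricted if (R3)–(R5) are satisfied uniformly. In the claim $\mathcal L_1(T_\alpha)$ is the constant in (R4) and $\mathcal L_0(T)$ is the constant in (T0) for the maximal operator $T$. Median. For a measurable function $g$ and a ball $B$ let $M_g(B)\subset B$ be the union of all measurable $E\subset B$ with $\mu(E)>\mu(B)/2$ and $\mathrm{OSC}_E(g)\le2\,\mathrm{OSC}_{B,1/2}(g)$. A value $m$ is a median of $g$ on $B$ if there is a point $x\in M_g(B)$ with $g(x)=m$. Families of sets. A collection $\mathcal S$ of measurable sets is sparse (or $\gamma$-sparse), with a constant $0<\gamma<1$, if for any $B\in\mathcal S$ there is a set $E_B\subset B$ with $\mu(E_B)\ge\gamma\mu(B)$ and the sets $E_B$, $B\in\mathcal S$, are pairwise disjoint. A family is of martingale type if any two members are disjoint or one contains the other. $\bar{\mathcal S}\Subset\mathcal S$ means that there is a one-to-one mapping from $\mathcal S$ to $\bar{\mathcal S}$ taking every $A\in\mathcal S$ to a set $\bar A\in\bar{\mathcal S}$ with $\bar A\subset A$. Admissible constants are positive constants depending only on $\mathcal K,\eta,r$; $a\lesssim b$ means $a\le c\,b$ with $c$ admissible.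
   Formalization: The median bound is stated for m=Tf(x0), almost every x0 in each set E forming M_{Tf}(B), as M_{Tf}(B) can be empty (no median) and otherwise null points can give spurious medians; Tf is the supremum modulo null sets and the pointwise bound holds for almost every x in B. *)

(* Defs.v *)
From HB Require Import structures.
From mathcomp Require Import all_boot all_order all_algebra.
From mathcomp Require Import all_classical all_reals all_analysis.
From mathcomp Require Export ess_sup_inf.

Set Implicit Arguments.
Unset Strict Implicit.
Unset Printing Implicit Defensive.

Import Order.TTheory GRing.Theory Num.Theory.
Import numFieldNormedType.Exports.

Local Open Scope classical_set_scope.
Local Open Scope ring_scope.
Local Open Scope ereal_scope.

(* Elements of L^r(X, U) and L^0(X, V) are represented by functions; everything
   below is insensitive to changes on null sets.  Banach spaces are real (a
   complex one is regarded as real). *)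

Section BallBasis.
Context d (X : measurableType d) (R : realType).
Context (mu : {measure set X -> \bar R}) (Bs : set (set X)).

(* the set B^* *)
Definition hull (B : set X) : set X :=
  \bigcup_(A in [set A | [/\ Bs A, mu A <= 2%:E * mu B & A `&` B !=set0]]) A.

(* In B3, a finite or infinite sequence of balls is a countable set of balls. *)
Record ball_basis (K : R) : Prop := BallBasis {
  ball_measurable : forall B, Bs B -> measurable B;
  ball_B1 : forall B, Bs B -> 0 < mu B < +oo;
  ball_B2 : forall x y : X, exists B, [/\ Bs B, B x & B y];
  ball_B3 : forall (E : set X) (e : R), measurable E -> (0 < e)%R ->
    exists Ck : set (set X), [/\ countable Ck, Ck `<=` Bs &
      mu (E `+` \bigcup_(B in Ck) B) < e%:E];
  ball_B4 : forall B, Bs B ->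
    exists B1, [/\ Bs B1, hull B `<=` B1 & mu B1 <= K%:E * mu B];
  ball_separable : forall Ck : set (set X), Ck `<=` Bs ->
    measurable (\bigcup_(B in Ck) B) }.

Definition doubling (eta : R) : Prop :=
  (1 < eta)%R /\
  forall B, Bs B -> hull B <> setT ->
    exists B', [/\ Bs B', B `<` B' & mu B' <= eta%:E * mu B].

End BallBasis.

Section BanachValued.
Context d (X : measurableType d) (R : realType).
Context (mu : {measure set X -> \bar R}).

Definition simple_fun (U : normedModType R) (s : X -> U) : Prop :=
  finite_set (range s) /\ forall u : U, measurable (s @^-1` [set u]).

(* L^0(X, U): strong (Bochner) measurability *)
Definition strongly_measurable (U : normedModType R) (f : X -> U) : Prop :=
  exists s : nat -> X -> U, (forall n, simple_fun (s n)) /\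
    forall x, s n x @[n --> \oo] --> f x.

Definition Lr (r : R) (U : normedModType R) (f : X -> U) : Prop :=
  strongly_measurable f /\ \int[mu]_x (`|f x| `^ r)%:E < +oo.

(* The next two definitions are only used on sets A of finite measure. *)
Definition simple_integral (U : normedModType R) (A : set X) (s : X -> U) : U :=
  (\sum_(u \in range s) fine (mu (A `&` s @^-1` [set u])) *: u)%R.

Definition bochner_integral (U : normedModType R) (A : set X) (f : X -> U) : U :=
  xget 0%R [set v : U | exists s : nat -> X -> U,
    [/\ forall n, simple_fun (s n),
        \int[mu]_(x in A) `|f x - s n x|%:E @[n --> \oo] --> 0 &
        simple_integral A (s n) @[n --> \oo] --> v]].

(* f_B *)
Definition mean (U : normedModType R) (f : X -> U) (B : set X) : U :=
  ((fine (mu B))^-1 *: bochner_integral B f)%R.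

(* f 1_A *)
Definition mulind (U : normedModType R) (f : X -> U) (A : set X) : X -> U :=
  fun x => (\1_A x *: f x)%R.

Definition ess_sup_on (E : set X) (h : X -> \bar R) : \bar R :=
  ess_sup mu (patch (fun=> -oo) E h).

Definition SUP (V : normedModType R) (E : set X) (g : X -> V) : \bar R :=
  ess_sup_on E (fun x => `|g x|%:E).

(* The essential supremum over pairs is iterated, so that no product measure
   (hence no sigma-finiteness of mu) is needed. *)
Definition OSC (V : normedModType R) (E : set X) (g : X -> V) : \bar R :=
  ess_sup_on E (fun x => ess_sup_on E (fun x' => `|g x - g x'|%:E)).

Definition OSCb (V : normedModType R) (beta : R) (B : set X) (g : X -> V)
    : \bar R :=
  ereal_inf [set OSC E g | E in
    [set E | [/\ measurable E, E `<=` B & beta%:E * mu B < mu E]]].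

(* The sets E whose union is M_g(B). *)
Definition median_pieces (g : X -> R) (B : set X) : set (set X) :=
  [set E | [/\ measurable E, E `<=` B, (2^-1)%:E * mu B < mu E &
    OSC E (g : X -> R^o) <= 2%:E * OSCb 2^-1 B (g : X -> R^o)]].

(* A median is a value g x with x in M_g(B), i.e. with x in one of the pieces E.
   Since g is only defined up to null sets, a property of all medians is required
   at almost every point of each piece.  (The exceptional set has to depend on E:
   adding a null set to a piece gives another piece, so that, if points are null,
   the set-theoretic union of all pieces is either empty or the whole of B.) *)
Definition for_all_medians (g : X -> R) (B : set X) (P : R -> Prop) : Prop :=
  forall E, median_pieces g B E -> \forall x \ae mu, E x -> P (g x).

End BanachValued.

Section Averages.
Context d (X : measurableType d) (R : realType).
Context (mu : {measure set X -> \bar R}) (Bs : set (set X)) (r : R).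
Context (U : normedModType R).
Implicit Types (f : X -> U) (A B : set X).

(* <f>_A *)
Definition avg f A : \bar R :=
  (((fine (mu A))^-1)%:E * \int[mu]_(x in A) (`|f x| `^ r)%:E) `^ (r^-1).

(* <f>^*_A *)
Definition avg_star f A : \bar R :=
  ereal_sup [set avg f C | C in [set C | Bs C /\ A `<=` C]].

(* <f>_{#,B} *)
Definition sharp f B : \bar R := avg (fun x => f x - mean mu f B)%R B.

(* <f>^*_{#,B} *)
Definition sharp_star f B : \bar R :=
  ereal_sup [set sharp f A | A in [set A | Bs A /\ B `<=` A]].

(* sup_{A ⊃ B} log^{-1}(1 + mu(A)/mu(B)) <f>_A *)
Definition log_star f B : \bar R :=
  ereal_sup [set ((ln (1 + fine (mu A) / fine (mu B)))^-1)%:E * avg f A |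
    A in [set A | Bs A /\ B `<=` A]].

End Averages.

Section Operators.
Context d (X : measurableType d) (R : realType).
Context (mu : {measure set X -> \bar R}) (Bs : set (set X)) (r : R).
Context (U V : normedModType R).
Local Notation L := (@Lr _ X R mu r U).
Implicit Types (S : (X -> U) -> X -> V) (f g : X -> U).

(* S : L^r(X, U) -> L^0(X, V), on classes modulo null sets *)
Definition is_operator S : Prop :=
  (forall f, L f -> strongly_measurable (S f)) /\
  (forall f g, L f -> L g -> (\forall x \ae mu, f x = g x) ->
     \forall x \ae mu, S f x = S g x).

Definition is_sublinear S : Prop := forall f g, L f -> L g ->
  \forall x \ae mu, (`|S (fun y => f y + g y) x| <= `|S f x| + `|S g x|)%R.

Definition is_linear S : Prop := forall (a : R) f g, L f -> L g ->
  \forall x \ae mu, (S (fun y => a *: f y + g y) x = a *: S f x + S g x)%R.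

Definition T0 S (L0 : R) : Prop := (0 <= L0)%R /\
  forall f, L f -> forall B (lambda : R), Bs B -> (0 < lambda)%R ->
    mu (B `&` [set x | lambda%:E * avg mu r f B < `|S (mulind f B) x|%:E])
      <= ((L0 / lambda) `^ r)%:E * mu B.

Definition T1 S (L1 : R) : Prop := (0 <= L1)%R /\
  forall f, L f -> forall B, Bs B ->
    OSC mu B (S (mulind f (~` hull mu Bs B))) <= L1%:E * avg_star mu Bs r f B.

Definition T2 S (L2 : R) : Prop := (0 <= L2)%R /\
  forall f, L f -> forall A, Bs A -> hull mu Bs A <> setT ->
    exists B, [/\ Bs B, A `<` B &
      SUP mu A (S (mulind f (hull mu Bs B `\` hull mu Bs A)))
        <= L2%:E * avg mu r f (hull mu Bs B)].

Definition BO_operator S : Prop :=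
  [/\ is_operator S, is_sublinear S &
      exists L0 L1 L2 : R, [/\ T0 S L0, T1 S L1 & T2 S L2]].

Definition R4 S (L1 : R) : Prop := (0 <= L1)%R /\
  forall f, L f -> forall B, Bs B ->
    OSC mu B (S (mulind f (~` hull mu Bs B))) <= L1%:E * log_star mu Bs r f B.

(* As functions in L^r(X, U) are U-valued, the scalar function 1_{B''} of (R5) is
   replaced by u 1_{B''} with u in U; B' may depend on u.  For U = R and linear
   operators this amounts to u = 1. *)
Definition R5_at S B (u : U) (e : R) B' : Prop :=
  forall B'', Bs B'' -> B' `<=` B'' ->
    OSC mu B (S (mulind (fun=> u) B'')) <= e%:E.

Definition R5 S : Prop := forall B (u : U) (e : R), Bs B -> (0 < e)%R ->
  exists B', [/\ Bs B', B `<=` B' & R5_at S B u e B'].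

Definition restricted_type S : Prop :=
  [/\ BO_operator S,
      exists eta : R, doubling mu Bs eta,
      is_linear S,
      exists L0, T0 S L0 &
      (exists L1, R4 S L1) /\ R5 S].

Definition uniformly_restricted (I : Type) (Ta : I -> (X -> U) -> X -> V)
    : Prop :=
  [/\ forall a, restricted_type (Ta a),
      exists L0, forall a, T0 (Ta a) L0,
      exists L1, forall a, R4 (Ta a) L1 &
      forall B (u : U) (e : R), Bs B -> (0 < e)%R ->
        exists B', [/\ Bs B', B `<=` B' & forall a, R5_at (Ta a) B u e B']].

(* T f = sup_a ||T_a f||_V is real valued and is the supremum in L^0(X, R), i.e.
   modulo null sets.  For a countable family this is the pointwise supremum; for an
   uncountable one the pointwise supremum depends on the representatives. *)
Definition is_maximal_operator (I : Type) (Ta : I -> (X -> U) -> X -> V)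
    (T : (X -> U) -> X -> R) : Prop :=
  forall f, L f ->
    [/\ measurable_fun setT (T f),
        forall a, \forall x \ae mu, (`|Ta a f x| <= T f x)%R &
        forall h : X -> R, measurable_fun setT h ->
          (forall a, \forall x \ae mu, (`|Ta a f x| <= h x)%R) ->
          \forall x \ae mu, (T f x <= h x)%R].

End Operators.

Section Families.
Context d (X : measurableType d) (R : realType).
Context (mu : {measure set X -> \bar R}).

Definition sparse (gamma : R) (S : set (set X)) : Prop :=
  (0 < gamma < 1)%R /\
  exists E : set X -> set X,
    (forall B, S B -> [/\ measurable (E B), E B `<=` B &
       gamma%:E * mu B <= mu (E B)]) /\
    trivIset S E.

Definition martingale_type (S : set (set X)) : Prop :=
  forall A B, S A -> S B -> [\/ A `&` B = set0, A `<=` B | B `<=` A].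

(* bar witnesses Sbar ⋐ S *)
Definition shrinking (S Sbar : set (set X)) (bar : set X -> set X) : Prop :=
  set_bij S Sbar bar /\ forall A, S A -> bar A `<=` A.

End Families.

(* C(T) = L_0(T) + sup_a L_1(T_a) *)
Definition CT (R : realType) (I : Type) (L0 : R) (L1 : I -> R) : \bar R :=
  L0%:E + ereal_sup (range (fun a => (L1 a)%:E)).

(* Main.v *)
Require Import Defs.
From HB Require Import structures.
From mathcomp Require Import all_boot all_order all_algebra.
From mathcomp Require Import all_classical all_reals all_analysis.
From mathcomp Require Import measurable_realfun finmap ring lra zify.

Import Order.TTheory GRing.Theory Num.Theory.
Import numFieldNormedType.Exports.

Local Open Scope classical_set_scope.
Local Open Scope ring_scope.
Local Open Scope ereal_scope.

Set Implicit Arguments.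
Unset Strict Implicit.
Unset Printing Implicit Defensive.

(* Let g = T f and let Z range over balls.
   - Oscillation.  Subtracting from f its mean c on [Z] and splitting f - c into the
     part on Z^* and the part outside, (T0) controls T on the first part off a set of
     measure at most e mu(Z).  For the second part (R4) applies, because
     <f - c>_A grows at most logarithmically in mu(A)/mu(Z), with factor the sharp
     function <f>^*_{#,Z}; the constant c itself is harmless by (R5).  The
     minimality of sup_a |T_a f| then gives a number c_Z with |g - c_Z| <= w_Z :=
     C C(T) <f>^*_{#,Z} on Z, up to an exceptional set D_Z with
     mu(D_Z) <= e mu(Z).
   - Stopping balls.  Put Z(A) = [[A]].  Starting with B, around the points of
     D_{Z(A)} choose balls b in which D_{Z(A)} has density about 1/2, with pairwise
     disjoint balls at each dyadic scale.  The children of A have total measure at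
     most a small multiple of mu(A), so the descendants decay geometrically and
     a.e. x in B is settled, i.e. off D_{Z(A)} for some last A containing it in its
     territory [A].  As D_{Z(b)} and D_{Z(A)} do not cover a child b of A,
     |c_{Z(b)} - c_{Z(A)}| <= w_{Z(b)} + w_{Z(A)}, and telescoping along the ancestors
     of the settling ball bounds |g(x) - c_{Z(B)}| by twice the sum of their w.
   - The points settled at descendants of Z form the shrunk set of Z; these sets are
     a martingale family with exponentially decaying overlap.
   - A median differs from c_{Z(B)} by at most 5 w_{Z(B)}. *)

(** Balls are not nested, so a ball selected at a later scale may meet [A] without descending from
    it, and the estimate for children alone does not give sparseness. Such a ball does descend from
    a selected ball t near [A] whose measure is comparable to that of [A]. These t occupy at most J
    scales, are disjoint at each of them and lie in one ball of measure at most 2 K^4 mu(A); the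
    final value 1 / (32 (J+1) eta K^8) of e is dictated by this count. The two brackets in Z(A) have
    different tasks. The inner one lets the disjoint balls selected at a scale cover, once enlarged,
    every candidate of that scale; the outer one gives Z(b) inside Z(A) for a child b of A. Nesting
    of the shrunk sets cannot come from inclusion of balls either, so it is read off the parent
    relation: the settled points are divided into disjoint leaves, one for each member of the
    family, and a shrunk set collects the leaves of all descendants. *)

(** * Sums over arbitrary index sets and over the generations of a tree *)

Section Sums.
Context {R : realType}.

Lemma esum_subset (T : choiceType) (A B : set T) (a : T -> \bar R) :
  A `<=` B -> \esum_(i in A) a i <= \esum_(i in B) a i.
Proof.
move=> AB; apply: ge_ereal_sup => _ [F [finF FA] <-].
by apply: esum_ge; exists F => //; split=> // x /FA /AB.
Qed.

(** Choosing for each x one index i with x in [J i] embeds the union into the disjoint sum of the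
    [J i]. *)
Lemma esum_bigcup_le (T1 T2 : choiceType) (I : set T1) (J : T1 -> set T2)
    (a : T2 -> \bar R) : (forall x, 0 <= a x) ->
  \esum_(x in \bigcup_(i in I) J i) a x <= \esum_(i in I) \esum_(x in J i) a x.
Proof.
move=> a0; rewrite esum_esum//; set U := \bigcup_(i in I) J i.
have [[x0 Ux0]|/forallNP U0] := pselect (exists x, U x); last first.
  by rewrite esum1 ?esum_ge0// => x /U0.
have [i0 _ _] := Ux0.
pose f x := xget i0 [set i | I i /\ J i x].
have fP x : U x -> I (f x) /\ J (f x) x.
  by move=> [i Ii Jix]; rewrite /f; case: xgetP => [y -> //|/(_ i)[]].
rewrite (_ : \esum_(x in U) a x =
    \esum_(k in (fun x => (f x, x)) @` U) a k.2); last first.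
  by rewrite esum_image// => x y _ _ [].
by apply: esum_subset => _ [x /fP[? ?] <-].
Qed.

Lemma esum_ge1 (T : choiceType) (A : set T) (a : T -> \bar R) x :
  (forall x, A x -> 0 <= a x) -> A x -> a x <= \esum_(i in A) a i.
Proof.
move=> a0 Ax; apply: esum_ge; exists [set x]; last by rewrite fsbig_set1.
by split => // y ->.
Qed.

Lemma le_esumZl (T : choiceType) (A : set T) (a b : T -> \bar R) (k : R) :
  (0 <= k)%R -> (forall x, 0 <= b x) ->
  (forall x, A x -> a x <= k%:E * b x) ->
  \esum_(i in A) a i <= k%:E * \esum_(i in A) b i.
Proof.
move=> k0 b0 ab; apply: ge_ereal_sup => _ [F [finF FA] <-].
apply: (@le_trans _ _ (\sum_(x \in F) (k%:E * b x))).
  by apply: lee_fsum => // x /FA /ab.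
rewrite -ge0_mule_fsumr//; apply: lee_wpmul2l; first by rewrite lee_fin.
by apply: esum_ge; exists F.
Qed.

Lemma countable_esum_lty (T : choiceType) (A : set T) (a : T -> \bar R) :
  (forall x, A x -> 0 < a x) -> \esum_(i in A) a i < +oo -> countable A.
Proof.
move=> a0 Aoo; rewrite (_ : A = \bigcup_n
    [set x | A x /\ (n.+1%:R^-1)%:E <= a x]); last first.
  apply/seteqP; split=> [x Ax|x [n _ []//]].
  have := a0 _ Ax; case E : (a x) => [r| |]// r0.
    exists (Num.truncn r^-1) => //; split => //.
    rewrite E lee_fin -[leRHS]invrK lef_pV2 ?posrE ?invr_gt0//.
    by apply/ltW; rewrite truncnS_gt.
  by exists 0%N => //; split => //; rewrite E leey.
apply: bigcup_countable => // n _; apply: finite_set_countable.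
apply: contrapT => inf.
set An := [set x | _] in inf.
have S0 : \esum_(i in A) a i \is a fin_num.
  by rewrite ge0_fin_numE ?esum_ge0// => x /a0/ltW.
have [F FA Fn] := infinite_set_fset
  (Num.truncn (fine (\esum_(i in A) a i) * n.+1%:R)).+1 inf.
have : \sum_(x <- F) a x <= \esum_(i in A) a i.
  apply: esum_ge; exists [set` F].
    by split => // x /FA [].
  by rewrite fsbig_finite//= set_fsetK.
apply/negP; rewrite -ltNge.
apply: (@lt_le_trans _ _ (\sum_(x <- F) (n.+1%:R^-1)%:E)); last first.
  by rewrite [leLHS]big_seq [leRHS]big_seq; apply: lee_sum => x /FA[].
rewrite sumEFin big_const_seq count_predT iter_addr_0 -(fineK S0) lte_fin.
rewrite -[(_ *+ _)%R]mulr_natl ltr_pdivlMr ?ltr0n//.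
apply: lt_le_trans (truncnS_gt _) _.
by rewrite ler_nat.
Qed.

(* [par] is only meaningful away from the root, which is its own ancestor. *)
Fixpoint descendants (T : Type) (N : set T) (root : T) (par : T -> T)
    (n : nat) (a : T) : set T :=
  if n is n'.+1 then
    [set b | [/\ N b, b <> root & descendants N root par n' a (par b)]]
  else [set a].

Lemma esum_descendants (T : choiceType) (N : set T) (root : T) (par : T -> T)
    (w : T -> \bar R) (q : R) n a :
  (0 <= q)%R -> (forall x, 0 <= w x) -> N a ->
  (forall b, N b -> b <> root -> N (par b)) ->
  (forall a, N a ->
    \esum_(b in [set b | [/\ N b, b <> root & par b = a]]) w b <= q%:E * w a) ->
  \esum_(b in descendants N root par n a) w b <= (q ^+ n)%:E * w a.
Proof.
move=> q0 w0 Na Npar ch; elim: n => [|n IHn].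
  by rewrite expr0 mul1e esum_set1.
apply: (@le_trans _ _ (\esum_(c in descendants N root par n a)
    \esum_(b in [set b | [/\ N b, b <> root & par b = c]]) w b)).
  apply: le_trans (esum_bigcup_le _ _ w0).
  by apply: esum_subset => b [Nb br pb]; exists (par b).
rewrite exprS EFinM -muleA.
apply: le_trans (lee_wpmul2l _ IHn); last by rewrite lee_fin.
apply: le_esumZl => // c; case: n {IHn} => [->|n [Nc _ _]]; exact: ch.
Qed.

(** Since q <= 1/2, generation n+1 contributes at most q^(n+1) <= 2 q / 2^(n+1) times [w a], and
    these factors add up to 2 q. *)
Lemma esum_strict_descendants (T : choiceType) (N : set T) (root : T)
    (par : T -> T) (w : T -> \bar R) (q : R) a :
  (0 <= q <= 2^-1)%R -> (forall x, 0 <= w x) -> w a \is a fin_num -> N a ->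
  (forall b, N b -> b <> root -> N (par b)) ->
  (forall a, N a ->
    \esum_(b in [set b | [/\ N b, b <> root & par b = a]]) w b <= q%:E * w a) ->
  \esum_(b in \bigcup_n descendants N root par n.+1 a) w b <= (2 * q)%:E * w a.
Proof.
move=> /andP[q0 q2] w0 wfin Na Npar ch.
apply: le_trans (esum_bigcup_le _ _ w0) _.
have wa0 : (0 <= fine (w a))%R by rewrite fine_ge0.
apply: (@le_trans _ _ (\esum_(n in [set: nat])
    (2 * q * fine (w a) / (2 ^ n.+1)%:R)%:E)).
  apply: le_esum => n _; apply: le_trans (esum_descendants n.+1 q0 w0 Na Npar ch) _.
  rewrite -(fineK wfin) -EFinM lee_fin [leRHS]mulrAC ler_wpM2r//.
  rewrite exprS natrX exprS invfM mulrA [(2 * q / 2)%R]mulrAC divff// mul1r.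
  by rewrite ler_wpM2l// -exprVn lerXn2r ?nnegrE ?invr_ge0.
rewrite -nneseries_esumT; last first.
  by move=> n; rewrite lee_fin !mulr_ge0// invr_ge0 ler0n.
rewrite -(fineK wfin) -EFinM fineK//.
by apply: epsilon_trick0; rewrite !mulr_ge0.
Qed.

Lemma descendants_trans (T : Type) (N : set T) root (par : T -> T) n k a b c :
  descendants N root par n b a -> descendants N root par k c b ->
  descendants N root par (n + k) c a.
Proof.
elim: n a => [|n IHn] a; first by rewrite add0n => ->.
by move=> [Na ar pa] cb; split => //; exact: IHn pa cb.
Qed.

End Sums.

(** * Measures of unions over countable index sets *)

Section CountableMeasure.
Context d (X : measurableType d) (R : realType) (mu : {measure set X -> \bar R}).

Lemma countable_bigcup_measurable (T : choiceType) (D : set T) (F : T -> set X) :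
  countable D -> (forall i, D i -> measurable (F i)) ->
  measurable (\bigcup_(i in D) F i).
Proof.
move=> /countable_injP[f finj] mF.
rewrite (_ : \bigcup_(i in D) F i =
    \bigcup_n \bigcup_(i in [set i | D i /\ f i = n]) F i); last first.
  apply/seteqP; split=> [x [i Di Fix]|x [n _ [i [Di fi] Fix]]].
    by exists (f i) => //; exists i.
  by exists i.
apply: bigcupT_measurable => n.
have [[i [Di fi]]|/forallNP Dn] := pselect (exists i, D i /\ f i = n).
  rewrite (_ : [set j | _] = [set i]) ?bigcup_set1; first exact: mF.
  apply/seteqP; split=> [j [Dj fj]|j -> //].
  by apply: finj; [exact: mem_set|exact: mem_set|rewrite fj fi].
rewrite (_ : [set j | _] = set0) ?bigcup_set0//.
by apply/seteqP; split => // i /Dn.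
Qed.

Lemma measure_bigcup_le_esum (T : choiceType) (D : set T) (F : T -> set X) :
  countable D -> (forall i, D i -> measurable (F i)) ->
  mu (\bigcup_(i in D) F i) <= \esum_(i in D) mu (F i).
Proof.
move=> cD mF; have /countable_injP[f finj] := cD.
pose G n := \bigcup_(i in [set i | D i /\ f i = n]) F i.
have DF : \bigcup_(i in D) F i = \bigcup_n G n.
  apply/seteqP; split=> [x [i Di Fix]|x [n _ [i [Di fi] Fix]]].
    by exists (f i) => //; exists i.
  by exists i.
have mG n : measurable (G n).
  by apply: countable_bigcup_measurable => [|i []/mF//];
    apply: sub_countable cD; apply: subset_card_le => i [].
rewrite DF; apply: (@le_trans _ _ (\sum_(n <oo) mu (G n))).
  by apply: measure_sigma_subadditive => //; exact: bigcupT_measurable.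
have Gfi i : D i -> G (f i) = F i.
  move=> Di; rewrite /G (_ : [set j | _] = [set i]) ?bigcup_set1//.
  apply/seteqP; split=> [j [Dj fj]|j -> //].
  by apply: finj; [exact: mem_set|exact: mem_set|].
rewrite nneseries_esumT// (esumID (f @` D))// setTI [X in _ + X]esum1 ?adde0.
  rewrite esum_image; last by move=> i j Di Dj; apply: finj.
  by apply: le_esum => i Di; rewrite Gfi.
move=> n [_ Dn]; rewrite /G (_ : [set j | _] = set0) ?bigcup_set0//.
by apply/seteqP; split => // i [Di fi]; apply: Dn; exists i.
Qed.

Lemma esum_trivIset_le (T : choiceType) (D : set T) (F : T -> set X)
    (Y : set X) :
  (forall i, D i -> measurable (F i)) -> trivIset D F -> measurable Y ->
  (forall i, D i -> F i `<=` Y) -> \esum_(i in D) mu (F i) <= mu Y.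
Proof.
move=> mF tF mY FY; apply: ge_ereal_sup => _ [A [finA AD] <-].
rewrite -measure_fin_bigcup//.
- apply: le_measure; last by move=> x [i /AD/FY]; exact.
    apply: mem_set; apply: countable_bigcup_measurable => [|i /AD/mF//].
    exact: finite_set_countable.
  exact: mem_set.
- exact: sub_trivIset tF.
- by move=> i /AD/mF.
Qed.

End CountableMeasure.

(** * Engulfing, Vitali covering and density points *)

Section BallGeometry.
Context d (X : measurableType d) (R : realType).
Context (mu : {measure set X -> \bar R}) (Bs : set (set X)) (K : R).
Hypothesis bb : ball_basis mu Bs K.
Local Notation m A := (fine (mu A)).

Lemma ball_fin A : Bs A -> mu A \is a fin_num.
Proof. by move=> /(ball_B1 bb)/andP[A0 Aoo]; rewrite ge0_fin_numE. Qed.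

Lemma ball_muE A : Bs A -> mu A = (m A)%:E.
Proof. by move=> /ball_fin/fineK. Qed.

Lemma ball_gt0 A : Bs A -> (0 < m A)%R.
Proof. by move=> BA; have /andP[] := ball_B1 bb BA; rewrite ball_muE. Qed.

Lemma ball_neq0 A : Bs A -> A !=set0.
Proof.
move=> BA; apply/set0P/eqP => A0; have := ball_gt0 BA.
by rewrite A0 measure0 ltxx.
Qed.

Lemma ball_meas A : Bs A -> measurable A.
Proof. by move=> BA; exact: (ball_measurable bb BA). Qed.

Lemma fin_num_sub A C : measurable A -> measurable C -> A `<=` C ->
  mu C \is a fin_num -> mu A \is a fin_num.
Proof.
move=> mA mC sAC; rewrite !ge0_fin_numE//; apply: le_lt_trans.
by apply: le_measure => //; exact: mem_set.
Qed.

Lemma le_fine_measure A C : measurable A -> measurable C -> A `<=` C ->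
  mu C \is a fin_num -> (m A <= m C)%R.
Proof.
move=> mA mC sAC fC; apply: fine_le => //; first exact: (fin_num_sub mA mC sAC fC).
by apply: le_measure => //; exact: mem_set.
Qed.

Lemma ball_le A C : Bs A -> Bs C -> A `<=` C -> (m A <= m C)%R.
Proof.
move=> BA BC sAC.
exact: (le_fine_measure (ball_meas BA) (ball_meas BC) sAC (ball_fin BC)).
Qed.

(** A fixed choice of the ball [A] of (B4); [setT] is a mere default. *)
Definition bracket (A : set X) : set X :=
  xget setT [set C | [/\ Bs C, hull mu Bs A `<=` C & mu C <= K%:E * mu A]].

Lemma bracketP A : Bs A ->
  [/\ Bs (bracket A), hull mu Bs A `<=` bracket A &
      (m (bracket A) <= K * m A)%R].
Proof.
move=> BA; rewrite /bracket; case: xgetP => [C -> /= [BC hC lC]|noC].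
  by split => //; move: lC; rewrite (ball_muE BC) (ball_muE BA) -EFinM lee_fin.
by have [C ?] := ball_B4 bb BA; case: (noC C).
Qed.

Lemma bracket_ball A : Bs A -> Bs (bracket A).
Proof. by move=> /bracketP[]. Qed.

Lemma bracket_le A : Bs A -> (m (bracket A) <= K * m A)%R.
Proof. by move=> /bracketP[]. Qed.

Lemma sub_hull A C : Bs A -> Bs C -> (m A <= 2 * m C)%R -> A `&` C !=set0 ->
  A `<=` hull mu Bs C.
Proof.
move=> BA BC sAC sAC0 x Ax; exists A => //; split => //.
by rewrite (ball_muE BA) (ball_muE BC) -EFinM lee_fin.
Qed.

Lemma engulf A C : Bs A -> Bs C -> (m A <= 2 * m C)%R -> A `&` C !=set0 ->
  A `<=` bracket C.
Proof.
move=> BA BC sAC sAC0; apply: subset_trans (sub_hull BA BC sAC sAC0) _.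
by have [] := bracketP BC.
Qed.

Lemma sub_bracket A : Bs A -> A `<=` bracket A.
Proof.
move=> BA; apply: engulf => //; last by rewrite setIid; exact: ball_neq0.
by have := ball_gt0 BA; lra.
Qed.

Lemma ball_basis_ge1 A : Bs A -> (1 <= K)%R.
Proof.
move=> BA; have := ball_le BA (bracket_ball BA) (sub_bracket BA).
move=> /le_trans/(_ (bracket_le BA)).
by rewrite -{1}[m A]mul1r ler_pM2r// ball_gt0.
Qed.

Lemma bracket2_le A : Bs A -> (m (bracket (bracket A)) <= K ^+ 2 * m A)%R.
Proof.
move=> BA; apply: le_trans (bracket_le (bracket_ball BA)) _.
rewrite expr2 -mulrA ler_wpM2l ?bracket_le//.
exact: le_trans (ball_basis_ge1 BA).
Qed.

Lemma hull_measurable A : Bs A -> measurable (hull mu Bs A).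
Proof. by move=> BA; apply: (ball_separable bb) => C []. Qed.

(** Zorn's lemma is applied to disjoint families H such that a ball of G meeting H meets a member of
    at least half its measure. This invariant survives unions of chains. It also survives adding an
    almost largest ball among those disjoint from H, so a maximal H misses no ball of G. *)
Lemma vitali_cover (G : set (set X)) (M : R) : G `<=` Bs ->
  (forall A, G A -> m A <= M)%R ->
  exists H : set (set X), [/\ H `<=` G, trivIset H id &
    forall A, G A -> exists2 C, H C & A `<=` bracket C].
Proof.
move=> GB GM.
pose P (H : set (set X)) := [/\ H `<=` G, trivIset H id &
  forall A, G A -> (forall C, H C -> A `&` C = set0) \/
    exists C, [/\ H C, A `&` C !=set0 & (m A <= 2 * m C)%R]].
have [|H [[HG tH HP] Hmax]] := @Zorn_bigcup _ P.
  move=> F FP totF; split.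
  - by move=> A [H /FP[HG _ _]] /HG.
  - move=> A C [H FH HA] [H' FH' HC].
    have [HH|HH] := totF _ _ FH FH'.
      by have [_ + _] := FP _ FH'; apply => //; exact: HH.
    by have [_ + _] := FP _ FH; apply => //; exact: HH.
  - move=> A GA.
    have [AF|] := pselect (forall C, (\bigcup_(H in F) H) C -> A `&` C = set0).
      by left.
    move=> /existsNP[C /not_implyP[[H FH HC] /eqP/set0P sAC]]; right.
    have [_ _ /(_ _ GA)[/(_ _ HC) sAC0|[C' [HC' sAC' le']]]] := FP _ FH.
      by move: sAC; rewrite sAC0 => -[].
    by exists C'; split => //; exists H.
exists H; split => // A GA.
have [AH|[C [HC sAC le]]] := HP _ GA; last first.
  by exists C => //; apply: engulf => //; [exact: GB|exact/GB/HG].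
exfalso.
pose G' := [set C | G C /\ forall C', H C' -> C `&` C' = set0].
pose S := [set m C | C in G'].
have S0 : S !=set0 by exists (m A), A.
have hS : has_sup S by split => //; exists M => _ [C [GC _] <-]; exact: GM.
have sS : (0 < sup S)%R.
  apply: lt_le_trans (ball_gt0 (GB _ GA)) _.
  by apply: ub_le_sup; [exact: hS.2|exists A].
have [_ [C [GC CH] <-] Clt] : exists2 x, S x & (sup S / 2 < x)%R.
  have /(_ (sup S / 2)%R)[|x Sx xlt] := @sup_adherent _ S _ _ hS; first by lra.
  by exists x => //; move: xlt; lra.
have nHC : ~ H C.
  move=> /CH; rewrite setIid => C0.
  by have := ball_neq0 (GB _ GC); rewrite C0 => -[].
apply: (Hmax (H `|` [set C])).
  by rewrite properEneq; split; [|by move=> ? ?; left]; apply/eqP => HE;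
    apply: nHC; rewrite HE; right.
split.
- by move=> C' [/HG//|->].
- move=> C1 C2 [HC1|->] [HC2|->] //=.
  + by apply: tH.
  + by rewrite setIC (CH _ HC1) => -[].
  + by rewrite (CH _ HC2) => -[].
- move=> C1 GC1; have [C1H|[C' [HC' ? ?]]] := HP _ GC1; last first.
    by right; exists C'; split => //; left.
  have [C10|/eqP/set0P C1C] := pselect (C1 `&` C = set0).
    by left => C' [/C1H//|->].
  right; exists C; split => //; first by right.
  have : (m C1 <= sup S)%R.
    by apply: ub_le_sup; [exact: hS.2|exists C1].
  by move: Clt; lra.
Qed.

Lemma le_measure' A C : measurable A -> measurable C -> A `<=` C ->
  mu A <= mu C.
Proof. by move=> ? ? ?; apply: le_measure => //; exact: mem_set. Qed.

(** Let F be the set of bad points. Every ball has at most half of its measure in F: a ball of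
    density above 1/2 misses F, and the others have at most half in D. Cover F by balls up to an
    error e using (B3), with union V, and extract disjoint balls: their total measure is at most 2
    mu(V \ F) <= 2 e, hence mu(V) <= 2 K e and mu(F) is of order e. *)
Lemma density_ball D : measurable D -> mu D \is a fin_num ->
  mu (D `\` \bigcup_(A in [set A | Bs A /\ (m A < 2 * m (A `&` D))%R]) A) = 0.
Proof.
move=> mD fD; set S := [set A | _].
have SB : S `<=` Bs by move=> A [].
have mU : measurable (\bigcup_(A in S) A) by exact: (ball_separable bb).
set F := D `\` _; have mF : measurable F by exact: measurableD.
have fF : mu F \is a fin_num by apply: (fin_num_sub mF mD _ fD) => x [].
have half A : Bs A -> (m (A `&` F) <= 2^-1 * m A)%R.
  move=> BA; have mA := ball_meas BA.
  have [/(conj BA) SA|] := boolP (m A < 2 * m (A `&` D))%R.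
    rewrite (_ : A `&` F = set0) ?measure0.
      by rewrite mulr_ge0 ?invr_ge0// ltW ?ball_gt0.
    by apply/seteqP; split => // x [Ax [_]]; apply; exists A.
  rewrite -leNgt => DA.
  have : (m (A `&` F) <= m (A `&` D))%R.
    apply: le_fine_measure; [exact: measurableI|exact: measurableI| |].
      by move=> x [Ax []].
    by apply: (@fin_num_sub _ A) => //; [exact: measurableI|exact: ball_fin].
  by move: DA; lra.
have Fe (e : R) : (0 < e)%R -> mu F <= ((1 + 2 * `|K|) * e)%:E.
  move=> e0; have [Ck [cCk CkB Cke]] := ball_B3 bb mF e0.
  set V := \bigcup_(C in Ck) C in Cke.
  have mV : measurable V by exact: (ball_separable bb).
  have mFV : measurable (F `\` V) by exact: measurableD.
  have mVF : measurable (V `\` F) by exact: measurableD.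
  have FVe : mu (F `\` V) <= e%:E.
    by apply/ltW/(le_lt_trans _ Cke)/le_measure' => //;
      [exact: measurableU (measurableD _ _) (measurableD _ _)|left].
  have VFe : mu (V `\` F) <= e%:E.
    by apply/ltW/(le_lt_trans _ Cke)/le_measure' => //;
      [exact: measurableU (measurableD _ _) (measurableD _ _)|right].
  have leD A C : measurable A -> measurable C -> mu A <= mu (A `\` C) + mu C.
    move=> mA mC; apply: (@le_trans _ _ (mu ((A `\` C) `|` C))).
      apply: le_measure' => //; first exact: measurableU (measurableD _ _) _.
      by move=> x Ax; have [Cx|nCx] := pselect (C x); [right|left].
    by apply: measureU2 => //; exact: measurableD.
  have fV : mu V \is a fin_num.
    rewrite ge0_fin_numE// (le_lt_trans (leD _ _ mV mF))//.
    by rewrite lte_add_pinfty ?(le_lt_trans VFe) ?ltry// -ge0_fin_numE.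
  have [|H [HCk tH CkH]] := @vitali_cover Ck (m V) CkB.
    move=> A CkA; apply: (le_fine_measure _ mV _ fV); first exact/ball_meas/CkB.
    by move=> x Ax; exists A.
  have HB : H `<=` Bs by move=> A /HCk/CkB.
  have cH : countable H by apply: sub_countable cCk; exact: subset_card_le.
  have sH : \esum_(A in H) mu A <= 2%:E * mu (V `\` F).
    apply: (@le_trans _ _ (2%:E * \esum_(A in H) mu (A `\` F))).
      apply: le_esumZl => // A HA; have mA := ball_meas (HB _ HA).
      have hA := half _ (HB _ HA); have AE := ball_muE (HB _ HA).
      have fAF : mu (A `\` F) \is a fin_num.
        by apply: (fin_num_sub (measurableD mA mF) mA _ (ball_fin (HB _ HA))) => x [].
      have fAF' : mu (A `&` F) \is a fin_num.
        by apply: (fin_num_sub (measurableI _ _ mA mF) mA _ (ball_fin (HB _ HA))) => x [].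
      have : mu A = mu (A `\` F) + mu (A `&` F) by rewrite -measureDI.
      rewrite AE -(fineK fAF) -(fineK fAF') -EFinD -EFinM lee_fin => -[mAE].
      by lra.
    apply: lee_wpmul2l => //; apply: esum_trivIset_le => //.
    - by move=> A HA; apply: measurableD => //; exact/ball_meas/HB.
    - move=> A C HA HC [x [[Ax _] [Cx _]]]; apply: tH => //.
      by exists x.
    - by move=> A HA x [Ax nFx]; split => //; exists A => //; exact: HCk.
  have VK : mu V <= `|K|%:E * \esum_(A in H) mu A.
    apply: (@le_trans _ _ (mu (\bigcup_(A in H) bracket A))).
      apply: le_measure' => //.
        apply: countable_bigcup_measurable => // A /HB/bracket_ball; exact: ball_meas.
      by move=> x [A CkA Ax]; have [C HC sAC] := CkH _ CkA; exists C => //; exact: sAC.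
    apply: (@le_trans _ _ (\esum_(A in H) mu (bracket A))).
      apply: measure_bigcup_le_esum => // A /HB/bracket_ball; exact: ball_meas.
    apply: le_esumZl => // A /HB BA.
    rewrite (ball_muE BA) (ball_muE (bracket_ball BA)) -EFinM lee_fin.
    apply: le_trans (bracket_le BA) _; by rewrite ler_wpM2r ?ler_norm// fine_ge0.
  apply: le_trans (leD _ _ mF mV) _.
  rewrite mulrDl mul1r EFinD leeD//; apply: le_trans VK _.
  rewrite [(2 * _)%R]mulrC -mulrA EFinM lee_wpmul2l ?lee_fin//.
  apply: le_trans sH _; rewrite EFinM lee_wpmul2l//.
apply/eqP; rewrite eq_le measure_ge0 andbT.
apply/lee_addgt0Pr => e e0; rewrite add0e.
have K0 : (0 < 1 + 2 * `|K|)%R by have := normr_ge0 K; lra.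
have := Fe (e / (1 + 2 * `|K|))%R; rewrite mulrCA divff ?gt_eqF// mulr1; apply.
exact: divr_gt0.
Qed.

Lemma bracket_setT A : Bs A -> hull mu Bs A = setT -> bracket A = setT.
Proof.
move=> BA hA; apply/seteqP; split => // x _.
by have [_ + _] := bracketP BA; rewrite hA; apply.
Qed.

(** * Enlarging balls by a controlled factor *)

Section Doubling.
Variable eta : R.
Hypothesis dbl : doubling mu Bs eta.
Local Notation Cg := (2 * eta * K ^+ 2)%R.

(** The doubling condition only provides a proper superset, with no gain in measure. But a ball
    properly containing [A] has measure above 2 mu(A), since otherwise it would lie in A^* and thus
    in [A]. If [A] itself is large, or a hull is already X, a bracket does the job. *)
Lemma ball_grow A : Bs A -> exists A', [/\ Bs A', A `<=` A',
  (m A' <= Cg * m A)%R & (2 * m A <= m A')%R \/ A' = setT].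
Proof.
move=> BA; have [eta1 dblP] := dbl.
have K1 := ball_basis_ge1 BA; have mA0 := ball_gt0 BA.
have KK : (K <= K ^+ 2)%R by rewrite expr2; nra.
have C1 : (K ^+ 2 <= Cg)%R.
  by have : (0 <= K ^+ 2)%R by [rewrite sqr_ge0]; nra.
have C2 : (2 * eta <= Cg)%R by nra.
have BZ := bracket_ball BA; have AZ := sub_bracket BA.
have mZ := bracket_le BA.
have [hA|hA] := pselect (hull mu Bs A = setT).
  exists (bracket A); split => //; last by right; exact: bracket_setT.
  by nra.
have [lt2|le2] := ltP (2 * m A)%R (m (bracket A)).
  by exists (bracket A); split => //; [nra|left; exact: ltW].
have Zh : bracket A `<=` hull mu Bs A.
  apply: sub_hull => //; have [x Ax] := ball_neq0 BA.
  by exists x; split => //; exact: AZ.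
have [hZ|hZ] := pselect (hull mu Bs (bracket A) = setT).
  exists (bracket (bracket A)); split.
  - exact: bracket_ball.
  - exact: subset_trans AZ (sub_bracket BZ).
  - by have := bracket2_le BA; nra.
  - by right; exact: bracket_setT.
have [A' [BA' [ZA' /existsNP[y /not_implyP[A'y nZy]]]]] := dblP _ BZ hZ.
rewrite (ball_muE BA') (ball_muE BZ) -EFinM lee_fin => le'.
exists A'; split => //; first exact: subset_trans AZ ZA'.
- by nra.
- left; rewrite leNgt; apply/negP => lt'.
  apply: nZy; have [_ + _] := bracketP BA; apply; apply: sub_hull A'y => //.
    exact: ltW.
  have [x Ax] := ball_neq0 BA.
  by exists x; split => //; apply: ZA'; exact: AZ.
Qed.

(* Take a ball almost maximal among those through [x] in which [D] has density
   above 1/2, and enlarge it once more. *)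
Lemma stopping_ball D : measurable D -> mu D \is a fin_num ->
  2%:E * mu D <= mu setT ->
  exists N, [/\ measurable N, mu N = 0 & forall x, D x -> ~ N x ->
    exists b, [/\ Bs b, b x, (m b <= 2 * Cg * m (b `&` D))%R &
      (2 * m (b `&` D) <= m b)%R]].
Proof.
move=> mD fD D2; have D0 := density_ball mD fD.
set N := (X in mu X = 0) in D0; exists N; split => //.
  by apply: measurableD => //; apply: (ball_separable bb) => A [].
move=> x Dx nNx.
have [A [BA Aden] Ax] : (\bigcup_(A in [set A | Bs A /\
    (m A < 2 * m (A `&` D))%R]) A) x.
  by apply: contrapT => nx; apply: nNx; split.
have mDle A' C : Bs A' -> measurable C -> A' `<=` C ->
    (m (A' `&` D) <= m (C `&` D))%R.
  move=> BA' mC sC.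
  apply: le_fine_measure; [exact: measurableI (ball_meas _) _|
    exact: measurableI| |].
  - by move=> y [/sC].
  - by apply: (fin_num_sub (measurableI _ _ mC mD) mD _ fD) => y [].
pose S := [set m A' | A' in [set A' | [/\ Bs A', A' x &
  (m A' < 2 * m (A' `&` D))%R]]].
have S0 : S !=set0 by exists (m A), A.
have hS : has_sup S.
  split => //; exists (2 * m D)%R => _ [A' [BA' A'x lt'] <-].
  have := mDle _ _ BA' (@measurableT _ X) (@subsetT _ _).
  by rewrite setTI; lra.
have sS : (0 < sup S)%R.
  apply: lt_le_trans (ball_gt0 BA) _.
  by apply: ub_le_sup; [exact: hS.2|exists A].
have [_ [A1 [BA1 A1x lt1] <-] A1lt] : exists2 y, S y & (sup S / 2 < y)%R.
  have /(_ (sup S / 2)%R)[|y Sy ylt] := @sup_adherent _ S _ _ hS; first by lra.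
  by exists y => //; move: ylt; lra.
have [b [Bb sb mb bbig]] := ball_grow BA1.
exists b; split => //; first exact: sb.
  have [eta1 _] := dbl; have K1 := ball_basis_ge1 BA.
  have C0 : (0 <= Cg)%R by rewrite mulr_ge0 ?sqr_ge0//; lra.
  have le1 := mDle _ _ BA1 (ball_meas Bb) sb.
  apply: le_trans mb _.
  rewrite (_ : (_ * _ * m (b `&` D) = Cg * (2 * m (b `&` D)))%R); last by ring.
  by rewrite ler_wpM2l//; lra.
(* If b had density above 1/2, then either its doubled measure would exceed the supremum, or b = X,
   which is excluded by 2 mu(D) <= mu(X). *)
rewrite leNgt; apply/negP => ltb; case: bbig => [big|bT].
  have : (m b <= sup S)%R.
    by apply: ub_le_sup; [exact: hS.2|exists b; split => //; exact: sb].
  by move: A1lt; lra.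
move: ltb; rewrite bT setTI; apply/negP; rewrite -leNgt.
have fT : mu setT \is a fin_num by rewrite -bT ball_fin.
by move: D2; rewrite -(fineK fD) -(fineK fT) -EFinM lee_fin.
Qed.

Lemma ball_grow_iter A n : Bs A -> exists A', [/\ Bs A', A `<=` A' &
  (2 ^+ n * m A <= m A')%R \/ A' = setT].
Proof.
move=> BA; elim: n => [|n [A1 [BA1 sA1 A1big]]].
  by exists A; split => //; left; rewrite expr0 mul1r.
have [A' [BA' sA' _ A'big]] := ball_grow BA1.
exists A'; split => //; first exact: subset_trans sA1 sA'.
case: A1big => [A1big|A1T]; last first.
  by right; apply/seteqP; split => // x _; apply: sA'; rewrite A1T.
by case: A'big => [A'big|]; [left; rewrite exprS; lra|right].
Qed.

Lemma ball_large A M : Bs A -> exists A', [/\ Bs A', A `<=` A' &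
  (M <= m A')%R \/ A' = setT].
Proof.
move=> BA; have mA := ball_gt0 BA.
have [A' [BA' sA' big]] := ball_grow_iter (Num.truncn (`|M| / m A)).+1 BA.
exists A'; split => //; case: big => [big|]; [left|by right].
apply: le_trans big; rewrite -ler_pdivrMr//.
apply: le_trans (ler_wpM2r _ (ler_norm M)) _; first by rewrite invr_ge0 ltW.
apply: (le_trans (ltW (truncnS_gt _))).
by rewrite -natrX ler_nat ltnW// ltn_expl.
Qed.

End Doubling.
End BallGeometry.

(** * Dyadic scales: the larger the scale, the smaller the ball *)

Section Scale.
Context {R : realType}.
Implicit Types M a c : R.
Local Open Scope ring_scope.

(* junk unless [0 < a <= M] *)
Definition scale M a : nat :=
  xget 0%N [set n | 2 ^+ n * a <= M < 2 ^+ n.+1 * a].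

Lemma scaleP M a : 0 < a <= M ->
  2 ^+ scale M a * a <= M < 2 ^+ (scale M a).+1 * a.
Proof.
move=> /andP[a0 aM].
have ex : exists n, M < 2 ^+ n.+1 * a.
  exists (Num.truncn (M / a)); rewrite -ltr_pdivrMr//.
  apply: (lt_trans (truncnS_gt _)).
  by rewrite -natrX ltr_nat ltn_expl.
have [] : exists n, 2 ^+ n * a <= M < 2 ^+ n.+1 * a; last first.
  by move=> n nP; rewrite /scale; case: xgetP => [k -> //|/(_ n)].
case: (ex_minnP ex) => n nM nmin; exists n; rewrite nM andbT.
case: n {nM} nmin => [|n] nmin; first by rewrite expr0 mul1r.
by rewrite leNgt; apply/negP => /nmin; rewrite ltnn.
Qed.

Lemma scale_eq M a c : 0 < a <= M -> 0 < c <= M -> scale M a = scale M c ->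
  a < 2 * c.
Proof.
move=> /scaleP/andP[aM _] /scaleP/andP[_ Mc] ac.
have := le_lt_trans aM Mc; rewrite -ac exprS [(2 * _)%R]mulrC -mulrA.
by rewrite ltr_pM2l ?exprn_gt0.
Qed.

Lemma scale_lt M a c : 0 < a <= M -> 0 < c <= M ->
  (scale M a < scale M c)%N -> c < a.
Proof.
move=> /[dup]/andP[a0 _] /scaleP/andP[_ aM] /[dup]/andP[c0 _] /scaleP/andP[Mc _] ac.
have le2 : 2 ^+ (scale M a).+1 <= 2 ^+ scale M c :> R by rewrite ler_eXn2l ?ltr1n.
have := le_lt_trans Mc aM; rewrite ltNge => /negP h; rewrite ltNge; apply/negP.
by move=> le; apply: h; apply: ler_pM => //; rewrite ?exprn_ge0// ltW.
Qed.

Lemma scale_gt M a c : 0 < a <= M -> 0 < c <= M -> 2 * c <= a ->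
  (scale M a < scale M c)%N.
Proof.
move=> aM cM ca; have /andP[c0 _] := cM; rewrite ltnNge leq_eqVlt.
by apply/negP => /orP[/eqP/esym/(scale_eq aM cM)|/(scale_lt cM aM)]; lra.
Qed.

End Scale.

(** * Selecting a maximal disjoint family at each scale *)

Section ScaleSelection.
Context {X : Type} (sc : set X -> nat) (cand : set (set X) -> set X -> Prop).

Let maxdisj (G : set (set X)) : set (set X) :=
  sval (ex_maximal_disjoint_subcollection id G).

Let maxdisjP G : [/\ maxdisj G `<=` G, trivIset (maxdisj G) id &
  forall b, G b -> b !=set0 -> exists2 A, maxdisj G A & A `&` b !=set0].
Proof.
rewrite /maxdisj; case: ex_maximal_disjoint_subcollection => H [HG tH Hmax] /=.
split => // b Gb b0; have [Hb|nHb] := pselect (H b).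
  by exists b => //; rewrite setIid.
apply: contrapT => nex; apply: (Hmax (H `|` [set b])).
- split; first by left.
  by move=> /(_ b (or_intror erefl)).
- by move=> A [/HG//|->].
- move=> A C [HA|->] [HC|->] //=; first exact: tH.
  + by move=> Ab; exfalso; apply: nex; exists A.
  + by rewrite setIC => Cb; exfalso; apply: nex; exists C.
Qed.

(* The balls are selected scale by scale; whether a ball is a candidate depends
   on the selection made at the previous scales. *)
Lemma scale_selection : exists H : set (set X),
  let below n := [set A | H A /\ (sc A < n)%N] in
  [/\ forall A, H A -> cand (below (sc A)) A,
      forall A C, H A -> H C -> sc A = sc C -> A `&` C !=set0 -> A = C &
      forall b, b !=set0 -> cand (below (sc b)) b ->
        exists A, [/\ H A, sc A = sc b & A `&` b !=set0]].
Proof.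
pose G j H := [set b | sc b = j /\ cand H b].
pose fix St j := if j is j'.+1 then St j' `|` maxdisj (G j' (St j')) else set0.
have StS j : St j.+1 = St j `|` maxdisj (G j (St j)) by [].
have mxG j A : maxdisj (G j (St j)) A -> sc A = j /\ cand (St j) A.
  by have [+ _ _] := maxdisjP (G j (St j)); move=> /[apply].
have StP j A : St j A -> (sc A < j)%N /\ maxdisj (G (sc A) (St (sc A))) A.
  elim: j => [//|j IHj]; rewrite StS => -[/IHj[lt ?]|/[dup] Am /mxG[ej _]].
    by split => //; exact: ltnW.
  by rewrite ej; split.
have Stm A : maxdisj (G (sc A) (St (sc A))) A ->
    forall j, (sc A < j)%N -> St j A.
  move=> Am; elim=> [//|j IHj]; rewrite ltnS leq_eqVlt StS => /orP[/eqP<-|/IHj].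
    by right.
  by left.
pose H := \bigcup_j St j.
have below j : [set A | H A /\ (sc A < j)%N] = St j.
  apply/seteqP; split=> [A [[i _ /StP[_ Am]] lt]|A StA]; first exact: Stm.
  by split; [exists j|have [] := StP _ _ StA].
have HP A : H A -> maxdisj (G (sc A) (St (sc A))) A by move=> [j _ /StP[]].
exists H => /=; split.
- by move=> A /HP/mxG[_]; rewrite below.
- move=> A C /HP + /HP + eAC; rewrite -eAC => mA mC ACne.
  by have [_ + _] := maxdisjP (G (sc A) (St (sc A))); apply.
- move=> b b0; rewrite below => cb.
  have [_ _ /(_ b (conj erefl cb) b0)[A Am Ab]] := maxdisjP (G (sc b) (St (sc b))).
  have [ej _] := mxG _ _ Am.
  by exists A; split => //; exists (sc A).+1 => //; apply: Stm; rewrite // ej.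
Qed.

End ScaleSelection.

(** * The tree of stopping balls *)

Section StoppingTree.
Context d (X : measurableType d) (R : realType).
Context (mu : {measure set X -> \bar R}) (Bs : set (set X)) (K eta : R).
Hypothesis bb : ball_basis mu Bs K.
Hypothesis dbl : doubling mu Bs eta.
Hypothesis K2 : (2 <= K)%R.
Local Notation m A := (fine (mu A)).
Local Notation Cg := (2 * eta * K ^+ 2)%R.
Local Notation br := (bracket mu Bs K).

Context (B : set X) (D : set X -> set X) (e : R) (J : nat).
Hypothesis BB : Bs B.
Hypothesis mD : forall A, Bs A -> measurable (D A).
Hypothesis DZ : forall A, Bs A -> D A `<=` br (br A).
Hypothesis De : forall A, Bs A -> (m (D A) <= e * m A)%R.
Hypothesis KJ : (2 * K ^+ 2 <= 2 ^+ J)%R.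
Local Notation q := (2 * Cg * e)%R.
Hypothesis q0 : (0 <= q)%R.
Hypothesis qsmall : (8 * J.+1%:R * K ^+ 4 * q <= 1)%R.

Let sc (A : set X) := scale (m B) (m A).

(** The two density bounds of [stopping_ball]. The lower one makes the children of P small in total;
    the upper one leaves enough of b outside [D P] to compare the values at P and b. *)
Let stop P b := (m b <= 2 * Cg * m (b `&` D P))%R /\
  (2 * m (b `&` D P) <= m b)%R.

(** A stopping ball around a base point x; its parent P has the latest scale among the balls
    selected so far whose bracket contains x. This maximality makes children of one parent
    disjoint. *)
Let cand (H : set (set X)) b := b = B \/ exists x P,
  [/\ H P, Bs b, b x, br P x & stop P b /\
    forall A, H A -> br A x -> (sc A <= sc P)%N].

Let q_bounds : [/\ (q <= 2^-1)%R, (K ^+ 2 * q <= 2^-1)%R &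
  (2 * K ^+ 2 * q <= 2^-1)%R].
Proof.
have J1 : (1 <= J.+1%:R :> R)%R by rewrite ler1n.
have K44 : (4 <= K ^+ 2)%R by rewrite expr2; move: K2; nra.
have K41 : (4 * K ^+ 2 <= K ^+ 4)%R.
  by rewrite (exprD K 2 2) ler_wpM2r ?sqr_ge0.
move: q0 qsmall; move: (q) => t t0 tsmall.
have h : (8 * K ^+ 4 * t <= 1)%R.
  apply: le_trans tsmall; rewrite ler_wpM2r// ler_wpM2r ?exprn_ge0//; first by move: K2; lra.
  by lra.
have Kt : (4 * K ^+ 2 * t <= K ^+ 4 * t)%R by rewrite ler_wpM2r.
have t4 : (4 * t <= K ^+ 2 * t)%R by rewrite ler_wpM2r.
by move: h Kt t4; rewrite -!mulrA; move: (K ^+ 4 * t)%R (K ^+ 2 * t)%R => a b;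
  split; lra.
Qed.

Let B_gt0 : (0 < m B)%R. Proof. exact: (ball_gt0 bb). Qed.

Let scB : sc B = 0%N.
Proof.
apply/eqP; rewrite -leqn0 leqNgt; apply/negP => sB.
have /scaleP/andP[le _] : (0 < m B <= m B)%R by rewrite B_gt0 lexx.
have : (2 <= 2 ^+ sc B :> R)%R by rewrite -(prednK sB) exprS ler_peMr// exprn_ege1// ler1n.
by move: le B_gt0; rewrite -/(sc B); nra.
Qed.

Let fDA A C : Bs A -> measurable C -> C `<=` A -> mu C \is a fin_num.
Proof.
move=> BA mC CA; exact: (fin_num_sub mC (ball_meas bb BA) CA (ball_fin bb BA)).
Qed.

Let stop_le P b : Bs P -> Bs b -> stop P b -> (m b <= q * m P)%R.
Proof.
move=> BP Bb [mb _]; apply: le_trans mb _.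
have [eta1 _] := dbl.
have C0 : (0 <= 2 * Cg)%R by have k2 := K2; rewrite !mulr_ge0//; lra.
rewrite -[leRHS]mulrA ler_wpM2l//; apply: le_trans (De BP).
have mDP := mD BP.
apply: le_fine_measure => //.
    by apply: measurableI => //; exact: (ball_meas bb Bb).
by apply: (fDA (bracket_ball bb (bracket_ball bb BP))) => //; exact: DZ.
Qed.

Section Selected.
Context (H : set (set X)).
Let below n := [set A | H A /\ (sc A < n)%N].
Hypothesis Hcand : forall A, H A -> cand (below (sc A)) A.
Hypothesis Hdisj : forall A C, H A -> H C -> sc A = sc C -> A `&` C !=set0 -> A = C.
Hypothesis Hmax : forall b, b !=set0 -> cand (below (sc b)) b ->
  exists A, [/\ H A, sc A = sc b & A `&` b !=set0].

Let HB : H B.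
Proof.
(* Maximality only yields a selected ball of scale 0 meeting B. No ball is selected at an earlier
   scale to be its parent, so it is B itself. *)
have [|A [HA sA _]] := @Hmax B (ball_neq0 bb BB); first by left.
have [<-//|[x [P [[_]]]]] := Hcand HA.
by rewrite sA scB.
Qed.

Let H_ball A : H A -> Bs A /\ (m A <= m B)%R.
Proof.
have [n] := ubnP (sc A); elim: n A => // n IHn A; rewrite ltnS => sAn HA.
have [->//|[x [P [[HP sP] BA _ _ [st _]]]]] := Hcand HA.
have [BP PB] := IHn P (leq_trans sP sAn) HP; split => //.
have [q2 _ _] := q_bounds.
by have := stop_le BP BA st; have := ball_gt0 bb BP; nra.
Qed.

Let HBs A : H A -> Bs A. Proof. by move=> /H_ball[]. Qed.

Let H_rng A : H A -> (0 < m A <= m B)%R.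
Proof. by move=> HA; have [BA ->] := H_ball HA; rewrite (ball_gt0 bb BA). Qed.

Let par A : set X := xget set0 [set P | exists x,
  [/\ H P, (sc P < sc A)%N, A x, br P x & stop P A /\
    forall C, H C -> (sc C < sc A)%N -> br C x -> (sc C <= sc P)%N]].

Let parP A : H A -> A <> B -> exists x,
  [/\ H (par A), (sc (par A) < sc A)%N, A x, br (par A) x & stop (par A) A /\
    forall C, H C -> (sc C < sc A)%N -> br C x -> (sc C <= sc (par A))%N].
Proof.
move=> HA nAB; rewrite /par; case: xgetP => [P -> //|noP].
have [//|[x [P [[HP sP] BA Ax Px [st mx]]]]] := Hcand HA.
exfalso; apply: (noP P); exists x; split => //; split => // C HC sC Cx.
by apply: mx.
Qed.

Let par_H A : H A -> A <> B -> H (par A).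
Proof. by move=> HA nAB; have [x []] := parP HA nAB. Qed.

Let par_sc A : H A -> A <> B -> (sc (par A) < sc A)%N.
Proof. by move=> HA nAB; have [x []] := parP HA nAB. Qed.

Let par_le A : H A -> A <> B -> (m A <= q * m (par A))%R.
Proof.
move=> HA nAB; have [x [HP _ _ _ [st _]]] := parP HA nAB.
exact: stop_le (HBs HP) (HBs HA) st.
Qed.

(** Since A is much smaller than its parent P, the ball [[A]] has measure at most 2 mu([P]); it
    meets [P] at the base point of A, so [[P]] engulfs it. *)
Let par_sub A : H A -> A <> B -> br (br A) `<=` br (br (par A)).
Proof.
move=> HA nAB; have [x [HP _ Ax Px _]] := parP HA nAB.
have [BA BP] := (HBs HA, HBs HP).
have [BbA BbP] := (bracket_ball bb BA, bracket_ball bb BP).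
apply: (engulf bb (bracket_ball bb BbA) BbP).
  have [_ Kq _] := q_bounds.
  have := bracket2_le bb BA; have := par_le HA nAB.
  have := ball_le bb BP BbP (sub_bracket bb BP).
  have := ball_gt0 bb BP; have : (0 <= K ^+ 2)%R by rewrite sqr_ge0.
  by nra.
exists x; split => //.
exact/(sub_bracket bb BbA)/(sub_bracket bb BA).
Qed.

Let sub_br2 A : Bs A -> A `<=` br (br A).
Proof.
move=> BA; apply: subset_trans (sub_bracket bb BA) _.
exact: (sub_bracket bb (bracket_ball bb BA)).
Qed.

Let later_sub A b : H A -> H b -> (sc A < sc b)%N -> b `&` A !=set0 ->
  b `<=` br A.
Proof.
move=> HA Hb sAb bA; apply: (engulf bb (HBs Hb) (HBs HA)) => //.
by have := scale_lt (H_rng HA) (H_rng Hb) sAb; have /andP[] := H_rng HA; lra.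
Qed.

(** If c has a later scale than b and meets it, then c lies in [b]. So the base point of c is in
    [b], and the parent of c would have a scale at least that of b, later than that of P. *)
Let children_disj P b c : H b -> b <> B -> par b = P -> H c -> c <> B ->
  par c = P -> b `&` c !=set0 -> b = c.
Proof.
wlog le : b c / (sc b <= sc c)%N.
  move=> wl; have [le|/ltnW le] := leqP (sc b) (sc c); first exact: wl.
  by move=> *; apply/esym; apply: wl => //; rewrite setIC.
move=> Hb nbB pb Hc ncB pc bc.
move: le; rewrite leq_eqVlt => /orP[/eqP/Hdisj|lt]; first exact.
have [x [_ _ cx _ [_ /(_ b Hb lt)]]] := parP Hc ncB.
have bx : br b x by apply: (later_sub Hb Hc) => //; rewrite setIC.
by move=> /(_ bx); rewrite pc -pb leqNgt (par_sc Hb nbB).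
Qed.

(** Each child has a fraction at least 1 / (2 Cg) of its measure in [D P], and these portions are
    disjoint. *)
Let children_sum P : H P ->
  \esum_(b in [set b | [/\ H b, b <> B & par b = P]]) mu b <= q%:E * mu P.
Proof.
move=> HP; have BP := HBs HP; have mDP := mD BP.
have [eta1 _] := dbl.
have C0 : (0 <= 2 * Cg)%R by have k2 := K2; rewrite !mulr_ge0//; lra.
have fDP : mu (D P) \is a fin_num.
  by apply: (fDA (bracket_ball bb (bracket_ball bb BP))) => //; exact: DZ.
apply: (@le_trans _ _ ((2 * Cg)%:E * \esum_(b in [set b |
    [/\ H b, b <> B & par b = P]]) mu (b `&` D P))).
  apply: le_esumZl => // b [Hb nbB pb].
  have [x [_ _ _ _ [[+ _] _]]] := parP Hb nbB; rewrite pb => le.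
  have fbD : mu (b `&` D P) \is a fin_num.
    apply: (fDA (HBs Hb)); last by move=> y [].
    by apply: measurableI => //; exact: (ball_meas bb (HBs Hb)).
  by rewrite (ball_muE bb (HBs Hb)) -(fineK fbD) -EFinM lee_fin.
apply: (@le_trans _ _ ((2 * Cg)%:E * mu (D P))).
  apply: lee_wpmul2l; first by rewrite lee_fin.
  apply: esum_trivIset_le => //.
  - move=> b [Hb _ _]; apply: measurableI => //; exact: (ball_meas bb (HBs Hb)).
  - move=> b c [Hb nb pb] [Hc nc pc] [y [[by_ _] [cy _]]].
    by apply: (children_disj (P := P)) => //; exists y.
rewrite -(fineK fDP) (ball_muE bb BP) -!EFinM lee_fin -[leRHS]mulrA.
by rewrite ler_wpM2l// De.
Qed.

Local Notation desc := (descendants H B par).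

Let desc_sub n t b : desc n t b -> br (br b) `<=` br (br t).
Proof.
elim: n b => [|n IHn] b; first by move=> ->.
by move=> [Hb nb /IHn]; apply: subset_trans; exact: par_sub.
Qed.

Let H_desc b : H b -> exists n, desc n B b.
Proof.
have [k] := ubnP (sc b); elim: k b => // k IHk b; rewrite ltnS => sbk Hb.
have [->|nbB] := pselect (b = B); first by exists 0%N.
have [|n dn] := IHk (par b) _ (par_H Hb nbB).
  exact: leq_trans (par_sc Hb nbB) sbk.
by exists n.+1.
Qed.

Let desc_esum t : H t ->
  \esum_(b in \bigcup_n desc n.+1 t) mu b <= (2 * q)%:E * mu t.
Proof.
move=> Ht; have [q2 _ _] := q_bounds.
apply: esum_strict_descendants => //; first by rewrite q0.
by apply: (ball_fin bb); exact: HBs.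
Qed.

Let H_esum : \esum_(b in H) mu b <= 2%:E * mu B.
Proof.
have [q2 _ _] := q_bounds.
rewrite (esumID [set B])//; have -> : H `&` [set B] = [set B].
  by apply/seteqP; split => [b []//|b ->].
rewrite esum_set1// (_ : 2 = 1 + 1)%R// EFinD ge0_muleDl// mul1e leeD2l//.
apply: (@le_trans _ _ (\esum_(b in \bigcup_n desc n.+1 B) mu b)).
  apply: esum_subset => b [Hb nbB]; have [[|n] dn] := H_desc Hb.
    by case: nbB.
  by exists n.
apply: le_trans (desc_esum HB) _.
by rewrite -[leRHS]mul1e lee_wpmul2r// lee_fin; lra.
Qed.

(** The selection is not an enumeration; countability comes from a finite sum of positive
    measures. *)
Let H_countable : countable H.
Proof.
apply: (@countable_esum_lty _ _ _ mu).
  by move=> b /HBs Bb; have /andP[] := ball_B1 bb Bb.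
by apply: le_lt_trans H_esum _; rewrite (ball_muE bb BB) -EFinM ltry.
Qed.

(* If [A] meets a later [b], an ancestor [t] of [b] comparable to [A] exists:
   otherwise all the ancestors of [b] of scale at least that of [A] have their
   base point in [br A], which bounds the scale of their parents from below. *)
Let later_ancestor A b : H A -> H b -> (sc A < sc b)%N -> b `&` A !=set0 ->
  exists t n, [/\ H t, (sc A <= sc t)%N, (m A <= K ^+ 2 * m t)%R,
    br (br t) `&` A !=set0 & desc n.+1 t b].
Proof.
move=> HA Hb sAb bA.
suff main c n : H c -> (sc A <= sc c)%N -> desc n.+1 c b ->
    exists t n, [/\ H t, (sc A <= sc t)%N, (m A <= K ^+ 2 * m t)%R,
      br (br t) `&` A !=set0 & desc n.+1 t b].
  have nbB : b <> B by move=> bB; move: sAb; rewrite bB scB.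
  have [x [HP sP bx Px [_ /(_ A HA sAb)]]] := parP Hb nbB.
  have Ax : br A x by apply: (later_sub HA Hb).
  by move=> /(_ Ax) sAP; apply: (main (par b) 0%N).
have [k] := ubnP (sc c); elim: k c n => // k IHk c n; rewrite ltnS => sck Hc sAc dc.
have cA : br (br c) `&` A !=set0.
  have [y [by_ Ay]] := bA; exists y; split => //.
  exact/(desc_sub dc)/(sub_br2 (HBs Hb)).
have [good|] := leP (m A) (K ^+ 2 * m c)%R; first by exists c, n.
move=> bad; have [BA Bc] := (HBs HA, HBs Hc).
have K4 : (4 <= K ^+ 2)%R by rewrite expr2; move: K2; nra.
have mc := ball_gt0 bb Bc.
have lt : (sc A < sc c)%N.
  rewrite ltn_neqAle sAc andbT; apply/eqP => /(scale_eq (H_rng HA) (H_rng Hc)).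
  by move: bad; nra.
have ncB : c <> B by move=> cB; move: lt; rewrite cB scB.
have cbA : br (br c) `<=` br A.
  apply: (engulf bb _ BA) => //; first exact: (bracket_ball bb (bracket_ball bb Bc)).
  by have := bracket2_le bb Bc; have := ball_gt0 bb BA; lra.
have [x [HP sP cx Px [_ /(_ A HA lt)]]] := parP Hc ncB.
have Ax : br A x by apply/cbA/(sub_br2 Bc).
move=> /(_ Ax) sAP; apply: (IHk (par c) n.+1) => //.
  exact: leq_trans sP sck.
by rewrite -[n.+2]addn1; apply: descendants_trans dc _; split.
Qed.

Let sub_pow (n k : nat) : (n <= k)%N -> (2 ^+ n <= 2 ^+ k :> R)%R.
Proof. by move=> nk; rewrite ler_eXn2l// ltr1n. Qed.

(** Origin of [J]: passing from mu(A) to mu(t) loses a factor K^2, and comparing measures through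
    scales another factor 2, together at most 2^J. *)
Let comparable_scale A t : H A -> H t -> (m A <= K ^+ 2 * m t)%R ->
  (sc t < sc A + J)%N.
Proof.
move=> HA Ht At; rewrite ltnNge; apply/negP => le.
have /scaleP/andP[_ mA] := H_rng HA; have /scaleP/andP[mt _] := H_rng Ht.
rewrite -!/(sc _) in mA mt.
have := lt_le_trans mA (ler_wpM2l _ At); rewrite exprn_ge0// => /(_ isT).
apply/negP; rewrite -leNgt; apply: le_trans mt.
have mt0 : (0 <= m t)%R by rewrite fine_ge0.
rewrite mulrA ler_wpM2r//; apply: le_trans (sub_pow le).
rewrite exprD exprS [(2 * _)%R]mulrC -mulrA ler_wpM2l// exprn_ge0//.
Qed.

Let almost_max (G : set (set X)) (M : R) : G !=set0 -> G `<=` Bs ->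
  (forall C, G C -> m C <= M)%R ->
  exists2 W, G W & forall C, G C -> (m C <= 2 * m W)%R.
Proof.
move=> [A GA] GB GM; pose S := [set m C | C in G].
have hS : has_sup S.
  by split; [exists (m A), A|exists M => _ [C /GM ? <-]].
have sS : (0 < sup S)%R.
  apply: lt_le_trans (ball_gt0 bb (GB _ GA)) _.
  by apply: ub_le_sup; [exact: hS.2|exists A].
have [|_ [W GW <-] Wlt] := @sup_adherent _ S (sup S / 2)%R _ hS; first by lra.
exists W => // C GC; have : (m C <= sup S)%R.
  by apply: ub_le_sup; [exact: hS.2|exists C].
by move: Wlt; lra.
Qed.

Let rel A := [set t | [/\ H t, (sc A <= sc t)%N, (m A <= K ^+ 2 * m t)%R &
  br (br t) `&` A !=set0]].

(** Let W be almost the largest among A and the balls [[t]]. Since all of them meet A, first A lies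
    in [W], then every [[t]] lies in [[W]]. As W has measure at most 2 K^2 mu(A), the two brackets
    give 2 K^4 mu(A). *)
Let rel_sub A : H A -> exists Y, [/\ Bs Y, (m Y <= 2 * K ^+ 4 * m A)%R &
  forall t, rel A t -> t `<=` Y].
Proof.
move=> HA; have BA := HBs HA; have mA := ball_gt0 bb BA.
have k2 := K2; have K4 : (4 <= K ^+ 2)%R by rewrite expr2; nra.
have bBr t : H t -> Bs (br (br t)).
  by move=> /HBs Bt; exact: (bracket_ball bb (bracket_ball bb Bt)).
pose G := [set C | C = A \/ exists2 t, rel A t & C = br (br t)].
have GB : G `<=` Bs by move=> C [->//|[t [Ht _ _ _] ->]]; exact: bBr.
have GM C : G C -> (m C <= 2 * K ^+ 2 * m A)%R.
  move=> [->|[t [Ht sAt _ _] ->]]; first by nra.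
  apply: le_trans (bracket2_le bb (HBs Ht)) _.
  rewrite (_ : (2 * K ^+ 2 * m A = K ^+ 2 * (2 * m A))%R); last by ring.
  rewrite ler_wpM2l ?sqr_ge0//.
  move: sAt; rewrite leq_eqVlt => /orP[/eqP sAt|].
    by rewrite ltW// (scale_eq (H_rng Ht) (H_rng HA)).
  by move=> /(scale_lt (H_rng HA) (H_rng Ht)); lra.
have GA C : G C -> C `&` A !=set0.
  by move=> [->|[t [_ _ _ tA] -> //]]; rewrite setIid; exact: (ball_neq0 bb).
have [|W GW Wmax] := @almost_max G _ _ GB GM; first by exists A; left.
have BW := GB _ GW; have BbW := bracket_ball bb BW.
have AW : A `<=` br W.
  apply: (engulf bb BA BW); first by apply: Wmax; left.
  by rewrite setIC; exact: GA.
exists (br (br W)); split.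
- exact: (bracket_ball bb BbW).
- apply: le_trans (bracket2_le bb BW) _.
  rewrite (_ : (2 * K ^+ 4 * m A = K ^+ 2 * (2 * K ^+ 2 * m A))%R); last by ring.
  by rewrite ler_wpM2l ?sqr_ge0// GM.
- move=> t rt; have [Ht _ _ _] := rt.
  apply: subset_trans (sub_br2 (HBs Ht)) _.
  have Gt : G (br (br t)) by right; exists t.
  apply: (engulf bb (GB _ Gt) BbW).
    by have := Wmax _ Gt; have := ball_le bb BW BbW (sub_bracket bb BW); lra.
  by have [x [tx Ax]] := GA _ Gt; exists x; split => //; exact: AW.
Qed.

Let later A := [set b | [/\ H b, (sc A < sc b)%N & b `&` A !=set0]].

(** By [later_ancestor] the later balls are strict descendants of balls t related to A. At each of
    at most J scales the t are disjoint inside Y, and the descendants of t have total measure at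
    most 2 q mu(t). The hypothesis [qsmall] is exactly what turns the resulting 4 (J+1) K^4 q into
    at most 1/2. *)
Let later_esum A : H A -> \esum_(b in later A) mu b <= (2^-1)%:E * mu A.
Proof.
move=> HA; have BA := HBs HA; have [Y [BY mY relY]] := rel_sub HA.
pose relk k := [set t | rel A t /\ sc t = (sc A + k)%N].
have H0 (S : set (set X)) : S `<=` H -> forall x, S x -> 0 <= mu x by [].
apply: (@le_trans _ _ (\esum_(b in \bigcup_(k in `I_J) \bigcup_(t in relk k)
    \bigcup_n desc n.+1 t) mu b)).
  apply: esum_subset => b [Hb sAb bA].
  have [t [n [Ht sAt At tA dn]]] := later_ancestor HA Hb sAb bA.
  have rt : rel A t by [].
  exists (sc t - sc A)%N; last first.
    by exists t; [split => //; rewrite subnKC|exists n].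
  by rewrite /= ltn_subLR// (comparable_scale HA Ht).
apply: le_trans (esum_bigcup_le _ _ _) _ => //.
apply: (@le_trans _ _ (\esum_(k in `I_J) ((2 * q)%:E * mu Y))).
  apply: le_esum => k _; apply: le_trans (esum_bigcup_le _ _ _) _ => //.
  apply: (@le_trans _ _ ((2 * q)%:E * \esum_(t in relk k) mu t)).
    apply: le_esumZl => //; first by rewrite mulr_ge0.
    by move=> t [[Ht _ _ _] _]; exact: desc_esum.
  apply: lee_wpmul2l; first by rewrite lee_fin mulr_ge0.
  apply: (esum_trivIset_le mu (F := id)) => //.
  - by move=> t [[Ht _ _ _] _]; exact: (ball_meas bb (HBs Ht)).
  - by move=> t u [[Ht _ _ _] st] [[Hu _ _ _] su]; apply: Hdisj => //; rewrite st.
  - exact: (ball_meas bb BY).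
  - by move=> t [/relY].
rewrite (ball_muE bb BY) (ball_muE bb BA) esum_fset//; last first.
  by move=> k _; rewrite -EFinM lee_fin mulr_ge0 ?fine_ge0//; apply: mulr_ge0.
rewrite -fsbig_ord -EFinM sumEFin sumr_const card_ord -EFinM lee_fin -[X in (X <= _)%R]mulr_natr.
have mA := ball_gt0 bb BA.
apply: (@le_trans _ _ (2 * q * (2 * K ^+ 4 * m A) * J.+1%:R)%R).
  have qq : (0 <= 2 * q)%R by apply: mulr_ge0.
  by rewrite ler_pM// ?ler_wpM2l ?ler_nat//; apply: mulr_ge0; rewrite ?fine_ge0.
rewrite (_ : (_ * J.+1%:R =
  2^-1 * ((8 * J.+1%:R * K ^+ 4 * q) * m A))%R); last by field.
by rewrite ler_wpM2l ?invr_ge0// -[leRHS]mul1r ler_wpM2r// ltW.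
Qed.

(** The set witnessing sparseness: removing all later balls separates different scales, while balls
    of one scale are disjoint already. *)
Let core A := A `\` \bigcup_(b in [set b | H b /\ (sc A < sc b)%N]) b.

Let coreP A : H A ->
  [/\ measurable (core A), core A `<=` A & (2^-1 * m A <= m (core A))%R].
Proof.
move=> HA; have BA := HBs HA; have mA := ball_meas bb BA.
have mc : measurable (core A).
  by apply: measurableD => //; apply: (ball_separable bb) => b [/HBs].
split => //; first by move=> x [].
set L := \bigcup_(b in later A) b.
have mL : measurable L by apply: (ball_separable bb) => b [/HBs].
have cA : core A = A `\` (A `&` L).
  apply/seteqP; split=> [x [Ax nx]|x [Ax nx]]; split => //.
    by move=> [_ [b [Hb sb _] bx]]; apply: nx; exists b.
  by move=> [b [Hb sb] bx]; apply: nx; split => //; exists b => //; split => //; exists x.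
have muL : mu (A `&` L) <= (2^-1)%:E * mu A.
  apply: (@le_trans _ _ (mu L)).
    by apply: (le_measure' mu (measurableI _ _ mA mL) mL) => x [].
  apply: le_trans (later_esum HA); apply: measure_bigcup_le_esum.
    by apply: sub_countable H_countable; apply: subset_card_le => b [].
  by move=> b [/HBs Bb _ _]; exact: (ball_meas bb Bb).
have fL : mu (A `&` L) \is a fin_num.
  by apply: (fDA BA (measurableI _ _ mA mL)) => x [].
have fC : mu (core A) \is a fin_num by apply: (fDA BA mc) => x [].
have : mu A = mu (core A) + mu (A `&` L).
  by rewrite cA setDE setCI setIUr setICr set0U -setDE -measureDI.
move: muL; rewrite (ball_muE bb BA) -(fineK fL) -(fineK fC) -EFinD -EFinM.
by rewrite lee_fin => muL [mAE]; lra.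
Qed.

Let core_triv : trivIset H core.
Proof.
move=> A C HA HC [x [[Ax nA] [Cx nC]]].
have [lt|lt|eAC] := ltngtP (sc A) (sc C).
- by exfalso; apply: nA; exists C.
- by exfalso; apply: nC; exists A.
- by apply: Hdisj => //; exists x.
Qed.

(** By Borel-Cantelli almost every x lies in brackets of selected balls of finitely many scales
    only. Let A have the last such scale. If x were in [D A], a stopping ball b around x would be a
    candidate of a later scale. A ball C selected at the scale of b would meet b, hence engulf it in
    [C], so x would be in a bracket of a later scale. *)
Let settled : \forall x \ae mu, B x -> exists2 A, H A & br A x /\ ~ D A x.
Proof.
have [q2 _ _] := q_bounds.
have stopP A : H A -> exists N, [/\ measurable N, mu N = 0 &
    forall x, D A x -> ~ N x -> exists b, [/\ Bs b, b x & stop A b]].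
  move=> HA; have BA := HBs HA; have mDA := mD BA.
  have fD : mu (D A) \is a fin_num.
    by apply: (fDA (bracket_ball bb (bracket_ball bb BA))) => //; exact: DZ.
  have [|N [mN N0 NP]] := stopping_ball bb dbl mDA fD.
    (* The hypothesis 2 mu(D) <= mu(X) of [stopping_ball] follows from e <= q / 4 <= 1/8. *)
    apply: (@le_trans _ _ (mu A)); last by apply: le_measure' => //; exact: (ball_meas bb BA).
    rewrite -(fineK fD) (ball_muE bb BA) -EFinM lee_fin.
    have [eta1 _] := dbl; have k2 := K2.
    have e1 : (4 * e <= q)%R.
      have [e0|e0] := leP 0%R e; last first.
        by apply: le_trans q0; lra.
      have : (1 <= K ^+ 2)%R by rewrite expr2; nra.
      move=> k21; have ek : (1 <= eta * K ^+ 2)%R by nra.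
      rewrite (_ : q = 4 * (eta * K ^+ 2 * e))%R; last by ring.
      by rewrite ler_wpM2l// ler_peMl.
    have h1 := De BA; have h2 := ball_gt0 bb BA; have : (e <= 8^-1)%R by lra.
    by nra.
  exists N; split => // x Dx Nx; have [b [? ? ? ?]] := NP x Dx Nx.
  by exists b.
have [N NP] : exists N : set X -> set X, forall A, H A ->
    [/\ measurable (N A), mu (N A) = 0 &
    forall x, D A x -> ~ N A x -> exists b, [/\ Bs b, b x & stop A b]].
  pose N A := xget set0 [set N | [/\ measurable N, mu N = 0 &
    forall x, D A x -> ~ N x -> exists b, [/\ Bs b, b x & stop A b]]].
  exists N => A HA; rewrite /N; case: xgetP => [? -> //|noN].
  by have [M ?] := stopP A HA; case: (noN M).
pose U j := \bigcup_(A in [set A | H A /\ sc A = j]) br A.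
have mU j : measurable (U j).
  apply: countable_bigcup_measurable.
    by apply: sub_countable H_countable; apply: subset_card_le => b [].
  by move=> A [/HBs BA _]; exact: (ball_meas bb (bracket_ball bb BA)).
have U0 : mu (lim_sup_set U) = 0.
  apply: lim_sup_set_cvg0 => //.
  apply: (@le_lt_trans _ _ (K%:E * \esum_(A in H) mu A)); last first.
    rewrite lte_mul_pinfty//.
    - by rewrite lee_fin; have k2 := K2; lra.
    - by apply: le_lt_trans H_esum _; rewrite (ball_muE bb BB) -EFinM ltry.
  rewrite (_ : H = \bigcup_j [set A | H A /\ sc A = j]); last first.
    apply/seteqP; split=> [A HA|A [j _ []]//]; first by exists (sc A).
  rewrite nneseries_sum_bigcup//; last first.
    by move=> i j _ _ [A [[_ <-] [_ <-]]].
  rewrite -nneseriesZl//; last by move=> j _; apply: esum_ge0.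
  apply: lee_nneseries => // j _.
  apply: (@le_trans _ _ (\esum_(A in [set A | H A /\ sc A = j]) mu (br A))).
    apply: measure_bigcup_le_esum.
      by apply: sub_countable H_countable; apply: subset_card_le => b [].
    by move=> A [/HBs BA _]; exact: (ball_meas bb (bracket_ball bb BA)).
  apply: le_esumZl => //; first by have k2 := K2; lra.
  move=> A [/HBs BA _]; rewrite (ball_muE bb BA) (ball_muE bb (bracket_ball bb BA)).
  by rewrite -EFinM lee_fin bracket_le.
have N0 : mu (\bigcup_(A in H) N A) = 0.
  apply/eqP; rewrite eq_le measure_ge0 andbT.
  apply: le_trans (measure_bigcup_le_esum _ H_countable _) _.
    by move=> A /NP[].
  by rewrite esum1// => A /NP[].
exists ((\bigcup_(A in H) N A) `|` lim_sup_set U); split.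
- apply: measurableU.
    by apply: countable_bigcup_measurable => [|A /NP[]//]; exact: H_countable.
  apply: bigcapT_measurable => n; apply: bigcup_measurable => k _; exact: mU.
- apply/eqP; rewrite eq_le measure_ge0 andbT -[leRHS]adde0 -[X in _ <= X + _]N0 -[X in _ <= _ + X]U0.
  apply: measureU2.
    by apply: countable_bigcup_measurable => [|A /NP[]//]; exact: H_countable.
  apply: bigcapT_measurable => n; apply: bigcup_measurable => k _; exact: mU.
move=> x /= nx; apply: contrapT => /not_orP[nN nU]; apply: nx => Bx.
have [n0 nU0] : exists n0, forall j, (n0 <= j)%N -> ~ U j x.
  apply: contrapT => /forallNP h; apply: nU => n _.
  have /existsNP[j /not_implyP[nj /contrapT Ujx]] := h n.
  by exists j.
pose P j := `[< exists A, [/\ H A, sc A = j & br A x] >].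
have exP : exists j, P j.
  by exists 0%N; apply/asboolP; exists B; split => //; apply: sub_bracket Bx.
have ubP j : P j -> (j <= n0)%N.
  move=> /asboolP[A [HA sA Ax]]; rewrite leqNgt; apply/negP => /ltnW/nU0.
  by apply; exists A.
case: (ex_maxnP exP ubP) => j /asboolP[A [HA sA Ax]] jmax.
exists A => //; split => // DAx.
have [_ _ /(_ x DAx)[|b [Bb bx stb]]] := NP A HA.
  by move=> NAx; apply: nN; exists A.
have BA := HBs HA.
have bA := stop_le BA Bb stb.
have b0 := ball_gt0 bb Bb; have A0 := ball_gt0 bb BA.
have bB : (0 < m b <= m B)%R.
  by rewrite b0/=; have /andP[_] := H_rng HA; nra.
have sAb : (sc A < sc b)%N by apply: (scale_gt (H_rng HA) bB); nra.
have [|C [HC sC Cb]] := Hmax (ball_neq0 bb Bb).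
  right; exists x, A; split => //; split => // C [HC sCb] Cx; rewrite sA.
  by apply: jmax; apply/asboolP; exists C.
have : (sc b <= j)%N.
  apply: jmax; apply/asboolP; exists C; split => //.
  apply: (engulf bb Bb (HBs HC) _ _ bx); last by rewrite setIC.
  by rewrite ltW// (scale_eq bB (H_rng HC)).
by rewrite -sA leqNgt sAb.
Qed.

Lemma selected_tree : exists (par core : set X -> set X),
  [/\ [/\ H B, H `<=` Bs, countable H & forall A, H A -> (m A <= m B)%R],
      forall A, H A -> A <> B ->
        [/\ H (par A), (m A <= q * m (par A))%R,
            br (br A) `<=` br (br (par A)) &
            (2 * m (A `&` D (par A)) <= m A)%R],
      forall P, H P -> \esum_(b in [set b | [/\ H b, b <> B & par b = P]]) mu b
        <= q%:E * mu P,
      (forall A, H A -> [/\ measurable (core A), core A `<=` A &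
        (2^-1 * m A <= m (core A))%R]) /\ trivIset H core &
      \forall x \ae mu, B x -> exists2 A, H A & br A x /\ ~ D A x].
Proof.
exists par, core; split.
- by split; [exact: HB|exact: HBs|exact: H_countable|move=> A /H_ball[]].
- move=> A HA nAB; split; [exact: par_H|exact: par_le|exact: par_sub|].
  by have [x [_ _ _ _ [[_ ?] _]]] := parP HA nAB.
- exact: children_sum.
- by split; [exact: coreP|exact: core_triv].
- exact: settled.
Qed.

End Selected.

Lemma stopping_tree : exists (H : set (set X)) (par core : set X -> set X),
  [/\ [/\ H B, H `<=` Bs, countable H & forall A, H A -> (m A <= m B)%R],
      forall A, H A -> A <> B ->
        [/\ H (par A), (m A <= q * m (par A))%R,
            br (br A) `<=` br (br (par A)) &
            (2 * m (A `&` D (par A)) <= m A)%R],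
      forall P, H P -> \esum_(b in [set b | [/\ H b, b <> B & par b = P]]) mu b
        <= q%:E * mu P,
      (forall A, H A -> [/\ measurable (core A), core A `<=` A &
        (2^-1 * m A <= m (core A))%R]) /\ trivIset H core &
      \forall x \ae mu, B x -> exists2 A, H A & br A x /\ ~ D A x].
Proof.
have [H /= [Hc Hd Hm]] := scale_selection sc cand.
by exists H; exact: selected_tree.
Qed.

End StoppingTree.

(** * Chains of ancestors *)

Section DescendantsTheory.
Context {T : Type} (N : set T) (root : T) (par : T -> T).
Local Notation desc := (descendants N root par).

Lemma descendants_iter n a b : desc n a b -> iter n par b = a.
Proof.
elim: n b => [//|n IHn] b [_ _ /IHn]; rewrite iterSr; exact.
Qed.

Lemma descendants_sub n a b k : desc n a b -> (k <= n)%N ->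
  desc (n - k) a (iter k par b).
Proof.
elim: k n b => [|k IHk] n b db; first by rewrite subn0.
case: n db => [//|n] [_ _ db]; rewrite ltnS subSS iterSr; exact: IHk.
Qed.

Lemma descendants_prefix n a b k : desc n a b -> (k <= n)%N ->
  desc k (iter k par b) b.
Proof.
elim: k n b => [//|k IHk] [//|n] b [Nb br db] kn; split => //.
by rewrite iterSr; exact: IHk db kn.
Qed.

(** A chain of ancestors cannot continue past the root. Hence depths are unique and a chain has no
    repetition. *)
Lemma descendants_root n k a b : desc n root b -> desc k a b -> (k <= n)%N.
Proof.
elim: n k b => [|n IHn] [|k] b //.
  by move=> -> [].
by move=> [_ _ dn] [_ _ dk]; rewrite ltnS; exact: IHn dn dk.
Qed.

Lemma descendants_in n a b : N a -> desc n a b -> N b.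
Proof. by move=> Na; case: n => [->//|n []]. Qed.

End DescendantsTheory.

(** * From the tree to the sparse family and its shrunk sets *)

Section Domination.
Context d (X : measurableType d) (R : realType).
Context (mu : {measure set X -> \bar R}) (Bs : set (set X)) (K eta : R).
Hypothesis bb : ball_basis mu Bs K.
Hypothesis dbl : doubling mu Bs eta.
Hypothesis K2 : (2 <= K)%R.
Local Notation m A := (fine (mu A)).
Local Notation br := (bracket mu Bs K).

Context (B : set X) (g : X -> R) (w c : set X -> R) (e : R) (J : nat).
Hypothesis BB : Bs B.
Hypothesis mg : measurable_fun setT g.
Hypothesis w0 : forall G, Bs G -> (0 <= w G)%R.

Let D G := [set y | G y /\ (w G < `|g y - c G|)%R].
Hypothesis De : forall G, Bs G -> (m (D G) <= e * m G)%R.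
Local Notation q := (2 * (2 * eta * K ^+ 2) * (e * K ^+ 2))%R.
Hypothesis KJ : (2 * K ^+ 2 <= 2 ^+ J)%R.
Hypothesis e0 : (0 <= e)%R.
Hypothesis qsmall : (8 * J.+1%:R * K ^+ 4 * q <= 1)%R.

Let Z A := br (br A).

Let Z_ball A : Bs A -> Bs (Z A).
Proof. by move=> BA; exact: (bracket_ball bb (bracket_ball bb BA)). Qed.

Let Z_le A : Bs A -> (m (Z A) <= K ^+ 2 * m A)%R.
Proof. by move=> BA; exact: (bracket2_le bb BA). Qed.

Let sub_Z A : Bs A -> A `<=` Z A.
Proof.
move=> BA; apply: subset_trans (sub_bracket bb BA) _.
exact: (sub_bracket bb (bracket_ball bb BA)).
Qed.

Let mD G : Bs G -> measurable (D G).
Proof.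
move=> BG; rewrite (_ : D G = G `&` [set y | (w G < `|g y - c G|)%R])//.
apply: measurableI; first exact: (ball_meas bb BG).
have mN : measurable_fun setT (fun y => `|g y - c G|)%R.
  by apply: measurableT_comp => //; exact: measurable_funB.
have := measurable_fun_ltr (measurable_cst (w G)) mN.
move=> /(_ measurableT [set true]); rewrite setTI; apply.
by [].
Qed.

Let q_bounds : [/\ (0 <= q)%R, (2 * K ^+ 2 * q <= 2^-1)%R & (e * K ^+ 2 <= 4^-1)%R].
Proof.
have k2 := K2; have [eta1 _] := dbl; have e00 := e0.
have K44 : (4 <= K ^+ 2)%R by rewrite expr2; nra.
have K41 : (4 * K ^+ 2 <= K ^+ 4)%R by rewrite (exprD K 2 2) ler_wpM2r ?sqr_ge0.
have eK : (0 <= e * K ^+ 2)%R by rewrite mulr_ge0 ?sqr_ge0.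
have eq : (4 * (e * K ^+ 2) <= q)%R.
  rewrite (_ : (2 * (2 * eta * K ^+ 2) * (e * K ^+ 2) =
    4 * (eta * K ^+ 2 * (e * K ^+ 2)))%R); last by ring.
  by rewrite ler_wpM2l// ler_peMl//; nra.
have J1 : (1 <= J.+1%:R :> R)%R by rewrite ler1n.
move: qsmall eq eK; move: (q) => t tsmall et eK.
have t0 : (0 <= t)%R by lra.
have h : (8 * K ^+ 4 * t <= 1)%R.
  apply: le_trans tsmall; rewrite ler_wpM2r// ler_wpM2r ?exprn_ge0//; first by lra.
  by lra.
have Kt : (4 * K ^+ 2 * t <= K ^+ 4 * t)%R by rewrite ler_wpM2r.
have t4 : (4 * t <= K ^+ 2 * t)%R by rewrite ler_wpM2r.
move: h Kt t4; rewrite -!mulrA; move: (K ^+ 4 * t)%R (K ^+ 2 * t)%R => a b.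
by move=> *; split; lra.
Qed.

Section Quotient.
Context (H : set (set X)) (par core : set X -> set X).
Hypotheses (HB : H B) (HBs : H `<=` Bs) (cH : countable H).
Hypothesis H_le : forall A, H A -> (m A <= m B)%R.
Hypothesis parP : forall A, H A -> A <> B ->
  [/\ H (par A), (m A <= q * m (par A))%R, Z A `<=` Z (par A) &
      (2 * m (A `&` D (Z (par A))) <= m A)%R].
Hypothesis children : forall P, H P ->
  \esum_(b in [set b | [/\ H b, b <> B & par b = P]]) mu b <= q%:E * mu P.
Hypothesis coreP : forall A, H A -> [/\ measurable (core A), core A `<=` A &
  (2^-1 * m A <= m (core A))%R].
Hypothesis tcore : trivIset H core.
Hypothesis settled : \forall x \ae mu, B x ->
  exists2 A, H A & br A x /\ ~ D (Z A) x.

(* Different balls of the tree may be contained in the same ball [Z A]; these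
   are identified, the parent being that of a chosen representative. *)
Let N := Z @` H.
Let rep G : set X := xget set0 [set A | H A /\ Z A = G].
Let up G := Z (par (rep G)).
Let root := Z B.

Let repP G : N G -> H (rep G) /\ Z (rep G) = G.
Proof.
by move=> [A HA <-]; rewrite /rep; case: xgetP => [C -> //|/(_ A)[]].
Qed.

Let N_ball G : N G -> Bs G.
Proof. by move=> [A /HBs BA <-]; exact: Z_ball. Qed.

Let N_root : N root. Proof. by exists B. Qed.

Let cN : countable N.
Proof.
apply: sub_countable cH; exact: card_image_le.
Qed.

Let repB G : N G -> G <> root -> rep G <> B.
Proof. by move=> NG nr rB; apply: nr; have [_ <-] := repP NG; rewrite rB. Qed.

Let up_N G : N G -> G <> root -> N (up G).
Proof.
move=> NG nr; have [HG _] := repP NG; have [? _ _ _] := parP HG (repB NG nr).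
by exists (par (rep G)).
Qed.

Let sub_up G : N G -> G <> root -> G `<=` up G.
Proof.
move=> NG nr; have [HG ZG] := repP NG; have [_ _ + _] := parP HG (repB NG nr).
by rewrite ZG.
Qed.

(** After the identification, a chain of representatives is no longer a chain of the tree. Growth of
    the measure replaces the decrease of scales in showing that iterated parents reach the root. *)
Let up_le G : N G -> G <> root -> (2 * m G <= m (up G))%R.
Proof.
move=> NG nr; have [HG ZG] := repP NG; have [HP le _ _] := parP HG (repB NG nr).
have BP := HBs HP.
have h1 := Z_le (HBs HG); rewrite ZG in h1.
have h2 := ball_le bb BP (Z_ball BP) (sub_Z BP).
have h3 := ball_gt0 bb BP.
have [q0 q2 _] := q_bounds.
have k0 : (0 <= K ^+ 2)%R by rewrite sqr_ge0.
have : (2 * K ^+ 2 * m (rep G) <= 2 * K ^+ 2 * (q * m (par (rep G))))%R.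
  by rewrite ler_wpM2l// mulr_ge0.
rewrite -/(up G) mulrA => h4.
have : (2 * K ^+ 2 * q * m (par (rep G)) <= 2^-1 * m (par (rep G)))%R.
  by rewrite ler_wpM2r// ltW.
move: h1 h4; rewrite -mulrA; move: (K ^+ 2 * _)%R => a.
rewrite /up; lra.
Qed.

Let sub_mD G A : Bs A -> Bs G -> (m (A `&` D G) <= m (D G))%R.
Proof.
move=> BA BG; have mA := ball_meas bb BA; have mG := ball_meas bb BG.
have fD : mu (D G) \is a fin_num.
  by apply: (fin_num_sub (mD BG) mG _ (ball_fin bb BG)) => x [].
by apply: (le_fine_measure (measurableI _ _ mA (mD BG)) (mD BG) _ fD) => x [].
Qed.

Let DZ_le A : Bs A -> (m (D (Z A)) <= e * K ^+ 2 * m A)%R.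
Proof.
move=> BA; apply: le_trans (De (Z_ball BA)) _.
by rewrite -mulrA ler_wpM2l// Z_le.
Qed.

(** The exceptional set of the parent takes at most half of [rep G], that of G at most a quarter; at
    a remaining point g is close to both centres. *)
Let center_up G : N G -> G <> root -> (`|c G - c (up G)| <= w G + w (up G))%R.
Proof.
move=> NG nr; have [HG ZG] := repP NG.
have [HP _ sP half] := parP HG (repB NG nr).
have BA := HBs HG; have BP := HBs HP.
set A := rep G in HG ZG HP sP half BA BP *.
have [y [Ay nDA nDP]] : exists y, [/\ A y, ~ D (Z A) y & ~ D (Z (par A)) y].
  apply: contrapT => /forallNP ny.
  have mA := ball_meas bb BA.
  have mDA := mD (Z_ball BA); have mDP := mD (Z_ball BP).
  have mI1 := measurableI _ _ mA mDA; have mI2 := measurableI _ _ mA mDP.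
  have fI F : measurable F -> mu (A `&` F) \is a fin_num.
    move=> mF; apply: (fin_num_sub (measurableI _ _ mA mF) mA _ (ball_fin bb BA)).
    by move=> x [].
  have : mu A <= mu (A `&` D (Z A)) + mu (A `&` D (Z (par A))).
    apply: (@le_trans _ _ (mu ((A `&` D (Z A)) `|` (A `&` D (Z (par A)))))).
      apply: (le_measure' mu mA (measurableU _ _ mI1 mI2)) => x Ax.
      have [?|nD1] := pselect (D (Z A) x); first by left.
      right; split => //; apply: contrapT => nD2.
      by apply: (ny x).
    exact: measureU2.
  rewrite (ball_muE bb BA) -(fineK (fI _ mDA)) -(fineK (fI _ mDP)) -EFinD lee_fin.
  have := sub_mD BA (Z_ball BA); have := DZ_le BA; have := ball_gt0 bb BA.
  have [_ _ e4] := q_bounds.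
  have : (e * K ^+ 2 * m A <= 4^-1 * m A)%R by rewrite ler_wpM2r// fine_ge0.
  by move: half; lra.
have ZAy : Z A y by exact: sub_Z.
have gA : (`|g y - c G| <= w G)%R.
  by rewrite -ZG leNgt; apply/negP => lt; apply: nDA.
have gP : (`|g y - c (up G)| <= w (up G))%R.
  by rewrite leNgt; apply/negP => lt; apply: nDP; split => //; exact: sP.
rewrite (_ : (c G - c (up G) = (g y - c (up G)) - (g y - c G))%R); last by ring.
by apply: le_trans (ler_normB _ _) _; rewrite addrC lerD.
Qed.

(** Several tree balls A may have Z(A) = Y. Their cores are disjoint in Y and carry half of their
    measures, so their children add up to at most 2 q mu(Y). Replacing each representative by its
    double bracket costs K^2, and 2 K^2 q <= 1/2. *)
Let up_children Y : N Y ->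
  \esum_(G in [set G | [/\ N G, G <> root & up G = Y]]) mu G
    <= (2^-1)%:E * mu Y.
Proof.
move=> NY; have BY := N_ball NY.
have [q0 q2 _] := q_bounds.
set ch := [set G | _].
apply: (@le_trans _ _ ((K ^+ 2)%:E * \esum_(G in ch) mu (rep G))).
  apply: le_esumZl => //; first by rewrite sqr_ge0.
  move=> G [NG _ _]; have [HG ZG] := repP NG; have BA := HBs HG.
  by rewrite (ball_muE bb (N_ball NG)) (ball_muE bb BA) -EFinM lee_fin -{1}ZG Z_le.
have : \esum_(G in ch) mu (rep G) <= (2 * q)%:E * mu Y.
  rewrite -(@esum_image _ _ _ ch rep mu); last first.
    move=> G G' /set_mem[NG _ _] /set_mem[NG' _ _] rr.
    by rewrite -(repP NG).2 rr (repP NG').2.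
  apply: (@le_trans _ _ (\esum_(b in \bigcup_(A in [set A | H A /\ Z A = Y])
      [set b | [/\ H b, b <> B & par b = A]]) mu b)).
    apply: esum_subset => _ [G [NG nr uG] <-]; have [HG ZG] := repP NG.
    have [HP _ _ _] := parP HG (repB NG nr).
    by exists (par (rep G)) => //; split => //; exact: repB.
  apply: le_trans (esum_bigcup_le _ _ _) _ => //.
  apply: (@le_trans _ _ ((2 * q)%:E * \esum_(A in [set A | H A /\ Z A = Y])
      mu (core A))).
    apply: le_esumZl => //; first by rewrite mulr_ge0.
    move=> A [HA _]; apply: le_trans (children HA) _.
    have BA := HBs HA; have [mc cA cle] := coreP HA.
    have fc := fin_num_sub mc (ball_meas bb BA) cA (ball_fin bb BA).
    rewrite (ball_muE bb BA) -(fineK fc) -!EFinM lee_fin [(2 * q)%R]mulrC.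
    by rewrite -[leRHS]mulrA ler_wpM2l//; lra.
  apply: lee_wpmul2l; first by rewrite lee_fin mulr_ge0.
  apply: esum_trivIset_le; last 2 first.
  - exact: (ball_meas bb BY).
  - move=> A [HA <-]; have [_ cA _] := coreP HA.
    by apply: subset_trans cA _; apply: sub_Z; exact: HBs.
  - by move=> A [/coreP[]].
  - by move=> A C [HA _] [HC _]; exact: tcore.
move=> /(lee_wpmul2l (x := (K ^+ 2)%:E)).
rewrite lee_fin sqr_ge0 => /(_ isT) /le_trans; apply.
rewrite muleA -EFinM lee_wpmul2r// lee_fin.
by rewrite mulrCA [leLHS]mulrA.
Qed.

Local Notation desc := (descendants N root up).

Let N_depth G : N G -> exists n, desc n root G.
Proof.
pose M := (K ^+ 2 * m B)%R.
have rng C : N C -> (0 < m C <= M)%R.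
  move=> NC; rewrite (ball_gt0 bb (N_ball NC))/=; case: NC => A HA <-.
  apply: le_trans (Z_le (HBs HA)) _.
  by rewrite ler_wpM2l ?sqr_ge0// H_le.
have [k] := ubnP (scale M (m G)); elim: k G => // k IHk G; rewrite ltnS => sG NG.
have [->|nr] := pselect (G = root); first by exists 0%N.
have lt := scale_gt (rng _ (up_N NG nr)) (rng _ NG) (up_le NG nr).
have [n dn] := IHk _ (leq_trans lt sG) (up_N NG nr).
by exists n.+1.
Qed.

Let desc_sub n Y G : desc n Y G -> G `<=` Y.
Proof.
elim: n G => [|n IHn] G; first by move=> ->.
by move=> [NG nr /IHn]; apply: subset_trans; exact: sub_up.
Qed.

Let settledP := \bigcup_(G in N) (core (rep G) `\` D G).

Let num : {f : set X -> nat | {in N &, injective f}}.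
Proof. by apply/cid/countable_injP. Qed.

(** The leaves partition the points lying in some [G] but not in its [D G]. Each G keeps the
    unexceptional part of its own core, which ensures that its leaf is not empty; every other point
    goes to the first suitable G in the numbering [num]. *)
Let leaf G := (core (rep G) `\` D G) `|` (((G `\` D G) `\` settledP) `\`
  \bigcup_(G' in [set G' | N G' /\ (sval num G' < sval num G)%N]) (G' `\` D G')).

Let core_sub G : N G -> core (rep G) `<=` G.
Proof.
move=> NG; have [HG ZG] := repP NG; have [_ cA _] := coreP HG.
by apply: subset_trans cA _; rewrite -{2}ZG; apply: sub_Z; exact: HBs.
Qed.

Let leaf_sub G : N G -> leaf G `<=` G `\` D G.
Proof.
by move=> NG x [[cx nD]|[[]]//]; split => //; exact: core_sub.
Qed.

Let m_core G : N G -> measurable (core (rep G)).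
Proof. by move=> /repP[/coreP[]]. Qed.

Let leaf_m G : N G -> measurable (leaf G).
Proof.
move=> NG; have mDD C : N C -> measurable (D C) by move=> /N_ball/mD.
have mC C : N C -> measurable C by move=> /N_ball BC; exact: (ball_meas bb BC).
apply: measurableU.
  by apply: measurableD; [exact: m_core|exact: mDD].
apply: measurableD; first apply: measurableD.
- by apply: measurableD; [exact: mC|exact: mDD].
- apply: countable_bigcup_measurable => // C NC.
  by apply: measurableD; [exact: m_core|exact: mDD].
- apply: countable_bigcup_measurable => [|C [NC _]].
    by apply: sub_countable cN; apply: subset_card_le => C [].
  by apply: measurableD; [exact: mC|exact: mDD].
Qed.

Let leaf_triv G G' : N G -> N G' -> leaf G `&` leaf G' !=set0 -> G = G'.
Proof.
move=> NG NG' [x []].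
move=> [[cx nD]|[[[Gx nD] nS] nb]] [[cx' nD']|[[[Gx' nD'] nS'] nb']].
- have [HG <-] := repP NG; have [HG' <-] := repP NG'.
  by congr Z; apply: tcore => //; exists x.
- by exfalso; apply: nS'; exists G.
- by exfalso; apply: nS; exists G'.
- have /countable_injP _ := cN; have inj := svalP num.
  have [lt|lt|eq] := ltngtP (sval num G) (sval num G').
  + by exfalso; apply: nb'; exists G.
  + by exfalso; apply: nb; exists G'.
  + by apply: inj => //; exact: mem_set.
Qed.

(** The core has at least half the measure of [rep G], and [D G] at most a quarter of it. *)
Let leaf_neq0 G : N G -> leaf G !=set0.
Proof.
move=> NG; have [HG ZG] := repP NG; have BA := HBs HG.
have [mc cA cle] := coreP HG.
apply: contrapT => /set0P/negP/negPn/eqP l0.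
have sub : core (rep G) `<=` D G.
  move=> x cx; apply: contrapT => nD.
  by have : leaf G x by [left]; rewrite l0.
have BG := N_ball NG; have mG := ball_meas bb BG.
have fD : mu (D G) \is a fin_num.
  by apply: (fin_num_sub (mD BG) mG _ (ball_fin bb BG)) => x [].
have := le_fine_measure mc (mD BG) sub fD.
have := DZ_le BA; rewrite ZG => h1; have := ball_gt0 bb BA.
have [_ _ e4] := q_bounds.
have : (e * K ^+ 2 * m (rep G) <= 4^-1 * m (rep G))%R.
  by rewrite ler_wpM2r// fine_ge0.
by move: cle h1; lra.
Qed.

Let leaf_cover G x : N G -> G x -> ~ D G x -> exists2 G', N G' & leaf G' x.
Proof.
move=> NG Gx nD.
have [[G' NG' [cx nD']]|nS] := pselect (settledP x).
  by exists G' => //; left.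
pose P k := `[< exists G, [/\ N G, sval num G = k, G x & ~ D G x] >].
have exP : exists k, P k by exists (sval num G); apply/asboolP; exists G.
case: (ex_minnP exP) => k /asboolP[G' [NG' nk G'x nD']] kmin.
exists G' => //; right; split => // -[C [NC lt] [Cx nDC]].
have : (k <= sval num C)%N by apply: kmin; apply/asboolP; exists C.
by rewrite leqNgt -nk lt.
Qed.

Let bar Y := \bigcup_(G in [set G | N G /\ exists n, desc n Y G]) leaf G.

(** A point has only one leaf, so the shrunk sets containing it are those of the ancestors of that
    leaf; sums over the family become sums along one chain. *)
Let bar_leaf G x n : N G -> leaf G x -> desc n root G ->
  forall Y, bar Y x <-> exists2 k, (k <= n)%N & Y = iter k up G.
Proof.
move=> NG Gx dn Y; split=> [[G' [NG' [k dk]] G'x]|[k kn ->]].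
  have GG' : G = G' by apply: leaf_triv => //; exists x.
  rewrite -GG' in dk; exists k; first exact: descendants_root dn dk.
  by rewrite (descendants_iter dk).
exists G => //; split => //; exists k.
exact: descendants_prefix dn kn.
Qed.

Let iter_N G n k : N G -> desc n root G -> (k <= n)%N -> N (iter k up G).
Proof.
move=> NG dn kn; apply: descendants_in (descendants_sub dn kn).
exact: N_root.
Qed.

Let iter_inj G n k l : N G -> desc n root G -> (k <= n)%N -> (l <= n)%N ->
  iter k up G = iter l up G -> k = l.
Proof.
move=> NG dn kn ln kl.
have dk := descendants_sub dn kn; have dl := descendants_sub dn ln.
rewrite kl in dk.
have h1 := descendants_root dk dl; have h2 := descendants_root dl dk.
by apply/eqP; rewrite eqn_leq; apply/andP; split; lia.
Qed.

Let esum_bar (F : set X -> \bar R) G x n : (forall Y, N Y -> 0 <= F Y) ->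
  N G -> leaf G x -> desc n root G ->
  \esum_(Y in N) (F Y * (\1_(bar Y) x)%:E) = \sum_(k < n.+1) F (iter k up G).
Proof.
move=> F0 NG Gx dn; have barP := bar_leaf NG Gx dn.
rewrite (esumID (fun Y => bar Y x)) => [|Y NY]; last first.
  by rewrite mule_ge0 ?F0// lee_fin.
rewrite [X in _ + X]esum1 ?adde0 => [|Y [NY nb]]; last first.
  by rewrite indicE memNset// mule0.
rewrite (_ : N `&` _ = (fun k => iter k up G) @` `I_n.+1); last first.
  apply/seteqP; split=> [Y [NY /barP[k kn ->]]|_ [k kn <-]]; first by exists k.
  by split; [exact: (iter_N NG dn)|apply/barP; exists k].
rewrite esum_image; last first.
  by move=> k l /set_mem/= kn /set_mem/= ln; exact: (iter_inj NG dn).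
rewrite esum_fset//; last first.
  move=> k /set_mem/= kn.
  by rewrite mule_ge0 ?lee_fin// F0//; exact: (iter_N NG dn).
rewrite -fsbig_ord; apply: eq_bigr => k _.
by rewrite indicE mem_set ?mule1//; apply/barP; exists k => //; rewrite -ltnS.
Qed.

Let chain_le G x n : N G -> leaf G x -> desc n root G ->
  (`|g x - c root| <= 2 * \sum_(k < n.+1) w (iter k up G))%R.
Proof.
move=> NG /(leaf_sub NG)[Gx nD] dn.
have gG : (`|g x - c G| <= w G)%R.
  by rewrite leNgt; apply/negP => lt; apply: nD.
(* Keeping the extra term [w (iter k up G)] on the left pays for the smaller ball in [center_up], so
   that each step adds just twice the new [w]. *)
suff main k : (k <= n)%N -> (`|g x - c (iter k up G)| + w (iter k up G)
    <= 2 * \sum_(i < k.+1) w (iter i up G))%R.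
  have := main _ (leqnn n); rewrite (descendants_iter dn).
  by have := w0 (N_ball N_root); lra.
elim: k => [_|k IHk kn].
  by rewrite big_ord_recr big_ord0/= add0r; lra.
rewrite big_ord_recr/=; have := IHk (ltnW kn).
set a := iter k up G.
have Na : N a by exact: (iter_N NG dn (ltnW kn)).
have nr : a <> root.
  move=> ar; have da := descendants_sub dn (ltnW kn).
  rewrite -/a in da; rewrite ar in da.
  have := @descendants_root _ N root up 0 (n - k) root root erefl da.
  by rewrite leqn0 subn_eq0 leqNgt kn.
have := center_up Na nr; have := ler_distD (c a) (g x) (c (up a)).
lra.
Qed.

Let bar_m Y : measurable (bar Y).
Proof.
apply: countable_bigcup_measurable => [|G [NG _]]; last exact: leaf_m.
by apply: sub_countable cN; apply: subset_card_le => G [].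
Qed.

Let bar_sub Y : bar Y `<=` Y.
Proof.
move=> x [G [NG [n dn]] /(leaf_sub NG)[Gx _]].
exact: desc_sub dn _ Gx.
Qed.

(** A point of the non-empty leaf of one member lies in the shrunk set of the other. By disjointness
    of leaves the first member descends from the second, so it is contained in it; then exchange the
    roles. *)
Let bar_inj Y Y' : N Y -> N Y' -> bar Y = bar Y' -> Y = Y'.
Proof.
suff sub Z1 Z2 : N Z1 -> bar Z1 = bar Z2 -> Z1 `<=` Z2.
  by move=> NY NY' e1; apply/seteqP; split; apply: sub.
move=> N1 e1; have [x lx] := leaf_neq0 N1.
have : bar Z1 x by exists Z1 => //; split => //; exists 0%N.
rewrite e1 => -[G [NG [n dn]] Gx].
have <- : G = Z1 by apply: leaf_triv => //; exists x.
exact: desc_sub dn.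
Qed.

(** Two shrunk sets with a common point belong to ancestors of the same leaf, one of which descends
    from the other. *)
Let bar_mart : martingale_type (bar @` N).
Proof.
move=> _ _ [Y NY <-] [Y' NY' <-].
have [->|/set0P[x [bx b'x]]] := eqVneq (bar Y `&` bar Y') set0.
  exact: Or31.
have [G [NG _] Gx] := bx; have [n dn] := N_depth NG.
have sub Z1 Z2 k l : (k <= l)%N -> (l <= n)%N -> Z1 = iter k up G ->
    Z2 = iter l up G -> bar Z1 `<=` bar Z2.
  move=> kl ln Z1E Z2E z [G' [NG' [j dj]] G'z]; exists G' => //; split => //.
  exists (j + (l - k))%N; apply: descendants_trans dj _.
  have := descendants_sub (descendants_prefix dn ln) kl.
  by rewrite -Z1E -Z2E.
have [k kn Yk] := (bar_leaf NG Gx dn Y).1 bx.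
have [l ln Yl] := (bar_leaf NG Gx dn Y').1 b'x.
have [kl|/ltnW lk] := leqP k l.
  by apply: Or32; exact: (sub _ _ k l).
by apply: Or33; exact: (sub _ _ l k).
Qed.

Let esum_bar1 G x n : N G -> leaf G x -> desc n root G ->
  \esum_(Y in N) (\1_(bar Y) x)%:E = n.+1%:R%:E :> \bar R.
Proof.
move=> NG Gx dn; under eq_esum do rewrite -[(\1_ _ _)%:E]mul1e.
rewrite (esum_bar (F := fun=> 1) _ NG Gx dn)//.
by rewrite sumEFin sumr_const card_ord.
Qed.

Let pow2_le (l : R) k : (l < k.+1%:R)%R ->
  (2^-1 ^+ k <= 2 * expR (- (ln 2 * l)))%R.
Proof.
move=> lk.
have e2 : (expR (ln 2) = 2 :> R)%R by rewrite lnK// posrE.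
have l2 : (0 <= ln 2 :> R)%R by rewrite ln_ge0// ler1n.
have E1 : (2^-1 ^+ k = expR (k%:R * - ln 2) :> R)%R.
  by rewrite expRM_natl expRN e2.
have E2 : (2 * expR (- (ln 2 * l)) = expR (ln 2 + - (ln 2 * l)))%R.
  by rewrite expRD e2.
rewrite E1 E2 ler_expR mulrN [(k%:R * _)%R]mulrC.
have : (ln 2 * l <= ln 2 * k.+1%:R)%R by rewrite ler_wpM2l// ltW.
by rewrite -natr1; lra.
Qed.

(** A point whose leaf has depth n is in n+1 shrunk sets. If n+1 > l then n is at least k, the
    integer part of l, so the point lies in a ball of generation k. That generation has total
    measure at most 2^-k mu(Z B), and 2^-k <= 2 * 2^-l. *)
Let bar_tail (l : R) : (0 < l)%R ->
  mu [set x | l%:E < \esum_(Y in N) (\1_(bar Y) x)%:E] <=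
    (2 * K ^+ 2 * expR (- (ln 2 * l)))%:E * mu B.
Proof.
move=> l0; set L := [set x | _].
pose deep := [set G | N G /\ exists2 n, desc n root G & (l < n.+1%:R)%R].
have LE : L = \bigcup_(G in deep) leaf G.
  apply/seteqP; split=> [x Lx|x [G [NG [n dn ln]] Gx]]; last first.
    by rewrite /L/= (esum_bar1 NG Gx dn) lte_fin.
  have [[Y [NY [G [NG [k dk]] Gx]]]|nb] := pselect (exists Y, N Y /\ bar Y x).
    have [n dn] := N_depth NG; exists G => //; split => //; exists n => //.
    by move: Lx; rewrite /L/= (esum_bar1 NG Gx dn) lte_fin.
  move: Lx; rewrite /L/= esum1 => [|Y NY]; first by rewrite lte_fin ltNge ltW.
  by rewrite indicE memNset// => bY; apply: nb; exists Y.
pose k := Num.truncn l.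
have lk : (l < k.+1%:R)%R by rewrite truncnS_gt.
have kl : (k%:R <= l)%R by rewrite truncn_le ltW.
have sub : L `<=` \bigcup_(Y in desc k root) Y.
  rewrite LE => x [G [NG [n dn ln]] /(leaf_sub NG)[Gx _]].
  have kn : (k <= n)%N by rewrite -ltnS -(ltr_nat R); apply: le_lt_trans ln.
  exists (iter (n - k) up G).
    by have := descendants_sub dn (leq_subr k n); rewrite subKn.
  apply: desc_sub Gx; apply: (descendants_prefix dn).
  exact: leq_subr.
have NB : desc k root `<=` Bs.
  by move=> Y /(descendants_in N_root)/N_ball.
have cdesc : countable (desc k root).
  apply: sub_countable cN; apply: subset_card_le => Y.
  exact: descendants_in.
apply: (@le_trans _ _ (mu (\bigcup_(Y in desc k root) Y))).
  apply: le_measure' => //.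
    rewrite LE; apply: countable_bigcup_measurable => [|G [NG _]].
      by apply: sub_countable cN; apply: subset_card_le => G [].
    exact: leaf_m.
  by apply: (ball_separable bb).
apply: le_trans (measure_bigcup_le_esum mu cdesc _) _.
  by move=> Y /NB BY; exact: (ball_meas bb BY).
apply: (@le_trans _ _ ((2^-1 ^+ k)%:E * mu root)).
  by apply: esum_descendants => // Y; exact: up_children.
rewrite (ball_muE bb (N_ball N_root)) (ball_muE bb BB) -!EFinM lee_fin.
rewrite (_ : (2 * K ^+ 2 * expR (- (ln 2 * l)) * m B =
  2 * expR (- (ln 2 * l)) * (K ^+ 2 * m B))%R); last by ring.
apply: ler_pM; rewrite ?fine_ge0 ?exprn_ge0 ?invr_ge0//; first exact: pow2_le.
exact: Z_le.
Qed.

Lemma quotient_domination : exists (A : set (set X)) (bar : set X -> set X),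
  [/\ A (Z B) /\ (A `<=` Bs /\ sparse mu (2 * K ^+ 2)^-1 A),
      [/\ bar @` A `<=` measurable, martingale_type (bar @` A) &
          shrinking A (bar @` A) bar],
      \bigcup_(G in A) G `<=` Z B,
      forall l : R, (0 < l)%R ->
        mu [set x | l%:E < \esum_(G in A) (\1_(bar G) x)%:E] <=
          (2 * K ^+ 2 * expR (- (ln 2 * l)))%:E * mu B &
      \forall x \ae mu, B x -> bar (Z B) x /\
        `|g x - c (Z B)|%:E <=
          2%:E * \esum_(G in A) ((w G)%:E * (\1_(bar G) x)%:E)].
Proof.
have k2 := K2.
have K4 : (4 <= K ^+ 2)%R by rewrite expr2; nra.
exists N, bar; split.
- split; first exact: N_root; split; first exact: N_ball.
  split; first by rewrite invr_gt0 invf_lt1 ?mulr_gt0//; lra.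
  exists (core \o rep); split=> [G NG|G G' NG NG' [x [xG xG']]].
    have [HG ZG] := repP NG; have [mc cA le] := coreP HG.
    split => //; first exact: core_sub.
    have BA := HBs HG; have fc := fin_num_sub mc (ball_meas bb BA) cA (ball_fin bb BA).
    rewrite (ball_muE bb (N_ball NG)) -(fineK fc) -EFinM lee_fin.
    rewrite ler_pdivrMl; last by lra.
    have := Z_le BA; rewrite ZG => h1.
    have : (K ^+ 2 * m (rep G) <= K ^+ 2 * (2 * m (core (rep G))))%R.
      by rewrite ler_wpM2l ?sqr_ge0//; lra.
    by rewrite /=; lra.
  have [HG <-] := repP NG; have [HG' <-] := repP NG'.
  by congr Z; apply: tcore => //; exists x.
- split; [by move=> _ [Y _ <-]; exact: bar_m|exact: bar_mart|].
  split; last by move=> Y _; exact: bar_sub.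
  split; [by move=> Y NY; exists Y| |by move=> _ [Y NY <-]; exists Y].
  by move=> Y Y' /set_mem NY /set_mem NY'; exact: bar_inj.
- move=> x [Y NY Yx]; have [n dn] := N_depth NY; exact: desc_sub dn _ Yx.
- exact: bar_tail.
- have : \forall x \ae mu, B x -> exists2 A, H A & br A x /\ ~ D (Z A) x by [].
  apply: filterS => x h /h[A HA [Ax nD]].
  have ZAx : Z A x.
    exact: (sub_bracket bb (bracket_ball bb (HBs HA))).
  have NA : N (Z A) by exists A.
  have [G NG Gx] := leaf_cover NA ZAx nD.
  have [n dn] := N_depth NG; split.
    by exists G => //; split => //; exists n.
  rewrite (esum_bar (F := fun Y => (w Y)%:E) _ NG Gx dn); last first.
    by move=> Y /N_ball BY; rewrite lee_fin w0.
  by rewrite sumEFin -EFinM lee_fin; exact: chain_le.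
Qed.

End Quotient.

Lemma tree_domination : exists (A : set (set X)) (bar : set X -> set X),
  [/\ A (Z B) /\ (A `<=` Bs /\ sparse mu (2 * K ^+ 2)^-1 A),
      [/\ bar @` A `<=` measurable, martingale_type (bar @` A) &
          shrinking A (bar @` A) bar],
      \bigcup_(G in A) G `<=` Z B,
      forall l : R, (0 < l)%R ->
        mu [set x | l%:E < \esum_(G in A) (\1_(bar G) x)%:E] <=
          (2 * K ^+ 2 * expR (- (ln 2 * l)))%:E * mu B &
      \forall x \ae mu, B x -> bar (Z B) x /\
        `|g x - c (Z B)|%:E <=
          2%:E * \esum_(G in A) ((w G)%:E * (\1_(bar G) x)%:E)].
Proof.
have [q0 _ _] := q_bounds.
(* The tree is built with the exceptional set of [[A]] attached to A; relative to A its measure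
   bound is e K^2 instead of e. *)
have [||||H [par [core [[HB HBs cH Hle] Hpar Hch [Hc tc] Hs]]]] :=
  @stopping_tree _ _ _ _ _ _ _ bb dbl K2 B (D \o Z) (e * K ^+ 2) J BB _ _ _ KJ _ qsmall.
- by move=> A /Z_ball/mD.
- by move=> A BA x [].
- move=> A BA /=; apply: le_trans (De (Z_ball BA)) _.
  by rewrite -mulrA ler_wpM2l ?e0// Z_le.
- exact: q0.
exact: (quotient_domination HB HBs cH Hle Hpar Hch Hc tc Hs).
Qed.

End Domination.

(** * Functions with finitely many values and their integrals *)

Section FinitelyValued.
Context d (X : measurableType d) (R : realType) (mu : {measure set X -> \bar R}).

(** The condition of [simple_fun] for values in any type, so that it applies to pairs of simple
    functions and to membership tests. *)
Definition finitely_valued (T : Type) (f : X -> T) :=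
  finite_set (range f) /\ forall p, measurable (f @^-1` [set p]).

Lemma finitely_valued_preimage (T : choiceType) (f : X -> T) P :
  finitely_valued f -> measurable (f @^-1` P).
Proof.
move=> [ff mf]; rewrite (_ : f @^-1` P =
    \bigcup_(p in range f `&` P) f @^-1` [set p]); last first.
  apply/seteqP; split=> [x Px|x [p [_ Pp] fp]]; last by rewrite /preimage/= fp.
  by exists (f x) => //; split => //; exists x.
apply: countable_bigcup_measurable => [|p _]; last exact: mf.
by apply: finite_set_countable; exact: finite_setIl.
Qed.

Lemma finitely_valued_comp (T T' : choiceType) (h : T -> T') (f : X -> T) :
  finitely_valued f -> finitely_valued (h \o f).
Proof.
move=> fv; have [ff _] := fv; split=> [|p].
  have -> : range (h \o f) = h @` range f by rewrite image_comp.
  exact: finite_image.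
exact: (finitely_valued_preimage (h @^-1` [set p]) fv).
Qed.

Lemma finitely_valued_pair (T T' : choiceType) (f : X -> T) (f' : X -> T') :
  finitely_valued f -> finitely_valued f' ->
  finitely_valued (fun x => (f x, f' x)).
Proof.
move=> [ff mf] [ff' mf']; split=> [|[p p']].
  apply: sub_finite_set (finite_setX ff ff') => _ [x _ <-].
  by split; exists x.
rewrite (_ : _ @^-1` _ = f @^-1` [set p] `&` f' @^-1` [set p']).
  exact: measurableI.
by apply/seteqP; split=> x /= [-> ->].
Qed.

Lemma finitely_valued_mem A : measurable A -> finitely_valued (fun x => x \in A).
Proof.
move=> mA; split=> [|b]; first exact: finite_finset.
have [->|->] : b = true \/ b = false by case: b; [left|right].
  by rewrite (_ : _ @^-1` _ = A)//; apply/seteqP; split=> x /=; [exact: set_mem|exact: mem_set].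
rewrite (_ : _ @^-1` _ = ~` A); first exact: measurableC.
by apply/seteqP; split=> x /=; [move=> + Ax; rewrite mem_set|exact: memNset].
Qed.

Lemma finitely_valued_cst (T : Type) (p : T) : finitely_valued (fun=> p).
Proof.
split=> [|p'].
  by apply: (@sub_finite_set _ _ [set p]); [move=> _ [x _ <-]|exact: finite_set1].
have [->|ne] := pselect (p' = p).
  by rewrite (_ : _ @^-1` _ = setT)//; apply/seteqP; split.
by rewrite (_ : _ @^-1` _ = set0)//; apply/seteqP; split => // x /= /esym.
Qed.

Lemma integral_finitely_valued (T : choiceType) (f : X -> T) A (k : T -> R) :
  finitely_valued f -> measurable A -> (forall p, 0 <= k p)%R ->
  \int[mu]_(x in A) (k (f x))%:E =
  \sum_(p \in range f) ((k p)%:E * mu (A `&` f @^-1` [set p])).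
Proof.
move=> fv mA k0; have [ff mf] := fv.
transitivity (\int[mu]_(x in A)
    \sum_(p \in range f) ((k p)%:E * (\1_(f @^-1` [set p]) x)%:E)).
  apply: eq_integral => x _; rewrite (fsbigD1 (f x))//=; last by exists x.
  rewrite indicE mem_set// mule1 fsbig1 ?adde0// => p [_ /= pf].
  by rewrite indicE memNset ?mule0// => /= e; apply: pf; rewrite e.
rewrite ge0_integral_fsum//; last first.
- by move=> p x _; rewrite mule_ge0// lee_fin.
- move=> p; apply: measurable_funeM; apply/measurable_EFinP.
  by apply: measurable_funTS; exact: measurable_indic.
apply: eq_fsbigr => p _; rewrite ge0_integralZl//.
- by rewrite integral_indic// setIC.
- by apply/measurable_EFinP/measurable_funTS; exact: measurable_indic.
- by rewrite lee_fin.
Qed.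

(** Values of f with the same image under h are grouped. With f a pair of simple functions and h a
    projection, both integrals become sums over one common partition. *)
Lemma simple_integral_comp (T : choiceType) (U : normedModType R) (f : X -> T)
    (h : T -> U) A :
  finitely_valued f -> measurable A -> mu A \is a fin_num ->
  simple_integral mu A (h \o f) =
  (\sum_(p \in range f) fine (mu (A `&` f @^-1` [set p])) *: h p)%R.
Proof.
move=> fv mA fA; have [ff mf] := fv; rewrite /simple_integral.
have mAp p : measurable (A `&` f @^-1` [set p]) by exact: measurableI.
have fin p : mu (A `&` f @^-1` [set p]) \is a fin_num.
  rewrite ge0_fin_numE//; apply: (@le_lt_trans _ _ (mu A)).
    by apply: le_measure; [exact: mem_set|exact: mem_set|move=> x []].
  by rewrite -ge0_fin_numE.
have muE u : fine (mu (A `&` (h \o f) @^-1` [set u])) =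
    (\sum_(p <- fset_set (range f) | h p == u)
      fine (mu (A `&` f @^-1` [set p])))%R.
  pose G p := if h p == u then A `&` f @^-1` [set p] else set0.
  rewrite (_ : A `&` _ = \bigcup_(p in range f) G p); last first.
    apply/seteqP; split=> [x [Ax /= hx]|x [p _]].
      by exists (f x); [exists x|rewrite /G hx eqxx].
    by rewrite /G; case: eqP => // <- [Ax /= ->].
  rewrite measure_fin_bigcup//; last 2 first.
  - by move=> p p' _ _ [x []]; rewrite /G; do 2!case: ifP => // _; move=> [_ <-] [_ <-].
  - by move=> p _; rewrite /G; case: ifP.
  rewrite fsbig_finite//= [in RHS]big_mkcond/= -[RHS]/(fine _%:E) -sumEFin.
  congr fine; apply: eq_bigr => p _; rewrite /G.
  by case: ifP => _; rewrite ?measure0// fineK.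
have -> : range (h \o f) = h @` range f by rewrite image_comp.
rewrite fsbig_finite; last exact: finite_image.
rewrite [in RHS]fsbig_finite//= fset_set_image//.
rewrite (partition_big_imfset _ h)/=.
apply: eq_big_seq => u _; rewrite muE scaler_suml.
by apply: eq_bigr => p /eqP ->.
Qed.

Lemma simple_integral_dist (U : normedModType R) (s t : X -> U) A :
  simple_fun s -> simple_fun t -> measurable A -> mu A \is a fin_num ->
  `|simple_integral mu A s - simple_integral mu A t|%:E <=
  \int[mu]_(x in A) `|s x - t x|%:E.
Proof.
move=> ss st mA fA.
have fv : finitely_valued (fun x => (s x, t x)) by exact: finitely_valued_pair.
have Is := simple_integral_comp (fst : U * U -> U) fv mA fA.
have It := simple_integral_comp (snd : U * U -> U) fv mA fA.
rewrite -[_ \o _]/s in Is; rewrite -[_ \o _]/t in It; rewrite Is It {Is It}.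
have [ff mf] := fv.
have := integral_finitely_valued (k := fun p : U * U => `|p.1 - p.2|%R) fv mA.
move=> /(_ (fun p => normr_ge0 _))/= ->.
rewrite !fsbig_finite//= -sumrB.
rewrite (eq_bigr (fun p : U * U => fine (mu (A `&`
  (fun x => (s x, t x)) @^-1` [set p])) *: (p.1 - p.2))%R); last first.
  by move=> p _; rewrite scalerBr.
apply: le_trans (_ : (\sum_(p <- fset_set (range (fun x => (s x, t x))))
  `|fine (mu (A `&` (fun x => (s x, t x)) @^-1` [set p])) *: (p.1 - p.2)|)%R%:E <= _).
  by rewrite lee_fin; exact: ler_norm_sum.
rewrite -sumEFin; apply: lee_sum => p _.
rewrite normrZ ger0_norm ?fine_ge0// mulrC EFinM fineK//.
rewrite ge0_fin_numE//; apply: (@le_lt_trans _ _ (mu A)).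
  apply: le_measure; [apply: mem_set|exact: mem_set|by move=> x []].
  exact: measurableI.
by rewrite -ge0_fin_numE.
Qed.

Lemma simple_integral_cst (U : normedModType R) (u : U) A : A !=set0 ->
  simple_integral mu A (fun=> u) = (fine (mu A) *: u)%R.
Proof.
move=> [x Ax]; rewrite /simple_integral (_ : range _ = [set u]); last first.
  by apply/seteqP; split=> [_ [y _ <-]//|_ ->]; exists x.
by rewrite fsbig_set1 (_ : _ @^-1` _ = setT) ?setIT//; apply/seteqP; split.
Qed.

End FinitelyValued.

(** * Strong measurability *)

Section StronglyMeasurable.
Context d (X : measurableType d) (R : realType) (U : normedModType R).
Implicit Types f h : X -> U.

Lemma strongly_measurable_simple f : simple_fun f -> strongly_measurable f.
Proof. by move=> sf; exists (fun=> f); split => // x; exact: cvg_cst. Qed.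

Lemma strongly_measurable_cst (u : U) : strongly_measurable (fun _ : X => u).
Proof. exact/strongly_measurable_simple/finitely_valued_cst. Qed.

Lemma strongly_measurableD f h : strongly_measurable f ->
  strongly_measurable h -> strongly_measurable (fun x => f x + h x)%R.
Proof.
move=> [s [ss sf]] [t [st th]]; exists (fun n x => s n x + t n x)%R.
split=> [n|x]; last exact: cvgD.
exact: (finitely_valued_comp (fun p : U * U => p.1 + p.2)%R
  (finitely_valued_pair (ss n) (st n))).
Qed.

Lemma strongly_measurableZ (a : R) f : strongly_measurable f ->
  strongly_measurable (fun x => a *: f x)%R.
Proof.
move=> [s [ss sf]]; exists (fun n x => a *: s n x)%R.
split=> [n|x]; last exact: cvgZr.
exact: (finitely_valued_comp (fun u : U => a *: u)%R (ss n)).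
Qed.

Lemma strongly_measurableB f h : strongly_measurable f ->
  strongly_measurable h -> strongly_measurable (fun x => f x - h x)%R.
Proof.
move=> mf mh; under eq_fun do rewrite -scaleN1r.
by apply: strongly_measurableD => //; exact: strongly_measurableZ.
Qed.

Lemma simple_fun_mulind A f : measurable A -> simple_fun f ->
  simple_fun (mulind f A).
Proof.
move=> mA sf; rewrite (_ : mulind f A =
  (fun p : bool * U => p.1%:R *: p.2)%R \o (fun x => (x \in A, f x)))//.
apply: (finitely_valued_comp (T := (bool * U)%type)).
by apply: finitely_valued_pair => //; exact: finitely_valued_mem.
Qed.

Lemma strongly_measurable_mulind A f : measurable A ->
  strongly_measurable f -> strongly_measurable (mulind f A).
Proof.
move=> mA [s [ss sf]]; exists (fun n => mulind (s n) A).
by split=> [n|x]; [exact: simple_fun_mulind|exact: cvgZr].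
Qed.

Lemma strongly_measurable_norm f : strongly_measurable f ->
  measurable_fun setT (fun x => `|f x|%R).
Proof.
move=> [s [ss sf]].
apply: (measurable_fun_cvg (h := fun n x => `|s n x|%R)) => [n _ Y mY|x _].
  rewrite setTI; exact: (finitely_valued_preimage [set u | Y `|u|%R] (ss n)).
exact: cvg_norm.
Qed.

End StronglyMeasurable.

Lemma cvge0_near_lt (R : realType) (u : nat -> \bar R) (e : R) :
  (0 < e)%R -> u n @[n --> \oo] --> 0 -> \forall n \near \oo, u n < e%:E.
Proof.
move=> e0 /fine_cvgP[ufin /cvgr_lt /(_ _ e0) ue].
by near=> n; rewrite -(fineK (near ufin n _))// lte_fin; near: n.
Unshelve. all: by end_near. Qed.

(** * The Bochner integral as a limit of simple integrals *)

Section BochnerMean.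
Context d (X : measurableType d) (R : realType) (mu : {measure set X -> \bar R}).

Lemma strongly_measurable_enorm (U : normedModType R) (f : X -> U) D :
  strongly_measurable f -> measurable_fun D (fun x => `|f x|%:E).
Proof.
move=> mf; apply/measurable_EFinP; apply: measurable_funTS.
exact: strongly_measurable_norm.
Qed.

Lemma integral_norm_triangle (U : normedModType R) (p u v : X -> U) A :
  measurable A -> strongly_measurable p -> strongly_measurable u ->
  strongly_measurable v -> (forall x, `|p x| <= `|u x| + `|v x|)%R ->
  \int[mu]_(x in A) `|p x|%:E <=
  \int[mu]_(x in A) `|u x|%:E + \int[mu]_(x in A) `|v x|%:E.
Proof.
move=> mA mp mu' mv tri; rewrite -ge0_integralD//; last 2 first.
- exact: strongly_measurable_enorm.
- exact: strongly_measurable_enorm.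
apply: ge0_le_integral => //.
- exact: strongly_measurable_enorm.
- by apply: emeasurable_funD; exact: strongly_measurable_enorm.
- by move=> x _; rewrite -EFinD lee_fin.
Qed.

(* Simple approximations of [f] dominated by [2 |f|]. *)
Lemma simple_approximation (U : normedModType R) (f : X -> U) A :
  measurable A -> strongly_measurable f ->
  \int[mu]_(x in A) `|f x|%:E < +oo ->
  exists s : nat -> X -> U, (forall n, simple_fun (s n)) /\
    \int[mu]_(x in A) `|f x - s n x|%:E @[n --> \oo] --> 0.
Proof.
move=> mA mf foo; have [s [ss sf]] := mf.
pose E n := [set x | (`|s n x| <= 2 * `|f x|)%R].
have mE n : measurable (E n).
  have m1 := strongly_measurable_norm (strongly_measurable_simple (ss n)).
  have m2 : measurable_fun setT (fun x => (2 * `|f x|)%R).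
    by apply: measurable_funM => //; exact: strongly_measurable_norm.
  have := measurable_fun_ler m1 m2.
  by move=> /(_ measurableT [set true]); rewrite setTI; apply.
pose t n := mulind (s n) (E n).
have st n : simple_fun (t n) by exact: simple_fun_mulind.
have mft n : strongly_measurable (fun x => f x - t n x)%R.
  by apply: strongly_measurableB => //; exact: strongly_measurable_simple.
exists t; split => //.
have t_le n x : (`|t n x| <= 2 * `|f x|)%R.
  rewrite /t /mulind indicE; case: (boolP (x \in E n)) => [/set_mem|_].
    by rewrite scale1r.
  by rewrite scale0r normr0 mulr_ge0.
have tf x : t n x @[n --> \oo] --> f x.
  have [fx0|fx0] := eqVneq (f x) 0%R.
    rewrite (_ : (fun n => t n x) = fun=> 0%R) ?fx0; first exact: cvg_cst.
    apply/funext => n; have := t_le n x.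
    by rewrite fx0 normr0 mulr0 normr_le0 => /eqP.
  apply: cvg_trans (sf x); apply: near_eq_cvg; near=> n.
  rewrite /t /mulind indicE mem_set ?scale1r// /E /=.
  rewrite -[s n x](subrK (f x)) (le_trans (ler_normD _ _))//.
  rewrite mulr_natl mulr2n lerD2r//.
  rewrite distrC ltW//; near: n.
  have : (0 < `|f x|)%R by rewrite normr_gt0.
  by move: (sf x) => /cvgrPdist_lt/[apply].
have [] := @dominated_convergence _ _ _ mu A mA
  (fun n x => `|f x - t n x|%:E) (fun=> 0) (fun x => 3%:E * `|f x|%:E).
- by move=> n; exact: strongly_measurable_enorm.
- exact: measurable_cst.
- apply/aeW => x _; apply: cvg_EFin; first exact: nearW.
  rewrite -(normr0 U) -(subrr (f x)).
  by apply: cvg_norm; apply: cvgB => //; exact: cvg_cst.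
- apply/integrableP; split.
    by apply: measurable_funeM; exact: strongly_measurable_enorm.
  under eq_integral do rewrite gee0_abs ?mule_ge0// ?lee_fin//.
  rewrite ge0_integralZl//.
    by rewrite lte_mul_pinfty.
  exact: strongly_measurable_enorm.
- apply/aeW => x n _; rewrite /= ger0_norm// -EFinM lee_fin.
  have := ler_normB (f x) (t n x); have := t_le n x; lra.
by move=> _ _; rewrite integral0.
Unshelve. all: by end_near. Qed.

(** The simple integrals of an approximating sequence are Cauchy, so by completeness a limit exists
    and [xget] does not fall back on 0. The estimate then passes to the limit from simple
    functions. *)
Lemma bochner_integral_dist (U : completeNormedModType R) (f : X -> U) A (c : U) :
  A !=set0 -> measurable A -> mu A \is a fin_num -> strongly_measurable f ->
  \int[mu]_(x in A) `|f x|%:E < +oo ->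
  `|bochner_integral mu A f - fine (mu A) *: c|%:E <=
  \int[mu]_(x in A) `|f x - c|%:E.
Proof.
move=> A0 mA fA mf foo; rewrite /bochner_integral.
case: xgetP => [v _ [s [ss sf sv]]|nov]; last first.
  exfalso; have [s [ss sf]] := simple_approximation mA mf foo.
  have msn n := strongly_measurable_simple (ss n).
  suff cv : cvg (simple_integral mu A (s n) @[n --> \oo]).
    by apply: (nov (lim (simple_integral mu A (s n) @[n --> \oo]))); exists s.
  apply: cauchy_cvg; apply: cauchy_exP => e e0.
  have [N _ NP] : \forall n \near \oo,
      \int[mu]_(x in A) `|f x - s n x|%:E < (e / 2)%:E.
    by apply: cvge0_near_lt => //; rewrite divr_gt0.
  exists (simple_integral mu A (s N)); exists N => // n /= Nn.
  rewrite -ball_normE /ball_ /= -lte_fin.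
  apply: le_lt_trans (simple_integral_dist (ss N) (ss n) mA fA) _.
  apply: (@le_lt_trans _ _ (\int[mu]_(x in A) `|f x - s N x|%:E +
      \int[mu]_(x in A) `|f x - s n x|%:E)).
    apply: integral_norm_triangle => //; try exact: strongly_measurableB.
    move=> x; rewrite [leRHS]addrC.
    rewrite (_ : s N x - s n x = (f x - s n x) - (f x - s N x))%R.
      exact: ler_normB.
    by rewrite opprB [RHS]addrC addrA subrK.
  rewrite [ltRHS](_ : _ = (e / 2)%:E + (e / 2)%:E); last first.
    by rewrite -EFinD -splitr.
  by apply: lteD; apply: NP => //=.
apply/lee_addgt0Pr => e e0.
have e20 : (0 < e / 2)%R by rewrite divr_gt0.
have : \forall n \near \oo, \int[mu]_(x in A) `|f x - s n x|%:E < (e / 2)%:E.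
  exact: cvge0_near_lt.
have : \forall n \near \oo, (`|v - simple_integral mu A (s n)| < e / 2)%R.
  by move/cvgrPdist_lt : sv => /(_ _ e20).
move=> [N1 _ N1P] [N2 _ N2P]; pose n := maxn N1 N2.
have h1 := N1P n (leq_maxl _ _); have h2 := N2P n (leq_maxr _ _).
rewrite /= in h1 h2.
have msn := strongly_measurable_simple (ss n).
have mc : strongly_measurable (fun _ : X => c) := strongly_measurable_cst X c.
have h3 := simple_integral_dist (ss n) (finitely_valued_cst X c) mA fA.
rewrite simple_integral_cst// in h3.
have h4 : \int[mu]_(x in A) `|s n x - c|%:E <=
    \int[mu]_(x in A) `|f x - c|%:E + \int[mu]_(x in A) `|f x - s n x|%:E.
  apply: integral_norm_triangle => //; try exact: strongly_measurableB.
  move=> x; rewrite (_ : s n x - c = (f x - c) - (f x - s n x))%R.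
    exact: ler_normB.
  by rewrite opprB [RHS]addrC addrA subrK.
apply: (@le_trans _ _ (`|v - simple_integral mu A (s n)|%:E +
    `|simple_integral mu A (s n) - fine (mu A) *: c|%:E)).
  by rewrite -EFinD lee_fin ler_distD.
apply: (@le_trans _ _ ((e / 2)%:E + (\int[mu]_(x in A) `|f x - c|%:E + (e / 2)%:E))).
  apply: leeD; first by rewrite lee_fin ltW.
  by apply: le_trans h3 _; apply: le_trans h4 _; rewrite leeD2l// ltW.
by rewrite addeCA -EFinD -splitr.
Qed.

End BochnerMean.

(** * Averages of powers of the norm *)

Section PowerIntegrals.
Context d (X : measurableType d) (R : realType) (mu : {measure set X -> \bar R}).
Context (r : R) (U : normedModType R).
Hypothesis r1 : (1 <= r)%R.
Implicit Types (f u v w : X -> U) (A : set X).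

Let r0 : (0 < r)%R. Proof. exact: lt_le_trans r1. Qed.

Lemma measurable_norm_powR f A : strongly_measurable f ->
  measurable_fun A (fun x => (`|f x| `^ r)%:E).
Proof.
move=> mf; apply/measurable_EFinP; apply: measurable_funTS.
apply: (measurableT_comp (measurable_powR r)).
exact: strongly_measurable_norm.
Qed.

Lemma powR_add_le (a b : R) : (0 <= a)%R -> (0 <= b)%R ->
  ((a + b) `^ r <= 2 `^ r * (a `^ r + b `^ r))%R.
Proof.
move=> a0 b0; have ar := powR_ge0 a r; have br := powR_ge0 b r.
wlog ab : a b a0 b0 ar br / (a <= b)%R.
  move=> wl; have [ab|/ltW ba] := leP a b; first exact: wl.
  by rewrite addrC [(a `^ r + _)%R]addrC; exact: wl.
apply: (@le_trans _ _ ((2 * b) `^ r)%R).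
  by have := r0; move=> ?; apply: ge0_ler_powR; rewrite ?nnegrE; lra.
by rewrite powRM// ler_wpM2l ?powR_ge0// lerDr.
Qed.

Lemma integral_powR_add u v w A : measurable A -> strongly_measurable u ->
  strongly_measurable v -> strongly_measurable w ->
  (forall x, A x -> `|w x| <= `|u x| + `|v x|)%R ->
  \int[mu]_(x in A) (`|w x| `^ r)%:E <= (2 `^ r)%:E *
   (\int[mu]_(x in A) (`|u x| `^ r)%:E + \int[mu]_(x in A) (`|v x| `^ r)%:E).
Proof.
move=> mA sm_u mv mw h.
have p0 (f : X -> U) x : 0 <= (`|f x| `^ r)%:E by rewrite lee_fin powR_ge0.
rewrite -ge0_integralD//; try exact: measurable_norm_powR.
rewrite -ge0_integralZl//; last 2 first.
- by apply: emeasurable_funD; exact: measurable_norm_powR.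
- by move=> x _; apply: adde_ge0.
apply: ge0_le_integral => //.
- exact: measurable_norm_powR.
- apply: measurable_funeM.
  by apply: emeasurable_funD; exact: measurable_norm_powR.
- move=> x Ax; rewrite -EFinD -EFinM lee_fin.
  apply: le_trans (powR_add_le _ _) => //.
  by apply: ge0_ler_powR; rewrite ?nnegrE ?addr_ge0 ?h// ltW.
Qed.

Lemma Lr_quasi u v w : Lr mu r u -> Lr mu r v -> strongly_measurable w ->
  (forall x, `|w x| <= `|u x| + `|v x|)%R -> Lr mu r w.
Proof.
move=> [sm_u uoo] [mv voo] mw h; split; first exact: mw.
have hT x : [set: X] x -> (`|w x| <= `|u x| + `|v x|)%R by move=> _; exact: h.
apply: (le_lt_trans (integral_powR_add measurableT sm_u mv mw hT)).
apply: lte_mul_pinfty; [by rewrite lee_fin powR_ge0|by []|].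
exact: (lte_add_pinfty uoo voo).
Qed.

Lemma Lr_const_mulind (c : U) A : measurable A -> mu A \is a fin_num ->
  Lr mu r (mulind (fun=> c) A).
Proof.
move=> mA fA; split.
  by apply: strongly_measurable_mulind => //; exact: strongly_measurable_cst.
have -> : (fun x => (`|mulind (fun=> c) A x| `^ r)%:E) =
    (fun x => (`|c| `^ r)%:E * (\1_A x)%:E).
  apply/funext => x; rewrite /mulind indicE; case: (x \in A).
    by rewrite scale1r mule1.
  by rewrite scale0r normr0 powR0 ?mule0// gt_eqF.
rewrite ge0_integralZl//; last by apply/measurable_EFinP; exact: measurable_indic.
by rewrite integral_indic// setIT lte_mul_pinfty ?lee_fin ?powR_ge0// -ge0_fin_numE.
Qed.

Lemma norm_mulind f A x : (`|mulind f A x| <= `|f x|)%R.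
Proof.
rewrite /mulind indicE; case: (x \in A); first by rewrite scale1r.
by rewrite scale0r normr0.
Qed.

Lemma Lr_mulind f A : measurable A -> Lr mu r f -> Lr mu r (mulind f A).
Proof.
move=> mA [mf foo]; have mfA := strongly_measurable_mulind mA mf.
split; first exact: mfA.
apply: le_lt_trans foo; apply: ge0_le_integral.
- exact: measurableT.
- by move=> x _; rewrite lee_fin powR_ge0.
- exact: measurable_norm_powR.
- exact: measurable_norm_powR.
- move=> x _; rewrite lee_fin.
  by apply: ge0_ler_powR; rewrite ?nnegrE ?norm_mulind// ltW.
Qed.

Section OnSet.
Context (A : set X).
Hypothesis mA : measurable A.
Hypothesis A_gt0 : (0 < fine (mu A))%R.
Local Notation m := (fine (mu A)).

Let fA : mu A = m%:E.
Proof. by move: A_gt0; case: (mu A) => //=; rewrite ltxx. Qed.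

(** This trades the root in [avg] for an inequality between integrals; when the integral is
    infinite, both sides fail. *)
Lemma avg_leP f (a : R) : (0 <= a)%R ->
  avg mu r f A <= a%:E <->
  \int[mu]_(x in A) (`|f x| `^ r)%:E <= (a `^ r * m)%:E.
Proof.
move=> a0; rewrite /avg; set I := \int[mu]_(x in A) _.
have I0 : 0 <= I by apply: integral_ge0 => x _; rewrite lee_fin powR_ge0.
case: I I0 => [i| |//]; last first.
  move=> _; rewrite mulry gtr0_sg ?invr_gt0// mul1e poweRyr ?invr_neq0 ?gt_eqF//.
rewrite lee_fin => i0; rewrite -EFinM poweR_EFin !lee_fin.
have mi0 : (0 <= m^-1 * i)%R by rewrite mulr_ge0// invr_ge0 ltW.
rewrite -ler_pdivrMr// [(i / m)%R]mulrC.
split=> h.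
  have := ge0_ler_powR (ltW r0) _ _ h; rewrite !nnegrE powR_ge0 => /(_ isT a0).
  by rewrite -powRrM mulVf ?gt_eqF// powRr1.
have : (0 <= r^-1)%R by rewrite invr_ge0 ltW.
move=> /ge0_ler_powR /(_ _ _ _ _ h); rewrite !nnegrE powR_ge0 => /(_ mi0 isT).
by rewrite -powRrM mulfV ?gt_eqF// powRr1.
Qed.

Lemma avg_mono u v (a : R) : (0 <= a)%R -> strongly_measurable u ->
  strongly_measurable v -> (forall x, A x -> `|u x| <= `|v x|)%R ->
  avg mu r v A <= a%:E -> avg mu r u A <= a%:E.
Proof.
move=> a0 sm_u mv uv /(avg_leP _ a0) h; apply/(avg_leP _ a0).
apply: le_trans h; apply: ge0_le_integral => //.
- exact: measurable_norm_powR.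
- exact: measurable_norm_powR.
- by move=> x Ax; rewrite lee_fin; apply: ge0_ler_powR; rewrite ?nnegrE ?uv// ltW.
Qed.

(** A quasi-triangle inequality in place of Minkowski's. The factor 4 is 2 * 2: one from (s + t)^r
    <= 2^r (s^r + t^r), the other from a^r + b^r <= 2 (a + b)^r and 2 <= 2^r. *)
Lemma avg_quasi u v w (a b : R) : (0 <= a)%R -> (0 <= b)%R ->
  strongly_measurable u -> strongly_measurable v -> strongly_measurable w ->
  (forall x, A x -> `|w x| <= `|u x| + `|v x|)%R ->
  avg mu r u A <= a%:E -> avg mu r v A <= b%:E ->
  avg mu r w A <= (4 * (a + b))%:E.
Proof.
move=> a0 b0 sm_u mv mw h /(avg_leP _ a0) ha /(avg_leP _ b0) hb.
apply/avg_leP; first by rewrite mulr_ge0// addr_ge0.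
apply: le_trans (integral_powR_add mA sm_u mv mw h) _.
apply: (@le_trans _ _ ((2 `^ r)%:E * ((a `^ r * m)%:E + (b `^ r * m)%:E))).
  by apply: lee_wpmul2l; [rewrite lee_fin powR_ge0|exact: leeD].
rewrite -EFinD -EFinM lee_fin -mulrDl mulrA ler_wpM2r ?(ltW A_gt0)//.
rewrite (_ : 4 * (a + b) = 2 * (2 * (a + b)))%R; last by ring.
rewrite powRM ?mulr_ge0 ?addr_ge0// ler_wpM2l ?powR_ge0//.
rewrite powRM ?addr_ge0//.
have h1 : (a `^ r <= (a + b) `^ r)%R.
  by apply: ge0_ler_powR; rewrite ?nnegrE ?addr_ge0 ?lerDl// ltW.
have h2 : (b `^ r <= (a + b) `^ r)%R.
  by apply: ge0_ler_powR; rewrite ?nnegrE ?addr_ge0 ?lerDr// ltW.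
have h3 : (2 <= 2 `^ r :> R)%R by apply: le1r_powR => //; rewrite ler1n.
have : (2 * (a + b) `^ r <= 2 `^ r * (a + b) `^ r)%R.
  by rewrite ler_wpM2r// powR_ge0.
lra.
Qed.

Lemma avg_cst (c : U) : avg mu r (fun=> c) A <= `|c|%:E.
Proof.
apply/avg_leP => //; rewrite EFinM -fA.
by rewrite (integral_cst mu mA).
Qed.

(** Hoelder's inequality up to a factor 2. Working with b > a allows division by b even when a =
    0. *)
Lemma integral_norm_avg f (a : R) : (0 <= a)%R -> strongly_measurable f ->
  avg mu r f A <= a%:E -> \int[mu]_(x in A) `|f x|%:E <= (2 * a * m)%:E.
Proof.
move=> a0 mf fa.
suff main b : (a < b)%R -> \int[mu]_(x in A) `|f x|%:E <= (2 * b * m)%:E.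
  apply/lee_addgt0Pr => e e0; rewrite -EFinD.
  have -> : (2 * a * m + e = 2 * (a + e / (2 * m)) * m)%R.
    by field; rewrite gt_eqF.
  by apply: main; rewrite ltrDl divr_gt0// mulr_gt0.
move=> ab; have b0 : (0 < b)%R by exact: le_lt_trans ab.
have /(avg_leP _ (ltW b0)) fb : avg mu r f A <= b%:E.
  by apply: le_trans fa _; rewrite lee_fin ltW.
(* pointwise, [t <= b + b (t / b)^r] *)
apply: (@le_trans _ _ (\int[mu]_(x in A)
    (b%:E + (b / b `^ r)%:E * (`|f x| `^ r)%:E))).
  have c0 : (0 <= b / b `^ r)%R by rewrite divr_ge0 ?powR_ge0// ltW.
  apply: ge0_le_integral => //.
  - exact: strongly_measurable_enorm.
  - apply: emeasurable_funD => //.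
    by apply: measurable_funeM; exact: measurable_norm_powR.
  - move=> x _; rewrite -EFinM -EFinD lee_fin.
    have [le|/ltW le] := leP `|f x|%R b.
      by apply: le_trans le _; rewrite lerDl mulr_ge0// powR_ge0.
    rewrite ler_wpDl ?(ltW b0)//.
    rewrite (_ : (_ / _ * _ = b * (`|f x| / b) `^ r)%R); last first.
      have bV : ((b^-1) `^ r = (b `^ r)^-1)%R.
        by rewrite -[in LHS]powR_inv1 ?(ltW b0)// -powRrM mulN1r powRN.
      have tE : ((`|f x| / b) `^ r = `|f x| `^ r / b `^ r)%R.
        by rewrite powRM ?invr_ge0 ?(ltW b0)// bV.
      by rewrite tE mulrAC mulrA.
    rewrite -[leLHS](divfK (lt0r_neq0 b0)) mulrC ler_wpM2l ?(ltW b0)//.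
    by apply: le1r_powR => //; rewrite ler_pdivlMr// mul1r.
have c0 : 0 <= (b / b `^ r)%:E by rewrite lee_fin divr_ge0 ?powR_ge0// ltW.
have p0 x : A x -> 0 <= (`|f x| `^ r)%:E by rewrite lee_fin powR_ge0.
have mp : measurable_fun A (fun x => (`|f x| `^ r)%:E).
  exact: measurable_norm_powR.
have cp0 x : A x -> 0 <= (b / b `^ r)%:E * (`|f x| `^ r)%:E.
  by move=> /p0; exact: mule_ge0.
have mcp : measurable_fun A (fun x => (b / b `^ r)%:E * (`|f x| `^ r)%:E).
  exact: measurable_funeM.
have be0 (x : X) : A x -> 0 <= b%:E by rewrite lee_fin ltW.
rewrite (ge0_integralD mu mA be0 _ cp0 mcp); last exact: measurable_cst.
rewrite (integral_cst mu mA) (ge0_integralZl mu mA mp p0 c0).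
rewrite [mu A]fA -EFinM.
apply: (@le_trans _ _ ((b * m)%:E + (b / b `^ r)%:E * (b `^ r * m)%:E)).
  by apply: leeD2l; exact: lee_wpmul2l.
rewrite -EFinM -EFinD lee_fin mulrA divfK ?gt_eqF ?powR_gt0//; lra.
Qed.

End OnSet.
End PowerIntegrals.

(** * Logarithmic growth of the averages of f minus a mean *)

Section LogArithmetic.
Context {R : realType}.
Local Open Scope ring_scope.

Lemma ln_double_count n (t : R) : 1 <= t -> 2 ^+ n <= t ->
  n.+1%:R * ln 2 <= 2 * ln (1 + t).
Proof.
move=> t1 nt; have t0 : 0 < 1 + t by lra.
have le1 : ln 2 <= ln (1 + t) by rewrite ler_ln ?posrE//; lra.
have le2 : n%:R * ln 2 <= ln (1 + t).
  by rewrite -ln_powR powR_mulrn// ler_ln ?posrE ?exprn_gt0//; lra.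
by rewrite -natr1 mulrDl; lra.
Qed.

Lemma growth_arith n (t s l1 l : R) : 0 <= t -> s <= t -> 0 < l1 ->
  n.+1%:R * l1 <= 2 * l -> 4 * (s + n.+3%:R * t) * l1 <= 20 * t * (2 * l).
Proof.
move=> t0 st l10 ll.
have -> : n.+3%:R = n.+1%:R + 2 :> R by rewrite -addn2 natrD.
have n1 : 1 <= n.+1%:R :> R by rewrite ler1n.
have e1 : 4 * (s + (n.+1%:R + 2) * t) <= 16 * (n.+1%:R * t).
  have : t <= n.+1%:R * t by rewrite ler_peMl.
  by lra.
apply: le_trans (ler_wpM2r (ltW l10) e1) _.
have h : t * (n.+1%:R * l1) <= t * (2 * l) by rewrite ler_wpM2l.
rewrite (_ : 16 * (n.+1%:R * t) * l1 = 16 * (t * (n.+1%:R * l1))); last by ring.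
have : 0 <= t * (n.+1%:R * l1) by rewrite !mulr_ge0// ltW.
by lra.
Qed.

End LogArithmetic.

Section MeanGrowth.
Context d (X : measurableType d) (R : realType).
Context (mu : {measure set X -> \bar R}) (Bs : set (set X)) (K eta r : R).
Context (U : completeNormedModType R).
Hypothesis bb : ball_basis mu Bs K.
Hypothesis dbl : doubling mu Bs eta.
Hypothesis r1 : (1 <= r)%R.
Local Notation m A := (fine (mu A)).
Local Notation Cg := (2 * eta * K ^+ 2)%R.
Local Notation br := (bracket mu Bs K).

Context (f : X -> U).
Hypothesis Lf : Lr mu r f.

Let mf : strongly_measurable f. Proof. by case: Lf. Qed.

Let mfc (c : U) : strongly_measurable (fun x => f x - c)%R.
Proof. by apply: strongly_measurableB => //; exact: strongly_measurable_cst. Qed.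

Lemma Lr_avg_bounded Z : Bs Z -> exists2 a, (0 <= a)%R &
  forall A, Bs A -> Z `<=` A -> avg mu r f A <= a%:E.
Proof.
move=> BZ; have [_ foo] := Lf.
set N := \int[mu]_x _ in foo.
have N0 : 0 <= N by apply: integral_ge0 => x _; rewrite lee_fin powR_ge0.
have fN : N \is a fin_num by rewrite ge0_fin_numE.
have r0 : (0 < r)%R by exact: lt_le_trans r1.
have mZ := ball_gt0 bb BZ.
have q0 : (0 <= fine N / m Z)%R by rewrite divr_ge0 ?fine_ge0.
exists ((fine N / m Z) `^ r^-1)%R; first exact: powR_ge0.
move=> A BA ZA; have mA := ball_gt0 bb BA.
apply/(avg_leP r1 mA); first exact: powR_ge0.
apply: (@le_trans _ _ N).
  apply: ge0_subset_integral => //; first exact: (ball_meas bb BA).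
  exact: measurable_norm_powR.
rewrite -powRrM mulVf ?gt_eqF// powRr1// -(fineK fN) lee_fin.
rewrite -mulrA ler_peMr ?fine_ge0// mulrC ler_pdivlMr// mul1r.
exact: (ball_le bb BZ BA ZA).
Qed.

Lemma Lr_integral_lty A : Bs A -> \int[mu]_(x in A) `|f x|%:E < +oo.
Proof.
move=> BA; have [a a0 /(_ A BA (@subset_refl _ _)) fa] := Lr_avg_bounded BA.
have := integral_norm_avg r1 (ball_meas bb BA) (ball_gt0 bb BA) a0 mf fa.
by move=> /le_lt_trans; apply; rewrite ltry.
Qed.

Lemma mean_dist A (c : U) (y : R) : Bs A ->
  \int[mu]_(x in A) `|f x - c|%:E <= (y * m A)%:E ->
  (`|mean mu f A - c| <= y)%R.
Proof.
move=> BA h; have mA := ball_gt0 bb BA.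
have := bochner_integral_dist c (ball_neq0 bb BA) (ball_meas bb BA)
  (ball_fin bb BA) mf (Lr_integral_lty BA).
move=> /le_trans/(_ h); rewrite lee_fin /mean.
set v := bochner_integral _ _ _.
rewrite (_ : v - m A *: c = m A *: ((m A)^-1 *: v - c))%R; last first.
  by rewrite scalerBr scalerA divff ?gt_eqF// scale1r.
by rewrite normrZ gtr0_norm// mulrC ler_pM2r.
Qed.

Lemma mean_norm_le A (a : R) : Bs A -> (0 <= a)%R -> avg mu r f A <= a%:E ->
  (`|mean mu f A| <= 2 * a)%R.
Proof.
move=> BA a0 fa; rewrite -[mean _ _ _]subr0; apply: mean_dist => //.
rewrite (eq_integral (fun x => `|f x|%:E)) => [|x _]; last by rewrite subr0.
exact: (integral_norm_avg r1 (ball_meas bb BA) (ball_gt0 bb BA) a0 mf fa).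
Qed.

Lemma sharp_le A (a : R) : Bs A -> (0 <= a)%R -> avg mu r f A <= a%:E ->
  sharp mu r f A <= (12 * a)%:E.
Proof.
move=> BA a0 fa; have mA := ball_gt0 bb BA.
rewrite /sharp (_ : 12 * a = 4 * (a + 2 * a))%R; last by ring.
apply: (avg_quasi (u := f) (v := fun=> mean mu f A) r1 (ball_meas bb BA) mA) => //.
- by rewrite mulr_ge0.
- exact: strongly_measurable_cst.
- by move=> x _; exact: ler_normB.
- apply: le_trans (avg_cst r1 (ball_meas bb BA) mA _) _.
  by rewrite lee_fin mean_norm_le.
Qed.

Lemma sharp_star_fin Z : Bs Z -> sharp_star mu Bs r f Z \is a fin_num.
Proof.
move=> BZ; have [a a0 fa] := Lr_avg_bounded BZ.
rewrite ge0_fin_numE.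
  apply: (@le_lt_trans _ _ (12 * a)%:E); last by rewrite ltry.
  by apply: ge_ereal_sup => _ [A [BA ZA] <-]; apply: sharp_le => //; exact: fa.
apply: (@le_trans _ _ (sharp mu r f Z)); first exact: poweR_ge0.
by apply: ereal_sup_ubound; exists Z => //; split.
Qed.

Lemma mean_sub A Q (s : R) : Bs A -> Bs Q -> A `<=` Q -> (0 <= s)%R ->
  sharp mu r f Q <= s%:E ->
  (`|mean mu f A - mean mu f Q| <= 2 * s * (m Q / m A))%R.
Proof.
move=> BA BQ AQ s0 fs; apply: mean_dist => //.
have mA := ball_gt0 bb BA.
rewrite -mulrA divfK ?gt_eqF//.
apply: le_trans (integral_norm_avg r1 (ball_meas bb BQ) (ball_gt0 bb BQ) s0 _ fs).
  apply: ge0_subset_integral => //; [exact: (ball_meas bb BA)|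
    exact: (ball_meas bb BQ)|].
  exact: strongly_measurable_enorm.
exact: mfc.
Qed.

Section Chain.
Context (s : R).
Hypothesis s0 : (0 <= s)%R.
Local Notation c1 := (2 * s * (K * Cg))%R.

Let mean_step Z Q : Bs Z -> Bs Q -> Z `<=` Q -> (m Q <= K * Cg * m Z)%R ->
  sharp mu r f Q <= s%:E -> (`|mean mu f Q - mean mu f Z| <= c1)%R.
Proof.
move=> BZ BQ ZQ mQ fs; rewrite distrC; apply: le_trans (mean_sub BZ BQ ZQ s0 fs) _.
rewrite ler_wpM2l ?mulr_ge0//; have mZ := ball_gt0 bb BZ.
by rewrite ler_pdivrMr.
Qed.

Let Cg1 Z : Bs Z -> [/\ (1 <= K)%R, (1 <= Cg)%R & (0 <= c1)%R].
Proof.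
move=> BZ; have K1 := ball_basis_ge1 bb BZ; have [eta1 _] := dbl.
have k2 : (1 <= K ^+ 2)%R by rewrite expr2; nra.
have C1 : (1 <= Cg)%R by nra.
split => //; have s00 := s0; apply: mulr_ge0; first by lra.
by apply: mulr_ge0; lra.
Qed.

(** Balls are grown from Z until one is at least half as large as A, and a bracket then swallows A;
    each enlargement moves the mean by at most [c1]. The induction asks that A meet Z, not contain
    it, because the growing ball may leave A. The bound M keeps the last ball Q comparable to A. *)
Lemma mean_chain n Z A M : Bs Z -> Bs A -> A `&` Z !=set0 ->
  (m A <= 2 ^+ n.+1 * m Z)%R -> (m Z <= M)%R -> (Cg * m A <= M)%R ->
  (forall Q, Bs Q -> Z `<=` Q -> sharp mu r f Q <= s%:E) ->
  exists Q, [/\ Bs Q, A `<=` Q, (m Q <= K * M)%R &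
    (`|mean mu f Q - mean mu f Z| <= n.+1%:R * c1)%R].
Proof.
have base k Z' : Bs Z' -> Bs A -> A `&` Z' !=set0 ->
    (m A <= 2 * m Z')%R -> (m Z' <= M)%R ->
    (forall Q, Bs Q -> Z' `<=` Q -> sharp mu r f Q <= s%:E) ->
    exists Q, [/\ Bs Q, A `<=` Q, (m Q <= K * M)%R &
      (`|mean mu f Q - mean mu f Z'| <= k.+1%:R * c1)%R].
  move=> BZ BA AZ le ZM fs; have [K1 C1 c10] := Cg1 BZ.
  have Bb := bracket_ball bb BZ; have Zb := sub_bracket bb BZ.
  have mZ := ball_gt0 bb BZ; have bl := bracket_le bb BZ.
  exists (br Z'); split => //; first exact: (engulf bb).
    by apply: le_trans bl _; rewrite ler_wpM2l//; lra.
  apply: (@le_trans _ _ c1); last first.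
    by rewrite ler_peMl// ler1n.
  apply: mean_step => //; last exact: fs.
  by apply: le_trans bl _; rewrite ler_wpM2r ?(ltW mZ)// ler_peMr//; lra.
elim: n Z => [|n IHn] Z BZ BA AZ le ZM AM fs; first exact: base.
have [small|big] := leP (m A) (2 * m Z)%R; first exact: base.
have [K1 C1 c10] := Cg1 BZ; have mZ := ball_gt0 bb BZ.
have [Z' [BZ' ZZ' mZ' Z'big]] := ball_grow bb dbl BZ.
have fs' : forall Q, Bs Q -> Z' `<=` Q -> sharp mu r f Q <= s%:E.
  by move=> Q BQ Z'Q; apply: fs => //; exact: subset_trans Z'Q.
have Z'M : (m Z' <= M)%R.
  have : (Cg * m Z <= Cg * m A)%R by rewrite ler_wpM2l//; lra.
  by move: mZ' AM; lra.
have M0 : (0 <= M)%R by lra.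
have step : (`|mean mu f Z' - mean mu f Z| <= c1)%R.
  apply: mean_step => //; last by apply: fs.
  apply: le_trans mZ' _; rewrite ler_wpM2r ?(ltW mZ)// ler_peMl//; lra.
case: Z'big => [Z'big|Z'T]; last first.
  exists Z'; split => //; [by rewrite Z'T|by apply: le_trans Z'M _; rewrite ler_peMl|].
  apply: le_trans step _.
  by rewrite ler_peMl// ler1n.
have [||Q [BQ AQ mQ QZ']] := IHn Z' BZ' BA _ _ Z'M AM fs'.
- by have [x [Ax Zx]] := AZ; exists x; split => //; exact: ZZ'.
- apply: le_trans le _; rewrite exprS [(2 * _)%R]mulrC -mulrA.
  by rewrite ler_wpM2l// exprn_ge0.
exists Q; split => //.
rewrite (_ : mean mu f Q - mean mu f Z =
  (mean mu f Q - mean mu f Z') + (mean mu f Z' - mean mu f Z))%R; last first.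
  by rewrite addrA subrK.
apply: le_trans (ler_normD _ _) _; rewrite -[n.+2%:R]natr1 mulrDl mul1r.
exact: lerD.
Qed.

(* The averages change by a bounded amount when a ball is enlarged by a bounded
   factor, and [log (1 + mu A / mu Z)] enlargements lead from [Z] to [A]. *)
Lemma avg_log_growth Z A : Bs Z -> Bs A -> Z `<=` A ->
  (forall Q, Bs Q -> Z `<=` Q -> sharp mu r f Q <= s%:E) ->
  avg mu r (fun x => f x - mean mu f (br Z))%R A <=
    (80 * (K * Cg) / ln 2 * s * ln (1 + m A / m Z))%:E.
Proof.
move=> BZ BA ZA fs; have [K1 C1 c10] := Cg1 BZ.
have mZ := ball_gt0 bb BZ; have mA := ball_gt0 bb BA.
have ZmA := ball_le bb BZ BA ZA.
have l2 : (0 < ln 2 :> R)%R by rewrite ln_gt0// ltr1n.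
have KC : (1 <= K * Cg)%R.
  by apply: (le_trans K1); rewrite ler_peMr//; lra.
have /scaleP/andP[nA nA'] : (0 < m Z <= m A)%R by rewrite mZ.
set n := scale (m A) (m Z) in nA nA'.
have AZ0 : A `&` Z !=set0.
  by have [x Zx] := ball_neq0 bb BZ; exists x; split => //; exact: ZA.
have ZM : (m Z <= Cg * m A)%R by apply: le_trans ZmA _; rewrite ler_peMl// ltW.
have [Q [BQ AQ mQ QZ]] := mean_chain BZ BA AZ0 (ltW nA') ZM (lexx _) fs.
have ZQ : Z `<=` Q by exact: subset_trans AQ.
have step1 : (`|mean mu f A - mean mu f Q| <= c1)%R.
  rewrite distrC; apply: mean_step => //; last exact: fs.
  by rewrite -mulrA.
have Bb := bracket_ball bb BZ; have Zb := sub_bracket bb BZ.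
have step2 : (`|mean mu f (br Z) - mean mu f Z| <= c1)%R.
  apply: mean_step => //; last exact: fs.
  apply: le_trans (bracket_le bb BZ) _.
  by rewrite ler_wpM2r ?(ltW mZ)// ler_peMr//; lra.
(* The chain from Z to Q costs n+1 steps, the passage from Q to A one, and that from Z to [Z]
   one. *)
have dist : (`|mean mu f A - mean mu f (br Z)| <= n.+3%:R * c1)%R.
  rewrite (_ : mean mu f A - mean mu f (br Z) = (mean mu f A - mean mu f Q) +
    (mean mu f Q - mean mu f Z) + (mean mu f Z - mean mu f (br Z)))%R; last first.
    by rewrite subrKA subrKA.
  rewrite distrC in step2.
  apply: le_trans (le_trans (ler_normD _ _) (lerD (le_trans (ler_normD _ _)
    (lerD step1 QZ)) step2)) _.
  by move: (2 * s * _)%R => t; rewrite -[n.+3%:R]natr1 -[n.+2%:R]natr1; lra.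
have h : avg mu r (fun x => f x - mean mu f (br Z))%R A <=
    (4 * (s + n.+3%:R * c1))%:E.
  apply: (avg_quasi (u := (fun x => f x - mean mu f A)%R)
    (v := (fun=> mean mu f A - mean mu f (br Z))%R) r1 (ball_meas bb BA) mA) => //.
  - by rewrite mulr_ge0.
  - exact: strongly_measurable_cst.
  - move=> x _; apply: le_trans (ler_normD _ _).
    by rewrite subrKA.
  - exact: fs.
  - apply: le_trans (avg_cst r1 (ball_meas bb BA) mA _) _.
    by rewrite lee_fin.
apply: le_trans h _; rewrite lee_fin.
have sc1 : (s <= c1)%R.
  by have : (s <= s * (K * Cg))%R by [rewrite ler_peMr]; lra.
have lnle : (n.+1%:R * ln 2 <= 2 * ln (1 + m A / m Z))%R.
  by apply: ln_double_count; rewrite ler_pdivlMr// mul1r.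
rewrite (_ : 80 * (K * Cg) / ln 2 * s * ln (1 + m A / m Z) =
  20 * c1 * (2 * ln (1 + m A / m Z)) / ln 2)%R; last by field; rewrite gt_eqF.
rewrite ler_pdivlMr//.
exact: growth_arith c10 sc1 l2 lnle.
Qed.

End Chain.
End MeanGrowth.

(** * Essential suprema and oscillation as statements almost everywhere *)

Section EssentialOscillation.
Context d (X : measurableType d) (R : realType) (mu : {measure set X -> \bar R}).

Lemma ess_sup_onP (E : set X) (h : X -> \bar R) y :
  ess_sup_on mu E h <= y <-> \forall x \ae mu, E x -> h x <= y.
Proof.
rewrite /ess_sup_on; split=> [/ess_supP|hE]; last apply/ess_supP.
  apply: filterS => x + Ex; by rewrite /patch mem_set.
apply: filterS hE => x hE; rewrite /patch; case: ifPn => [/set_mem//|_].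
exact: leNye.
Qed.

Lemma OSC_leP (V : normedModType R) (E : set X) (g : X -> V) (b : R) :
  OSC mu E g <= b%:E <-> \forall x \ae mu, E x ->
    \forall x' \ae mu, E x' -> (`|g x - g x'| <= b)%R.
Proof.
rewrite /OSC; split=> [/ess_sup_onP|h]; last apply/ess_sup_onP.
  apply: filterS => x + Ex => /(_ Ex)/ess_sup_onP.
  by apply: filterS => x' + Ex' => /(_ Ex'); rewrite lee_fin.
apply: filterS h => x + Ex => /(_ Ex) h; apply/ess_sup_onP.
by apply: filterS h => x' + Ex' => /(_ Ex'); rewrite lee_fin.
Qed.

Lemma measure_gt0_ex (E : set X) (P : X -> Prop) : measurable E ->
  0 < mu E -> (\forall x \ae mu, E x -> P x) -> exists2 x, E x & P x.
Proof.
move=> mE E0 [N [mN N0 PN]]; apply: contrapT => nex.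
have EN : E `<=` N.
  by move=> x Ex; apply: PN => /= h; apply: nex; exists x => //; exact: h.
by have := le_measure' mu mE mN EN; rewrite N0 leNgt E0.
Qed.

End EssentialOscillation.

(** * Oscillation of a single operator *)

Section OperatorOscillation.
Context d (X : measurableType d) (R : realType).
Context (mu : {measure set X -> \bar R}) (Bs : set (set X)) (K eta r : R).
Context (U V : completeNormedModType R).
Hypothesis bb : ball_basis mu Bs K.
Hypothesis dbl : doubling mu Bs eta.
Hypothesis r1 : (1 <= r)%R.
Local Notation m A := (fine (mu A)).
Local Notation Cg := (2 * eta * K ^+ 2)%R.
Local Notation br := (bracket mu Bs K).
Local Notation hl := (hull mu Bs).
Local Notation Cl := (80 * (K * Cg) / ln 2)%R.

Context (f : X -> U).
Hypothesis Lf : Lr mu r f.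
Context (Z : set X).
Hypothesis BZ : Bs Z.

Let c := mean mu f (br Z).
Let s := fine (sharp_star mu Bs r f Z).
(** The mean is taken over [Z] because the support Z^* is contained in [Z]: the average over [Z] is
    then bounded by the sharp function at that very ball. *)
Definition near_part := mulind (fun x => f x - mean mu f (br Z))%R (hl Z).

Let mf : strongly_measurable f. Proof. by case: Lf. Qed.

Let mh : measurable (hl Z). Proof. exact: (hull_measurable bb BZ). Qed.

Let h_br : hl Z `<=` br Z. Proof. by have [] := bracketP bb BZ. Qed.

Let Bb : Bs (br Z). Proof. exact: (bracket_ball bb BZ). Qed.

Let sharp_s A : Bs A -> Z `<=` A -> sharp mu r f A <= s%:E.
Proof.
move=> BA ZA; rewrite /s fineK ?(sharp_star_fin bb r1 Lf BZ)//.
by apply: ereal_sup_ubound; exists A.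
Qed.

Let s0 : (0 <= s)%R.
Proof.
rewrite /s fine_ge0//; apply: (@le_trans _ _ (sharp mu r f Z)).
  exact: poweR_ge0.
by apply: ereal_sup_ubound; exists Z => //; split.
Qed.

Lemma near_part_Lr : Lr mu r near_part.
Proof.
have fh : mu (hl Z) \is a fin_num.
  exact: (fin_num_sub mh (ball_meas bb Bb) h_br (ball_fin bb Bb)).
apply: (Lr_quasi r1 Lf (Lr_const_mulind r1 c mh fh)).
  apply: strongly_measurable_mulind => //.
  by apply: strongly_measurableB => //; exact: strongly_measurable_cst.
move=> x; rewrite /near_part /mulind indicE; case: (x \in hl Z).
  by rewrite !scale1r; exact: ler_normB.
by rewrite !scale0r normr0 addr0.
Qed.

Lemma near_part_avg : avg mu r near_part (br Z) <= s%:E.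
Proof.
apply: (avg_mono r1 (ball_meas bb Bb) (ball_gt0 bb Bb) s0 _ _ _ (sharp_s Bb _)).
- by have [] := near_part_Lr.
- by apply: strongly_measurableB => //; exact: strongly_measurable_cst.
- by move=> x _; exact: norm_mulind.
- exact: (sub_bracket bb BZ).
Qed.

Lemma near_part_mulind : mulind near_part (br Z) = near_part.
Proof.
apply/funext => x; rewrite /mulind indicE; case: (boolP (x \in br Z)) => [_|].
  by rewrite scale1r.
move=> /negP nb; rewrite scale0r /near_part /mulind indicE memNset ?scale0r//.
by move=> /h_br bx; apply: nb; exact: mem_set.
Qed.

(* Away from [hull Z] the function is [f - c] on a huge ball [B''] and [f]
   outside of it, where the logarithm in [R4] makes it negligible. *)
Lemma far_part_oscillation (S : (X -> U) -> X -> V) (L1 dl : R) :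
  is_operator mu r S -> is_linear mu r S -> R4 mu Bs r S L1 -> R5 mu Bs S ->
  (0 < dl)%R ->
  \forall x \ae mu, Z x -> \forall x' \ae mu, Z x' ->
    (`|(S f x - S near_part x) - (S f x' - S near_part x')|
      <= L1 * (Cl * s + dl) + dl)%R.
Proof.
move=> opS linS [L10 r4S] r5S dl0.
have mZ := ball_gt0 bb BZ.
have [a a0 fa] := Lr_avg_bounded bb r1 Lf BZ.
have [B0 [BB0 ZB0 B0P]] := r5S Z c dl BZ dl0.
(* For mu(A) >= M the logarithm in (R4) is at least 4 (a + |c|) / dl, while 4 (a + |c|) bounds the
   average of [k] below over any ball A containing Z. So balls A leaving [B2], which have mu(A) >=
   M, contribute at most [dl]. *)
pose M := (m Z * expR (4 * (a + `|c|) / dl))%R.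
have [B1 [BB1 B01 B1big]] := ball_large bb dbl (Num.max M (m (br Z))) BB0.
pose B2 := br B1; have BB2 : Bs B2 by exact: (bracket_ball bb BB1).
have B12 : B1 `<=` B2 by exact: (sub_bracket bb BB1).
have ZB1 : Z `<=` B1 by exact: subset_trans B01.
have hB2 : hl Z `<=` B2.
  apply: subset_trans h_br _.
  case: B1big => [big|B1T]; last by move=> x _; apply: B12; rewrite B1T.
  apply: (engulf bb Bb BB1).
    have : (m (br Z) <= Num.max M (m (br Z)))%R by rewrite le_max lexx orbT.
    by have := ball_gt0 bb BB1; lra.
  have [x Zx] := ball_neq0 bb BZ; exists x; split; last exact: ZB1.
  exact: (sub_bracket bb BZ).
have far A : Bs A -> Z `<=` A -> ~ A `<=` B2 -> (M <= m A)%R.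
  move=> BA ZA nA; rewrite leNgt; apply/negP => lt; apply: nA.
  case: B1big => [big|B1T]; last by move=> x _; apply: B12; rewrite B1T.
  apply: (engulf bb BA BB1).
    have : (M <= Num.max M (m (br Z)))%R by rewrite le_max lexx.
    by have := ball_gt0 bb BB1; lra.
  by have [x Zx] := ball_neq0 bb BZ; exists x; split; [exact: ZA|exact: ZB1].
have mB2 := ball_meas bb BB2.
pose u1 : X -> U := mulind (fun=> c) B2.
have Lu1 : Lr mu r u1 by apply: Lr_const_mulind => //; exact: (ball_fin bb BB2).
have mu1 : strongly_measurable u1 by case: Lu1.
pose k x := (f x - u1 x)%R.
have mk : strongly_measurable k by exact: strongly_measurableB.
have Lk : Lr mu r k by apply: (Lr_quasi r1 Lf Lu1 mk) => x; exact: ler_normB.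
pose u2 := mulind k (~` hl Z).
have Lu2 : Lr mu r u2 by apply: Lr_mulind => //; exact: measurableC.
have logk : log_star mu Bs r k Z <= (Cl * s + dl)%:E.
  apply: ge_ereal_sup => _ [A [BA ZA] <-].
  have mA := ball_gt0 bb BA; have ZmA := ball_le bb BZ BA ZA.
  have t1 : (1 <= m A / m Z)%R by rewrite ler_pdivlMr// mul1r.
  have ln0 : (0 < ln (1 + m A / m Z))%R by rewrite ln_gt0//; lra.
  have [AB|nAB] := pselect (A `<=` B2).
    have [K1 [eta1 _]] := (ball_basis_ge1 bb BZ, dbl).
    have y0 : (0 <= Cl * s * ln (1 + m A / m Z))%R.
      rewrite !mulr_ge0// ?invr_ge0 ?ln_ge0 ?ler1n//; lra.
    have : avg mu r k A <= (Cl * s * ln (1 + m A / m Z))%:E.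
      apply: (avg_mono r1 (ball_meas bb BA) mA y0 mk _ _
        (avg_log_growth bb dbl r1 Lf s0 BZ BA ZA _)).
      - by apply: strongly_measurableB => //; exact: strongly_measurable_cst.
      - move=> x /AB B2x; rewrite /k /u1 /mulind indicE mem_set//.
        by rewrite scale1r.
      - exact: sharp_s.
    move=> /(lee_wpmul2l (x := ((ln (1 + m A / m Z))^-1)%:E)).
    rewrite lee_fin invr_ge0 (ltW ln0) => /(_ isT)/le_trans; apply.
    by rewrite -EFinM lee_fin mulrCA mulVf ?gt_eqF// mulr1 lerDl ltW.
  have : avg mu r k A <= (4 * (a + `|c|))%:E.
    apply: (avg_quasi (u := f) (v := u1) r1 (ball_meas bb BA) mA) => //.
    - by move=> x _; exact: ler_normB.
    - exact: fa.
    - apply: (avg_mono r1 (ball_meas bb BA) mA _ mu1 _ _ (avg_cst r1 _ mA c)) => //.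
      + exact: strongly_measurable_cst.
      + by move=> x _; exact: norm_mulind.
      + exact: (ball_meas bb BA).
  move=> /(lee_wpmul2l (x := ((ln (1 + m A / m Z))^-1)%:E)).
  rewrite lee_fin invr_ge0 (ltW ln0) => /(_ isT)/le_trans; apply.
  rewrite -EFinM lee_fin.
  apply: (@le_trans _ _ dl); last first.
    have [K1 [eta1 _]] := (ball_basis_ge1 bb BZ, dbl).
    rewrite lerDr !mulr_ge0// ?invr_ge0 ?ln_ge0 ?ler1n//; lra.
  rewrite mulrC ler_pdivrMr// [leRHS]mulrC -ler_pdivrMr//.
  have p1 : (0 < 1 + m A / m Z)%R by lra.
  rewrite -[leLHS]expRK ler_ln ?posrE ?expR_gt0//.
  have : (expR (4 * (a + `|c|) / dl) <= m A / m Z)%R.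
    by rewrite ler_pdivlMr// mulrC; exact: far.
  by lra.
have o1 : OSC mu Z (S u1) <= dl%:E.
  by apply: B0P => //; exact: subset_trans B01 B12.
have o2 : OSC mu Z (S u2) <= (L1 * (Cl * s + dl))%:E.
  apply: le_trans (r4S k Lk Z BZ) _; rewrite EFinM.
  by apply: lee_wpmul2l => //; rewrite lee_fin.
have Lh : Lr mu r (fun y => 1 *: u1 y + u2 y)%R.
  apply: (Lr_quasi r1 Lu1 Lu2); last by move=> x; rewrite scale1r; exact: ler_normD.
  apply: strongly_measurableD; last by case: Lu2.
  exact: strongly_measurableZ.
have fE : f = (fun y => 1 *: near_part y + (1 *: u1 y + u2 y))%R.
  apply/funext => x; rewrite !scale1r /near_part /u2 /k /u1 /mulind !indicE.
  case: (boolP (x \in hl Z)) => [hx|nhx].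
    rewrite [x \in B2]mem_set; last by apply: hB2; exact: set_mem.
    rewrite memNset; last by move=> /(_ (set_mem hx)).
    by rewrite !scale1r scale0r addr0 subrK.
  rewrite [x \in ~` _]mem_set; last by move=> hx; move/negP: nhx; apply; exact: mem_set.
  by rewrite scale0r add0r scale1r addrC subrK.
have l1 := linS 1%R _ _ near_part_Lr Lh.
have l2 := linS 1%R _ _ Lu1 Lu2.
rewrite -fE in l1.
have E : \forall x \ae mu, (S f x - S near_part x = S u1 x + S u2 x)%R.
  apply: filterS2 l1 l2 => x -> ->.
  by rewrite !scale1r [(S near_part x + _)%R]addrC addrK.
move: o1 o2 => /OSC_leP o1 /OSC_leP o2.
move: (E) o1 o2; apply: filterS3 => x Ex o1 o2 Zx.
move: (E) (o1 Zx) (o2 Zx); apply: filterS3 => x' Ex' d1 d2 Zx'.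
rewrite Ex Ex' opprD addrACA [leRHS]addrC.
by apply: le_trans (ler_normD _ _) _; apply: lerD; [exact: d1|exact: d2].
Qed.

End OperatorOscillation.

(** * Oscillation of the maximal operator *)

Section MaximalOscillation.
Context d (X : measurableType d) (R : realType).
Context (mu : {measure set X -> \bar R}) (Bs : set (set X)) (K eta r : R).
Context (U V : completeNormedModType R) (I : Type).
Context (Ta : I -> (X -> U) -> X -> V) (T : (X -> U) -> X -> R).
Context (L0 : R) (L1 : I -> R).
Hypothesis bb : ball_basis mu Bs K.
Hypothesis dbl : doubling mu Bs eta.
Hypothesis r1 : (1 <= r)%R.
Hypothesis unif : uniformly_restricted mu Bs r Ta.
Hypothesis maxT : is_maximal_operator mu r Ta T.
Hypothesis weakT : T0 mu Bs r (T : (X -> U) -> X -> R^o) L0.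
Hypothesis r4T : forall a : I, R4 mu Bs r (Ta a) (L1 a).
Hypothesis CTfin : CT L0 L1 < +oo.
Hypothesis i0 : I.
Local Notation m A := (fine (mu A)).
Local Notation Cg := (2 * eta * K ^+ 2)%R.
Local Notation br := (bracket mu Bs K).
Local Notation Cl := (80 * (K * Cg) / ln 2)%R.
Local Notation ct := (fine (CT L0 L1)).

Lemma CT_fine : [/\ CT L0 L1 = ct%:E, (0 <= ct)%R, (L0 <= ct)%R &
  forall a, (L1 a <= ct)%R].
Proof.
have L00 : (0 <= L0)%R by case: weakT.
have L10 a : (0 <= L1 a)%R by case: (r4T a).
set S := ereal_sup (range (fun a => (L1 a)%:E)).
have LS a : (L1 a)%:E <= S by apply: ereal_sup_ubound; exists a.
have S0 : 0 <= S by apply: le_trans (LS i0); rewrite lee_fin.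
have CTS : CT L0 L1 = L0%:E + S by [].
have fS : S \is a fin_num.
  rewrite ge0_fin_numE// -[S]add0e; apply: le_lt_trans CTfin.
  by rewrite CTS; apply: leeD2r; rewrite lee_fin.
have SE : S = (fine S)%:E by rewrite fineK.
rewrite CTS SE -EFinD/=; split => //.
- by rewrite addr_ge0// fine_ge0.
- by rewrite lerDl fine_ge0.
- move=> a; have := LS a; rewrite SE lee_fin => h.
  by apply: (le_trans h); rewrite lerDr.
Qed.

Context (f : X -> U) (Z : set X) (e : R).
Hypothesis Lf : Lr mu r f.
Hypothesis BZ : Bs Z.
Hypothesis e01 : (0 < e < 1)%R.
Local Notation s := (fine (sharp_star mu Bs r f Z)).
Local Notation kap := ((K / e) `^ r^-1)%R.
Local Notation p := (near_part mu Bs K f Z).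

Let s0 : (0 <= s)%R.
Proof.
rewrite fine_ge0//; apply: (@le_trans _ _ (sharp mu r f Z)).
  exact: poweR_ge0.
by apply: ereal_sup_ubound; exists Z => //; split.
Qed.

Let Lp : Lr mu r p. Proof. exact: (near_part_Lr bb r1 Lf BZ). Qed.

Let mTp : measurable_fun setT (T p). Proof. by have [] := maxT Lp. Qed.

Let mg : measurable_fun setT (T f). Proof. by have [] := maxT Lf. Qed.

Let kap0 : (0 < kap)%R.
Proof.
apply: powR_gt0; have /andP[e0 _] := e01; rewrite divr_gt0//.
by have := ball_basis_ge1 bb BZ; lra.
Qed.

Let l0 := (L0 * kap * s)%R.

Let mZ := ball_meas bb BZ.

Let mgt (h : X -> R) (t : R) : measurable_fun setT h ->
  measurable (Z `&` [set x | t < h x]%R).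
Proof.
move=> mh; apply: measurableI => //.
have := measurable_fun_ltr (measurable_cst t) mh.
by move=> /(_ measurableT [set true]); rewrite setTI; apply.
Qed.

(** At the level lambda = L0 (K / e)^(1/r), (T0) on [Z] gives (e / K) mu([Z]) <= e mu(Z). As lambda
    must be positive and L0 may vanish, L0 is replaced by L0 + 1/(n+1), and the resulting sets
    increase to the required one. *)
Let weak_tail : mu (Z `&` [set x | l0 < T p x]%R) <= (e * m Z)%:E.
Proof.
have [L00 wT] := weakT; have r0 : (0 < r)%R by exact: lt_le_trans r1.
have /andP[e0 e1] := e01; have K1 := ball_basis_ge1 bb BZ.
pose la n := ((L0 + n.+1%:R^-1) * kap)%R.
have la0 n : (0 < la n)%R by rewrite mulr_gt0// ltr_wpDl// invr_gt0.
pose F n := Z `&` [set x | la n * s < T p x]%R.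
have Fe n : mu (F n) <= (e * m Z)%:E.
  have := wT p Lp _ _ (bracket_ball bb BZ) (la0 n).
  rewrite (near_part_mulind bb f BZ) => h.
  apply: (@le_trans _ _ (mu (br Z `&` [set x |
      (la n)%:E * avg mu r p (br Z) < `|T p x|%:E]))).
    apply: le_measure'.
    - exact: mgt.
    - apply: measurableI; first exact: (ball_meas bb (bracket_ball bb BZ)).
      have := measurable_lte measurableT
        (measurable_cst ((la n)%:E * avg mu r p (br Z))) (_ : measurable_fun setT (fun x => `|T p x|%:E)).
      rewrite setTI; apply; apply/measurable_EFinP.
      by apply: (measurableT_comp _ mTp).
    - move=> x [Zx lt]; split; first exact: (sub_bracket bb BZ).
      apply: (@le_lt_trans _ _ (la n * s)%:E).
        rewrite [leRHS]EFinM; apply: lee_wpmul2l; first by rewrite lee_fin ltW.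
        exact: (near_part_avg bb r1 Lf BZ).
      by rewrite lte_fin; apply: lt_le_trans lt _; exact: ler_norm.
  apply: le_trans h _; rewrite (ball_muE bb (bracket_ball bb BZ)) -EFinM lee_fin.
  have t0 : (0 < L0 + n.+1%:R^-1)%R by rewrite ltr_wpDl// invr_gt0.
  have le1 : (L0 / la n <= kap^-1)%R.
    rewrite /la invfM mulrA ler_piMl ?invr_ge0 ?(ltW kap0)//.
    by rewrite ler_pdivrMr// mul1r lerDl invr_ge0.
  have le2 : ((L0 / la n) `^ r <= e / K)%R.
    have -> : (e / K = (kap^-1) `^ r)%R.
      have kr : (kap `^ r = K / e)%R.
        by rewrite -powRrM mulVf ?gt_eqF// powRr1// divr_ge0//; lra.
      rewrite -[(kap^-1)%R]powR_inv1 ?(ltW kap0)// -powRrM mulN1r powRN kr.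
      by rewrite invf_div.
    apply: ge0_ler_powR => //; rewrite ?nnegrE; first exact: ltW.
    - by rewrite divr_ge0// ltW.
    - by rewrite invr_ge0 ltW.
  apply: le_trans (ler_wpM2r _ le2) _; first by rewrite fine_ge0.
  rewrite mulrAC -mulrA ler_wpM2l ?(ltW e0)// ler_pdivrMr; last by lra.
  by rewrite mulrC; exact: (bracket_le bb BZ).
have UE : Z `&` [set x | l0 < T p x]%R = \bigcup_n F n.
  apply/seteqP; split=> [x [Zx /= lt]|x [n _ [Zx /= lt]]]; last first.
    split => //=; apply: le_lt_trans lt.
    rewrite /l0 /la ler_wpM2r// ler_wpM2r ?(ltW kap0)//.
    by rewrite lerDl invr_ge0.
  pose gap := (T p x - l0)%R; have g0 : (0 < gap)%R by rewrite subr_gt0.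
  exists (Num.truncn (kap * s / gap)) => //; split => //=.
  set n := Num.truncn _.
  have : (kap * s / gap < n.+1%:R)%R by exact: truncnS_gt.
  rewrite ltr_pdivrMr// -ltr_pdivrMl// => h.
  rewrite /la mulrDl mulrDl -ltrBrDl -/l0 -/gap.
  by rewrite -mulrA.
have ndF : nondecreasing_seq F.
  move=> i j ij; apply/subsetPset => x [Zx /= lt]; split => //=.
  apply: le_lt_trans lt; rewrite /la ler_wpM2r// ler_wpM2r ?(ltW kap0)//.
  by rewrite lerD2l lef_pV2 ?posrE// ler_nat.
have mF n : measurable (F n) by exact: mgt.
have mU : measurable (\bigcup_n F n) by exact: bigcupT_measurable.
rewrite UE; have cv := nondecreasing_cvg_mu (mu := mu) mF mU ndF.
rewrite -(cvg_lim _ cv)//; apply: lime_le; first by apply/cvg_ex; eexists; exact: cv.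
by apply: nearW => n; exact: Fe.
Qed.

Let E0 := Z `\` [set x | l0 < T p x]%R.

Let E0E : E0 = Z `\` (Z `&` [set x | l0 < T p x]%R).
Proof.
apply/seteqP; split=> x [Zx h]; split => //; first by move=> [_ /h].
by move=> lt; apply: h.
Qed.

Let mE0 : measurable E0.
Proof. by rewrite E0E; apply: measurableD => //; exact: mgt. Qed.

Let E0_gt0 : 0 < mu E0.
Proof.
have /andP[e0 e1] := e01; have m0 := ball_gt0 bb BZ.
rewrite ltNge; apply/negP => E00.
have : mu Z <= mu E0 + mu (Z `&` [set x | l0 < T p x]%R).
  have mt := mgt l0 mTp; rewrite E0E.
  apply: le_trans (measureU2 mu (measurableD mZ mt) mt).
  apply: (le_measure' mu mZ); first by apply: measurableU => //; exact: measurableD.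
  by move=> x Zx; have [|] := pselect ((Z `&` [set x | l0 < T p x]%R) x);
    [right|left].
move=> /le_trans/(_ (leeD E00 weak_tail)).
by rewrite add0e (ball_muE bb BZ) lee_fin; nra.
Qed.

Let b := (2 * l0 + ct * (Cl * s))%R.

(** Going from x' to x through the far part of f costs its oscillation plus the near part at both
    points; on [E0] each of the latter is at most [l0], whence the 2 [l0] in [b]. *)
Let alpha_oscillation a (dl : R) : (0 < dl)%R ->
  \forall x \ae mu, E0 x -> \forall x' \ae mu, E0 x' ->
    (`|Ta a f x'| <= T f x + b + dl)%R.
Proof.
move=> dl0; have [resT _ _ _] := unif.
have [[opS _ _] _ linS _ [_ r5S]] := resT a.
have [_ ct0 _ L1ct] := CT_fine.
have d1 : (0 < dl / (ct + 1))%R by rewrite divr_gt0//; lra.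
have far := far_part_oscillation bb dbl r1 Lf BZ opS linS (r4T a) r5S d1.
have [_ ubp _] := maxT Lp; have [_ ubf _] := maxT Lf.
have hp := ubp a; have hf := ubf a.
have L1a0 : (0 <= L1 a)%R by case: (r4T a).
have tot : (L1 a * (Cl * s + dl / (ct + 1)) + dl / (ct + 1) <= ct * (Cl * s) + dl)%R.
  have ds : (dl = ct * (dl / (ct + 1)) + dl / (ct + 1))%R.
    by field; rewrite gt_eqF//; lra.
  rewrite [X in (_ <= _ + X)%R]ds addrA lerD2r -mulrDr ler_wpM2r//.
  have [eta1 _] := dbl; have K1 := ball_basis_ge1 bb BZ.
  by rewrite addr_ge0 ?(ltW d1)// !mulr_ge0// ?invr_ge0 ?ln_ge0 ?ler1n//; lra.
move: far (hp) (hf); apply: filterS3 => x far px fx E0x.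
have Zx : Z x by case: E0x.
move: (far Zx) (hp); apply: filterS2 => x' farx' px' E0x'.
have Zx' : Z x' by case: E0x'.
have plx : (T p x <= l0)%R by rewrite leNgt; apply/negP => lt; case: E0x => _; apply.
have plx' : (T p x' <= l0)%R by rewrite leNgt; apply/negP => lt; case: E0x' => _; apply.
have h := farx' Zx'.
set u := Ta a f x; set u' := Ta a f x'; rewrite -/u -/u' in h fx *.
set v := Ta a p x; set v' := Ta a p x'; rewrite -/v -/v' in h px px'.
have e1 : (`|u'| <= `|u' - v'| + `|v'|)%R.
  by rewrite -{1}[u'](subrK v') ler_normD.
have e2 : (`|u' - v'| <= `|u - v| + `|(u - v) - (u' - v')|)%R.
  by have := ler_normB (u - v)%R ((u - v) - (u' - v'))%R; rewrite subKr.
have e3 := ler_normB u v.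
rewrite /b; lra.
Qed.

(** The centre is the essential infimum M of T f on [E0]. Comparison with a point where T f is
    almost M bounds each |T_a f| on [E0] almost everywhere. As T f is a supremum modulo null sets,
    the bound is transferred by testing minimality against T f truncated on [E0]. *)
Lemma maximal_oscillation : exists q : R,
  (m [set y | Z y /\ ((2 * kap + Cl) * (ct * s) < `|T f y - q|)%R] <= e * m Z)%R.
Proof.
have [_ ct0 L0ct _] := CT_fine.
have [L00 _] := weakT.
have [_ ubf minf] := maxT Lf.
have b0 : (b <= (2 * kap + Cl) * (ct * s))%R.
  have : (l0 <= kap * (ct * s))%R.
    rewrite /l0 mulrA ler_wpM2r// mulrC ler_wpM2l// ltW//.
  by rewrite /b; lra.
pose S : set R := [set t | \forall x \ae mu, E0 x -> (t <= T f x)%R].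
have S0 : S 0%R.
  by apply: filterS (ubf i0) => x h _; exact: le_trans h.
(* A real valued function cannot exceed every integer on the set [E0] of positive measure. *)
have ubS : has_ubound S.
  apply: contrapT => nub.
  have nS n : \forall x \ae mu, E0 x -> (n%:R <= T f x)%R.
    have /existsNP[t /not_implyP[St /negP]] : ~ ubound S n%:R.
      by move=> h; apply: nub; exists n%:R.
    rewrite -ltNge => /ltW nt.
    by apply: filterS St => x h /h; exact: le_trans.
  have := ae_foralln nS => aS.
  have [x E0x /=] := measure_gt0_ex mE0 E0_gt0 (P := fun x => forall n,
    (n%:R <= T f x)%R) (filterS (fun x h Ex n => h n Ex) aS).
  move=> /(_ (Num.truncn (T f x)).+1); rewrite leNgt truncnS_gt.
  by [].
have hS : has_sup S by split => //; exists 0%R.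
set M := sup S.
have lower : \forall x \ae mu, E0 x -> (M <= T f x)%R.
  have nS n : \forall x \ae mu, E0 x -> (M - n.+1%:R^-1 <= T f x)%R.
    have n0 : (0 < n.+1%:R^-1 :> R)%R by rewrite invr_gt0.
    have [t St /ltW Mt] := sup_adherent n0 hS.
    by apply: filterS St => x h /h; exact: le_trans.
  have := ae_foralln nS; apply: filterS => x h Ex.
  apply/ler_addgt0Pr => g g0.
  have : (g^-1 < (Num.truncn g^-1).+1%:R)%R by exact: truncnS_gt.
  set n := Num.truncn _ => ng; have := h n Ex.
  have : (n.+1%:R^-1 <= g)%R by rewrite invf_ple ?posrE// ltW.
  by move: (n.+1%:R^-1)%R => t; lra.
have upper : \forall x \ae mu, E0 x -> (T f x <= M + b)%R.
  have nS n : \forall x \ae mu, E0 x -> (T f x <= M + b + 2 * n.+1%:R^-1)%R.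
    set dl : R := (n.+1%:R^-1)%R; have dl0 : (0 < dl)%R by rewrite invr_gt0.
    pose h x := if x \in E0 then Num.min (T f x) (M + b + 2 * dl)%R else T f x.
    have mh : measurable_fun setT h.
      apply: measurable_fun_ifT => //; last exact: measurable_minr.
      apply: (measurable_fun_bool true) => //.
      rewrite setTI (_ : _ @^-1` _ = E0)//.
      by apply/seteqP; split=> x /=; [exact: set_mem|exact: mem_set].
    have : \forall x \ae mu, (T f x <= h x)%R.
      apply: minf => // a.
      have [x E0x [lt hx]] : exists2 x, E0 x & (T f x < M + dl)%R /\
          \forall x' \ae mu, E0 x' -> (`|Ta a f x'| <= T f x + b + dl)%R.
        apply: contrapT => nx.
        have : S (M + dl)%R.
          apply: filterS (alpha_oscillation a dl0) => x hx E0x.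
          rewrite leNgt; apply/negP => lt; apply: nx; exists x => //.
          by split => //; exact: hx.
        move=> /(ub_le_sup ubS); rewrite -/M; lra.
      move: hx (ubf a); apply: filterS2 => x' hx' ub'.
      rewrite /h; case: ifPn => // /set_mem E0x'.
      rewrite le_min ub'/=; apply: le_trans (hx' E0x') _; lra.
    apply: filterS => x; rewrite /h => + E0x; rewrite mem_set// le_min.
    by move=> /andP[].
  have := ae_foralln nS; apply: filterS => x h Ex.
  apply/ler_addgt0Pr => g g0.
  have : ((g / 2)^-1 < (Num.truncn (g / 2)^-1).+1%:R)%R by exact: truncnS_gt.
  set n := Num.truncn _ => ng; have := h n Ex.
  have g20 : (0 < g / 2)%R by rewrite divr_gt0.
  have : (n.+1%:R^-1 <= g / 2)%R by rewrite invf_ple ?posrE// ltW.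
  by move: (n.+1%:R^-1)%R => t; lra.
exists M; set W := [set y | _].
have mW : measurable W.
  rewrite (_ : W = Z `&` [set y | (2 * kap + Cl) * (ct * s) < `|T f y - M|]%R)//.
  apply: mgt; apply: measurableT_comp => //.
  exact: measurable_funB.
have mt := mgt l0 mTp.
have W0 : mu (W `&` E0) = 0.
  have : \forall x \ae mu, ~ (W `&` E0) x.
    move: lower upper; apply: filterS2 => x lo up [[_ lt] E0x].
    have := lo E0x; have := up E0x => h1 h2.
    move: lt; rewrite ger0_norm ?subr_ge0//; lra.
  move=> [N [mN N0 WN]]; apply/eqP; rewrite eq_le measure_ge0 andbT -N0.
  apply: le_measure' => //; first exact: measurableI.
  by move=> x Wx; apply: WN => /=; apply.
have /andP[e0 e1] := e01.
have : mu W <= (e * m Z)%:E.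
  apply: (@le_trans _ _ (mu (W `&` E0) + mu (Z `&` [set x | l0 < T p x]%R))).
    apply: le_trans (measureU2 mu (measurableI _ _ mW mE0) mt).
    apply: (le_measure' mu mW); first by apply: measurableU => //; exact: measurableI.
    move=> x Wx; have [Zx _] := Wx; have [lt|nlt] := pselect (l0 < T p x)%R.
      by right.
    by left.
  by rewrite W0 add0e.
have fW : mu W \is a fin_num.
  by apply: (fin_num_sub mW mZ _ (ball_fin bb BZ)) => x [].
by rewrite -(fineK fW) lee_fin.
Qed.

End MaximalOscillation.

(** * Medians and centres *)

Section Median.
Context d (X : measurableType d) (R : realType) (mu : {measure set X -> \bar R}).
Context (g : X -> R) (B : set X) (q w : R).

(* A piece of the median has measure more than half of [B], so it meets the set
   where [g] is within [w] of [q], whose oscillation also bounds that of the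
   piece. *)
Lemma median_dist : measurable_fun setT g -> measurable B ->
  mu B \is a fin_num -> (0 <= w)%R ->
  mu (B `&` [set y | w < `|g y - q|]%R) < (2^-1)%:E * mu B ->
  for_all_medians mu g B (fun t => `|t - q| <= 5 * w)%R.
Proof.
move=> mg mB fB w0 small E [mE EB Ebig Eosc].
set D := B `&` _ in small.
have mD : measurable D.
  apply: measurableI => //.
  have mh : measurable_fun setT (fun y => `|g y - q|)%R.
    by apply: measurableT_comp => //; exact: measurable_funB.
  have := measurable_fun_ltr (measurable_cst w) mh.
  by move=> /(_ measurableT [set true]); rewrite setTI; apply.
set G := B `\` D.
have mG : measurable G by exact: measurableD.
have Gw y : G y -> (`|g y - q| <= w)%R.
  by move=> [By nD]; rewrite leNgt; apply/negP => lt; apply: nD.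
have split_half : mu B = (2^-1)%:E * mu B + (2^-1)%:E * mu B.
  rewrite -(fineK fB) -!EFinM -EFinD; congr (_%:E); lra.
have Gbig : (2^-1)%:E * mu B < mu G.
  rewrite ltNge; apply/negP => Gsmall.
  have : mu B <= mu G + mu D.
    apply: le_trans (measureU2 mu mG mD).
    apply: (le_measure' mu mB); first exact: measurableU.
    by move=> x Bx; have [Dx|nD] := pselect (D x); [right|left; split].
  rewrite leNgt [ltRHS]split_half lee_ltD// ge0_fin_numE//.
  by rewrite (le_lt_trans Gsmall)// -(fineK fB) -EFinM ltry.
have oscG : OSC mu G (g : X -> R^o) <= (2 * w)%:E.
  apply/OSC_leP; apply: aeW => x Gx; apply: aeW => x' Gx'.
  have h := Gw _ Gx; have h' := Gw _ Gx'.
  by rewrite -[(g x - g x')%R](subrKA q) (le_trans (ler_normD _ _))// (distrC q); lra.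
(* The set G has oscillation at most 2 w, and a piece at most twice the infimum, so 4 w; the
   distance w from g to q at a common point makes it 5 w. *)
have : OSC mu E (g : X -> R^o) <= (4 * w)%:E.
  apply: (le_trans Eosc); rewrite (_ : 4 * w = 2 * (2 * w))%R; last by ring.
  rewrite [leRHS]EFinM; apply: lee_wpmul2l => //; apply: le_trans oscG.
  by apply: ereal_inf_lbound; exists G => //; split => // x [].
move=> /OSC_leP; apply: filterS => x + Ex => /(_ Ex) hx.
have EG0 : 0 < mu (E `&` G).
  rewrite lt0e measure_ge0 andbT; apply/eqP => EG0.
  have : mu E <= mu (E `&` G) + mu D.
    apply: le_trans (measureU2 mu (measurableI _ _ mE mG) mD).
    apply: (le_measure' mu mE).
      by apply: measurableU => //; exact: measurableI.
    move=> y Ey; have [Dy|nD] := pselect (D y); first by right.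
    by left; split => //; split => //; exact: EB.
  by rewrite EG0 add0e leNgt (lt_trans small).
have [y [Ey Gy] h] := measure_gt0_ex (measurableI _ _ mE mG) EG0
  (P := fun y => (`|g x - g y| <= 4 * w)%R)
  (filterS (fun y (h : E y -> _) (EGy : (E `&` G) y) => h EGy.1) hx).
have h' := Gw _ Gy.
by rewrite -[(g x - q)%R](subrKA (g y)) (le_trans (ler_normD _ _))//; lra.
Qed.

End Median.

(** * Assembling the estimates and fixing the constants *)

Lemma ball_basis_le d (X : measurableType d) (R : realType)
    (mu : {measure set X -> \bar R}) (Bs : set (set X)) (K K' : R) :
  (K <= K')%R -> ball_basis mu Bs K -> ball_basis mu Bs K'.
Proof.
move=> KK' [b0 b1 b2 b3 b4 b5]; split => // A BA.
have [C [BC AC CK]] := b4 A BA; exists C; split => //.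
by apply: (le_trans CK); rewrite lee_wpmul2r// lee_fin.
Qed.

(* If there is no operator, every real function is a supremum of the family, which
   contradicts the minimality of [T f]. *)
Lemma maximal_operator_index d (X : measurableType d) (R : realType)
    (mu : {measure set X -> \bar R}) (r : R) (U V : normedModType R) (I : Type)
    (Ta : I -> (X -> U) -> X -> V) (T : (X -> U) -> X -> R) (f : X -> U)
    (B : set X) :
  is_maximal_operator mu r Ta T -> Lr mu r f -> measurable B -> 0 < mu B ->
  inhabited I.
Proof.
move=> maxT Lf mB B0; apply: contrapT => nI.
have noI (a : I) : False by apply: nI; split.
have [mT _ minT] := maxT f Lf.
have mh : measurable_fun setT (fun x => T f x - 1)%R by exact: measurable_funB.
have h := minT _ mh (fun a => False_ind _ (noI a)).
have [x _] := measure_gt0_ex mB B0 (filterS (fun x hx (_ : B x) => hx) h).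
by rewrite lerBrDr gerDl ler10.
Qed.

Section Domination.
Context d (X : measurableType d) (R : realType).
Context (mu : {measure set X -> \bar R}) (Bs : set (set X)) (K eta r : R).
Context (U V : completeNormedModType R) (I : Type).
Context (Ta : I -> (X -> U) -> X -> V) (T : (X -> U) -> X -> R).
Context (L0 : R) (L1 : I -> R) (e : R) (J : nat).
Hypothesis bb : ball_basis mu Bs K.
Hypothesis dbl : doubling mu Bs eta.
Hypothesis r1 : (1 <= r)%R.
Hypothesis unif : uniformly_restricted mu Bs r Ta.
Hypothesis maxT : is_maximal_operator mu r Ta T.
Hypothesis weakT : T0 mu Bs r (T : (X -> U) -> X -> R^o) L0.
Hypothesis r4T : forall a : I, R4 mu Bs r (Ta a) (L1 a).
Hypothesis CTfin : CT L0 L1 < +oo.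
Hypothesis K2 : (2 <= K)%R.
Hypothesis e01 : (0 < e < 1)%R.
Hypothesis KJ : (2 * K ^+ 2 <= 2 ^+ J)%R.
Hypothesis eK : (e * K ^+ 2 < 2^-1)%R.
Hypothesis qsmall :
  (8 * J.+1%:R * K ^+ 4 * (2 * (2 * eta * K ^+ 2) * (e * K ^+ 2)) <= 1)%R.
Local Notation m A := (fine (mu A)).
Local Notation C1 :=
  (2 * (K / e) `^ r^-1 + 80 * (K * (2 * eta * K ^+ 2)) / ln 2)%R.
Local Notation Z B := (bracket mu Bs K (bracket mu Bs K B)).

Lemma sparse_domination (f : X -> U) (B : set X) : Lr mu r f -> Bs B ->
  exists (A : set (set X)) (bar : set X -> set X),
    [/\ A `<=` Bs /\ sparse mu (2 * K ^+ 2)^-1 A,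
        [/\ bar @` A `<=` measurable, martingale_type (bar @` A) &
            shrinking A (bar @` A) bar],
        \bigcup_(G in A) G `<=` Z B,
        forall l : R, (0 < l)%R ->
          mu [set x | l%:E < \esum_(G in A) (\1_(bar G) x)%:E] <=
            (2 * K ^+ 2 * expR (- (ln 2 * l)))%:E * mu B &
        for_all_medians mu (T f) B (fun t =>
          \forall x \ae mu, B x ->
            `|T f x - t|%:E <= (7 * C1)%:E * CT L0 L1 *
              \esum_(G in A) (sharp_star mu Bs r f G * (\1_(bar G) x)%:E))].
Proof.
move=> Lf BB.
have mB := ball_meas bb BB; have B0 := ball_gt0 bb BB.
have [i0] : inhabited I.
  apply: (maximal_operator_index maxT Lf mB).
  by rewrite (ball_muE bb BB) lte_fin.
have [CTE ct0 _ _] := CT_fine weakT r4T CTfin i0.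
have /andP[e0 e1] := e01; have [eta1 _] := dbl; have k2 := K2.
have C10 : (0 <= C1)%R.
  have [K0 eta0] : (0 <= K)%R /\ (0 <= eta)%R by split; lra.
  by rewrite addr_ge0// !mulr_ge0 ?powR_ge0 ?invr_ge0 ?ln_ge0 ?exprn_ge0 ?ler1n.
have Sfin G : Bs G -> sharp_star mu Bs r f G = (fine (sharp_star mu Bs r f G))%:E.
  by move=> BG; rewrite fineK// (sharp_star_fin bb r1 Lf BG).
have S0 G : Bs G -> (0 <= fine (sharp_star mu Bs r f G))%R.
  move=> BG; rewrite fine_ge0//; apply: (@le_trans _ _ (sharp mu r f G)).
    exact: poweR_ge0.
  by apply: ereal_sup_ubound; exists G => //; split.
pose w G := (C1 * (fine (CT L0 L1) * fine (sharp_star mu Bs r f G)))%R.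
have w0 G : Bs G -> (0 <= w G)%R by move=> BG; rewrite !mulr_ge0// S0.
have osc G : exists q : R, Bs G ->
    (m [set y | G y /\ (w G < `|T f y - q|)%R] <= e * m G)%R.
  have [BG|nB] := pselect (Bs G); last by exists 0%R.
  have [q hq] := maximal_oscillation bb dbl r1 unif maxT weakT r4T CTfin i0
    Lf BG e01.
  by exists q.
have [c De] := choice osc.
have [mT _ _] := maxT Lf.
have [A [bar [[AZ [AB spA]] bA AZB tail dom]]] :=
  tree_domination bb dbl k2 BB mT w0 De KJ (ltW e0) qsmall.
exists A, bar; split => //.
have BZ := AB _ AZ.
have fB := ball_fin bb BB.
have BsubZ : B `<=` Z B.
  apply: subset_trans (sub_bracket bb BB) _.
  exact: (sub_bracket bb (bracket_ball bb BB)).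
have small : mu (B `&` [set y | w (Z B) < `|T f y - c (Z B)|]%R) <
    (2^-1)%:E * mu B.
  have mh : measurable [set y | w (Z B) < `|T f y - c (Z B)|]%R.
    have mh : measurable_fun setT (fun y => `|T f y - c (Z B)|)%R.
      by apply: measurableT_comp => //; exact: measurable_funB.
    have := measurable_fun_ltr (measurable_cst (w (Z B))) mh.
    by move=> /(_ measurableT [set true]); rewrite setTI; apply.
  have mZD := measurableI _ _ (ball_meas bb BZ) mh.
  apply: (@le_lt_trans _ _ (mu (Z B `&` [set y | w (Z B) < `|T f y - c (Z B)|]%R))).
    apply: (le_measure' mu _ mZD); first exact: measurableI.
    by move=> y [By hy]; split => //; exact: BsubZ.
  have fZD := fin_num_sub mZD (ball_meas bb BZ) (fun y h => h.1) (ball_fin bb BZ).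
  rewrite (ball_muE bb BB) -(fineK fZD) -EFinM lte_fin.
  apply: le_lt_trans (De _ BZ) _.
  apply: (@le_lt_trans _ _ (e * (K ^+ 2 * m B))%R).
    by rewrite ler_wpM2l ?(ltW e0)//; exact: (bracket2_le bb BB).
  by rewrite mulrA ltr_pM2r.
have med := median_dist mT mB fB (w0 _ BZ) small.
move=> E pE; move: (med E pE); apply: filterS => y + Ey => /(_ Ey) hy.
move: dom; apply: filterS => x + Bx => /(_ Bx)[barx hx].
set Sg := \esum_(G in A) ((w G)%:E * _) in hx.
(* Every x considered lies in the shrunk set of Z(B), so the median error 5 w(Z(B)) is absorbed by
   the sum: 7 = 2 + 5. *)
have Sg1 : (w (Z B))%:E <= Sg.
  have := @esum_ge1 R _ A (fun G => (w G)%:E * (\1_(bar G) x)%:E) (Z B).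
  rewrite indicE mem_set// mule1; apply => // G AG.
  by rewrite mule_ge0// lee_fin w0//; exact: AB.
have Sg7 : `|T f x - T f y|%:E <= 7%:E * Sg.
  apply: (@le_trans _ _ (`|T f x - c (Z B)|%:E + 5%:E * (w (Z B))%:E)).
    rewrite -EFinM -EFinD lee_fin -[(T f x - T f y)%R](subrKA (c (Z B))).
    by rewrite (le_trans (ler_normD _ _))// lerD2l distrC.
  have Sg_ge0 : 0 <= Sg by apply: le_trans Sg1; rewrite lee_fin w0.
  have -> : 7%:E * Sg = 2%:E * Sg + 5%:E * Sg.
    by rewrite -ge0_muleDl// -EFinD; congr (_%:E * _); ring.
  by rewrite leeD// lee_wpmul2l.
apply: (le_trans Sg7).
have SgE : Sg <= (C1 * fine (CT L0 L1))%:E *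
    \esum_(G in A) (sharp_star mu Bs r f G * (\1_(bar G) x)%:E).
  (* The absolute value makes the terms nonnegative for every set G, as [le_esumZl] requires, and
     changes nothing on A. *)
  rewrite (eq_esum (b := fun G =>
      `|fine (sharp_star mu Bs r f G)|%:E * (\1_(bar G) x)%:E)); last first.
    by move=> G AG; rewrite ger0_norm ?(S0 _ (AB _ AG))// -(Sfin _ (AB _ AG)).
  apply: le_esumZl => [|G|G AG]; first by rewrite mulr_ge0.
    by rewrite mule_ge0// lee_fin.
  by rewrite ger0_norm ?(S0 _ (AB _ AG))// muleA -EFinM /w mulrA.
rewrite CTE -EFinM -(mulrA 7%R) EFinM -muleA.
exact: lee_wpmul2l.
Qed.

End Domination.

Unset Implicit Arguments.
Set Strict Implicit.
Set Printing Implicit Defensive.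

Theorem theorem1p2 (R : realType) (K eta r : R) (hr : (1 <= r)%R) :
  exists C c gamma : R, [/\ (0 < C)%R, (0 < c)%R & (0 < gamma < 1)%R] /\
  forall (d : measure_display) (X : measurableType d)
    (mu : {measure set X -> \bar R}) (Bs : set (set X))
    (U V : completeNormedModType R) (I : Type)
    (Ta : I -> (X -> U) -> X -> V) (T : (X -> U) -> X -> R)
    (L0 : R) (L1 : I -> R),
  ball_basis mu Bs K -> doubling mu Bs eta ->
  uniformly_restricted mu Bs r Ta ->
  is_maximal_operator mu r Ta T ->
  T0 mu Bs r (T : (X -> U) -> X -> R^o) L0 ->
  (forall a : I, R4 mu Bs r (Ta a) (L1 a)) ->
  CT L0 L1 < +oo ->
  forall (f : X -> U) (B : set X), Lr mu r f -> Bs B ->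
  exists (B' : set X) (A Abar : set (set X)) (bar : set X -> set X),
    [/\ Bs B' /\ B `<=` B',
        A `<=` Bs /\ sparse mu gamma A,
        [/\ Abar `<=` measurable, martingale_type Abar & shrinking A Abar bar],
        \bigcup_(G in A) G `<=` B' /\ mu B' <= C%:E * mu B &
        (forall lambda : R, (0 < lambda)%R ->
           mu [set x | lambda%:E < \esum_(G in A) (\1_(bar G) x)%:E]
             <= (C * expR (- (c * lambda)))%:E * mu B) /\
        for_all_medians mu (T f) B (fun m =>
          \forall x \ae mu, B x ->
            `|T f x - m|%:E <= C%:E * CT L0 L1 *
              \esum_(G in A) (sharp_star mu Bs r f G * (\1_(bar G) x)%:E))].
Proof.
(* For eta <= 1 no ball-basis is doubling with this constant, and any constants will do. *)
have [eta1|eta1] := ltP 1%R eta; last first.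
  exists 1%R, 1%R, 2^-1%R; split.
    by split => //; rewrite invr_gt0 ltr0n/= invf_lt1 ?ltr1n.
  move=> d X mu Bs U V I Ta T L0 L1 _ [lt _]; by rewrite ltNge eta1 in lt.
pose K' := Num.max K 2%R.
have [KK' K2] : (K <= K')%R /\ (2 <= K')%R by rewrite !le_max !lexx orbT.
pose J := (Num.truncn (2 * K' ^+ 2)).+1.
(* This e turns [qsmall] into an equality: 8 (J+1) K'^4 times 4 eta K'^2 times e K'^2 is 1. *)
pose e := (32 * J.+1%:R * eta * K' ^+ 8)^-1%R.
have J0 : (1 <= J.+1%:R :> R)%R by rewrite ler1n.
have K21 : (4 <= K' ^+ 2)%R by rewrite expr2; nra.
have K1X n : (1 <= K' ^+ n)%R by rewrite exprn_ege1//; lra.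
have P1 n : (1 <= J.+1%:R * eta * K' ^+ n)%R by rewrite !mulr_ege1// ltW.
have e01 : (0 < e < 1)%R.
  have := P1 8%N; rewrite /e -2!(mulrA 32%R); move: (_ * _)%R => t t1.
  by rewrite invr_gt0 invf_lt1; lra.
have KJ : (2 * K' ^+ 2 <= 2 ^+ J)%R.
  apply: le_trans (ltW (truncnS_gt _)) _.
  by rewrite -natrX ler_nat ltnW// ltn_expl.
have eK : (e * K' ^+ 2 < 2^-1)%R.
  have -> : (e * K' ^+ 2 = (32 * (J.+1%:R * eta * K' ^+ 6))^-1)%R.
    by rewrite /e; field; rewrite !gt_eqF//; lra.
  have := P1 6%N; move: (_ * K' ^+ 6)%R => t t1.
  by rewrite ltf_pV2 ?posrE; lra.
have qsmall : (8 * J.+1%:R * K' ^+ 4 *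
    (2 * (2 * eta * K' ^+ 2) * (e * K' ^+ 2)) <= 1)%R.
  rewrite le_eqVlt; apply/orP; left; apply/eqP; rewrite /e; field.
  by rewrite !gt_eqF//; lra.
pose C1 := (2 * (K' / e) `^ r^-1 + 80 * (K' * (2 * eta * K' ^+ 2)) / ln 2)%R.
(* One constant serves three bounds: K'^2 for mu(B'), 2 K'^2 for the overlap and 7 [C1] for the
   domination. *)
exists (2 * K' ^+ 2 + 7 * C1)%R, (ln 2), (2 * K' ^+ 2)^-1%R.
have C10 : (0 <= C1)%R.
  have [K0 eta0] : (0 <= K')%R /\ (0 <= eta)%R by split; lra.
  by rewrite addr_ge0// !mulr_ge0 ?powR_ge0 ?invr_ge0 ?ln_ge0 ?exprn_ge0 ?ler1n.
have [CK C7] : (2 * K' ^+ 2 <= 2 * K' ^+ 2 + 7 * C1 /\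
  7 * C1 <= 2 * K' ^+ 2 + 7 * C1)%R by split; lra.
split.
  split; [lra|by rewrite ln_gt0// ltr1n|].
  by rewrite invr_gt0 invf_lt1; lra.
move=> d X mu Bs U V I Ta T L0 L1 bbK dbl unif maxT weakT r4T CTfin f B Lf BB.
have bb := ball_basis_le KK' bbK.
have [A [bar [spA barA AB tail med]]] := sparse_domination bb dbl hr unif maxT
  weakT r4T CTfin K2 e01 KJ eK qsmall Lf BB.
have [i0] : inhabited I.
  apply: (maximal_operator_index maxT Lf (ball_meas bb BB)).
  by rewrite (ball_muE bb BB) lte_fin (ball_gt0 bb BB).
have [CTE ct0 _ _] := CT_fine weakT r4T CTfin i0.
exists (bracket mu Bs K' (bracket mu Bs K' B)), A, [set bar G | G in A], bar.
have BT := bracket_ball bb BB; have BZ := bracket_ball bb BT.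
split => //.
- split => //; apply: subset_trans (sub_bracket bb BB) (sub_bracket bb BT).
- split => //; rewrite (ball_muE bb BZ) (ball_muE bb BB) -EFinM lee_fin.
  have := bracket2_le bb BB; have := ball_gt0 bb BB.
  by move: (fine _) (fine _) => a b; nra.
- split => [l l0|E pE].
    apply: (le_trans (tail l l0)); by rewrite lee_wpmul2r// lee_fin ler_wpM2r// expR_ge0.
  move: (med E pE); apply: filterS => y + Ey => /(_ Ey).
  apply: filterS => x + Bx => /(_ Bx) h; apply: (le_trans h).
  rewrite lee_wpmul2r//.
    apply: esum_ge0 => G AG; rewrite mule_ge0// ?lee_fin//.
    apply: (@le_trans _ _ (sharp mu r f G)); first exact: poweR_ge0.
    by apply: ereal_sup_ubound; exists G => //; split => //; apply: spA.1.
  by rewrite CTE -!EFinM lee_fin ler_wpM2r.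
Qed.
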